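(* Let $c>0$, $E\in\mathbb{R}$ and $z\in\mathbb{C}$ with $\operatorname{Im}z>0$, and for $\ell\ge0$ put $z_\ell=E+2^{-\ell}z$. There exist $C_z<\infty$ and $\delta>0$ such that \[\mathbb{E}\,\big|\nu_n(P_{z_\ell})-\nu_{n,m}(P_{z_\ell})\big|\le C_z\,2^{3(\ell-(1+\delta)m)}\] for all integers $0\le m\le n$ and all $\ell\ge n$.
   Context: Let $B_n=\{1,\dots,2^n\}$. For $0\le r\le n$ let $\mathcal{P}_r$ be the partition of $B_n$ into the $2^{n-r}$ consecutive blocks $\{1,\dots,2^r\},\{2^r+1,\dots,2\cdot2^r\},\dots$, and $d(x,y)=\min\{r\ge0: x,y\text{ lie in a common block of }\mathcal{P}_r\}$. $\Phi_{n,r}$ is a real symmetric random matrix on $\ell^2(B_n)$ with independent (up to symmetry) centered Gaussian entries, $\mathbb{E}|\langle\delta_y,\Phi_{n,r}\delta_x\rangle|^2=2^{-r}\cdot2$ if $x=y$, $=2^{-r}$ if $1\le d(x,y)\le r$, $=0$ otherwise; the $\Phi_{n,r}$ for different $r$ are independent. Here (without normalizing constant) $H_n=\sum_{r=0}^n2^{-(1+c)r/2}\Phi_{n,r}$ and $H_{n,m}=\sum_{r=0}^m2^{-(1+c)r/2}\Phi_{n,r}$. Define $\nu_n(f)=2^{-n}\operatorname{Tr}f(H_n)$, $\nu_{n,m}(f)=2^{-n}\operatorname{Tr}f(H_{n,m})$, and the Poisson kernel $P_w(\lambda)=\operatorname{Im}\frac{1}{\lambda-w}=\frac{\operatorname{Im}w}{(\lambda-\operatorname{Re}w)^2+(\operatorname{Im}w)^2}$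 for $\operatorname{Im}w>0$. *)

(* Defs.v *)
From HB Require Import structures.
From mathcomp Require Import all_boot all_order all_algebra.
From mathcomp Require Import all_classical all_reals all_analysis.
From mathcomp Require Import complex.

Set Implicit Arguments.
Unset Strict Implicit.
Unset Printing Implicit Defensive.

Import Order.TTheory GRing.Theory Num.Theory.
Local Open Scope classical_set_scope.
Local Open Scope ring_scope.

(* Index set B_n = {1,...,2^n} is represented by 'I_(2^n) = {0,...,2^n-1}
   (point x in B_n corresponds to the ordinal x-1).                        *)
Notation Bn n := ('I_(2 ^ n)).

(* Hierarchical distance d(x,y) = min { r >= 0 : x,y lie in a common block
   of P_r }.  With 0-based indices i = x-1, j = y-1, the blocks of P_r are
   the classes of i |-> i %/ 2^r.  For i, j < 2^n the minimum is <= n, so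
   searching r in 0..n computes it exactly.                                *)
Definition hdist (n : nat) (i j : nat) : nat :=
  find (fun r => ((i %/ 2 ^ r) == (j %/ 2 ^ r))%N) (iota 0 n.+1).

(* Index set of the independent standard Gaussians used to build
   Phi_{n,0}, ..., Phi_{n,n}: triples (r, i, j); the upper-triangular
   entry (i <= j) of Phi_{n,r} at (i,j) uses the Gaussian (r,i,j). *)
Definition Idx (n : nat) : finType := ('I_n.+1 * Bn n * Bn n)%type.

Definition iid_std_normal {d} {T : measurableType d} {R : realType}
  (P : probability T R) (I : finType) (g : I -> T -> R) : Prop :=
  (forall k, measurable_fun setT (g k)) /\
  (forall k (B : set R), measurable B ->
      P (g k @^-1` B) = normal_prob 0 1 B) /\
  (forall A : I -> set R, (forall k, measurable (A k)) ->
      P [set t | forall k, A k (g k t)] =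
      (\prod_(k : I) P (g k @^-1` A k))%E).

Section Model.
Variable R : realType.

Definition phi_sd (n r : nat) (i j : Bn n) : R :=
  if i == j then Num.sqrt (2 * (2 ^-1) ^+ r)
  else if (1 <= hdist n i j <= r)%N then Num.sqrt ((2 ^-1) ^+ r)
  else 0.

Definition Phi {d} {T : measurableType d} (n : nat) (g : Idx n -> T -> R)
  (r : 'I_n.+1) (t : T) : 'M[R]_(2 ^ n) :=
  \matrix_(i, j) (@phi_sd n r i j *
     (if (i <= j)%N then g (r, i, j) t else g (r, j, i) t)).

Definition Hnm {d} {T : measurableType d} (c : R) (n m : nat)
  (g : Idx n -> T -> R) (t : T) : 'M[R]_(2 ^ n) :=
  \sum_(r < n.+1 | (r <= m)%N)
     powR 2 (- ((1 + c) * r%:R) / 2) *: Phi g r t.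

(* nu(P_w) = 2^-n Tr P_w(A) for the Poisson kernel
   P_w(lambda) = Im w / ((lambda - Re w)^2 + (Im w)^2), applied to the
   real symmetric matrix A by functional calculus:
   P_w(A) = Im w * ((A - Re w)^2 + (Im w)^2)^{-1}. *)
Definition nuP (n : nat) (A : 'M[R]_(2 ^ n)) (w : R[i]) : R :=
  (2 ^-1) ^+ n *
  \tr (complex.Im w *: invmx ((A - (complex.Re w)%:M) *m (A - (complex.Re w)%:M)
                              + ((complex.Im w) ^+ 2)%:M)).

End Model.

Arguments Hnm {R d T} c n m g t.

(* Main.v *)
(** With [G = (H - w)^-1], [nuP] is [2^-n] times [Im tr G].  Interpolate linearly
    between [Hnm m] and [Hnm n], and replace the absolute value of the gap by its
    smoothing [sqrt (x^2 + eps^2)].  Gaussian integration by parts in each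
    entry bounds the growth of the smoothed gap by the entry variances times first
    derivatives squared over [eps], plus second derivatives, of [Im tr G].  By the Ward
    identity, their sums over the entries of one level reduce to
    [Im G_ii] and to [Im G_ii * sum_j |G_jj|], [j] in the block of [i].
    Every [Hnm] contains the level-0 diagonal, so integrating over the [i]-th
    diagonal Gaussian bounds [E Im G_ii] by [pi] (the density is at most 1 and the Poisson
    kernel has mass [pi]) and [E |G_jj|] by a logarithm of [1 / Im w].  For the product,
    the same integration decouples the two factors, because moving one diagonal entry
    changes the sum over [j] of [|G_jj|] by at most [2 / Im w].  Finally
    [eps = 2^(3 (l - m) - c m / 2)] balances the terms, whence [delta = c / 6]. *)

Require Import Defs.
From HB Require Import structures.
From mathcomp Require Import all_boot all_order all_algebra.
From mathcomp Require Import all_classical all_reals all_analysis.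
From mathcomp Require Import measurable_realfun complex ring lra.
Import Order.TTheory GRing.Theory Num.Theory.
Import numFieldNormedType.Exports.
Import ComplexField.Normc.
Local Open Scope ring_scope.

Set Implicit Arguments.
Unset Strict Implicit.
Unset Printing Implicit Defensive.

(** The deterministic bound [1 / eta] on [Im G_ii] is of order [2^l] and would lose a whole power of
    [2^l]; only the average over a level-0 diagonal entry is of order one. The inverse of [G_ii] is
    affine in the [i]-th diagonal entry of [H], so diagonal resolvent entries are what such an
    average controls, and every sum over pairs is first reduced to them pointwise. Products of two
    diagonal entries are the obstacle: averaging for one factor moves the other. A step of the
    interpolation brings one coefficient of each Gaussian and the integration by parts a second one,
    so variances are summed and not standard deviations. For this the reference matrix must be free
    of the Gaussian being integrated; it is, because every Gaussian belongs to a single level. The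
    expectation is never differentiated: a pointwise inequality with quadratic error is integrated
    over short steps, and the errors vanish on subdivision. The logarithm is of order [l], which may
    far exceed [m]; [l <= m + 2^(l - m)] splits it between the decay in [m] and a spare power of
    [2^(l - m)]. *)

Section ComplexParts.
Variable R : realType.
Implicit Types z w : R[i].

Lemma Rec_add z w : complex.Re (z + w) = complex.Re z + complex.Re w.
Proof. by case: z w => [a b] [c d]. Qed.

Lemma Imc_add z w : complex.Im (z + w) = complex.Im z + complex.Im w.
Proof. by case: z w => [a b] [c d]. Qed.

Lemma Rec_mul z w : complex.Re (z * w) =
  complex.Re z * complex.Re w - complex.Im z * complex.Im w.
Proof. by case: z w => [a b] [c d]. Qed.

Lemma Imc_mul z w : complex.Im (z * w) =
  complex.Re z * complex.Im w + complex.Im z * complex.Re w.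
Proof. by case: z w => [a b] [c d]. Qed.

Lemma Rec_opp z : complex.Re (- z) = - complex.Re z.
Proof. by case: z. Qed.

Lemma Imc_opp z : complex.Im (- z) = - complex.Im z.
Proof. by case: z. Qed.

Lemma Rec_sum (I : Type) (r : seq I) (P : pred I) (F : I -> R[i]) :
  complex.Re (\sum_(i <- r | P i) F i) = \sum_(i <- r | P i) complex.Re (F i).
Proof. by apply: (big_morph (@complex.Re R) Rec_add). Qed.

Lemma Imc_sum (I : Type) (r : seq I) (P : pred I) (F : I -> R[i]) :
  complex.Im (\sum_(i <- r | P i) F i) = \sum_(i <- r | P i) complex.Im (F i).
Proof. by apply: (big_morph (@complex.Im R) Imc_add). Qed.

Definition nsq z : R := complex.Re z ^+ 2 + complex.Im z ^+ 2.

Lemma nsq_ge0 z : 0 <= nsq z.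
Proof. by rewrite addr_ge0 ?sqr_ge0. Qed.

Lemma nsq_eq0 z : (nsq z == 0) = (z == 0).
Proof.
by rewrite /nsq paddr_eq0 ?sqr_ge0// !sqrf_eq0 eq_complex.
Qed.

Lemma normc_sqrtE z : normc z = Num.sqrt (nsq z).
Proof. by case: z. Qed.

Lemma normc_ge0 z : 0 <= normc z.
Proof. by rewrite normc_sqrtE sqrtr_ge0. Qed.

Lemma sqr_normcE z : normc z ^+ 2 = nsq z.
Proof. by rewrite normc_sqrtE sqr_sqrtr ?nsq_ge0. Qed.

Lemma ler_normcD z w : normc (z + w) <= normc z + normc w.
Proof. exact: le_normcD. Qed.

Lemma normc_opp z : normc (- z) = normc z.
Proof. exact: normcN. Qed.

Lemma ler_normc_sum (I : Type) (r : seq I) (P : pred I) (F : I -> R[i]) :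
  normc (\sum_(i <- r | P i) F i) <= \sum_(i <- r | P i) normc (F i).
Proof.
elim/big_rec2: _ => [|i y x _ ih]; first by rewrite normc0.
by rewrite (le_trans (ler_normcD _ _))// lerD2l.
Qed.

Lemma Im_le_normc z : `|complex.Im z| <= normc z.
Proof.
by rewrite normc_sqrtE -sqrtr_sqr ler_wsqrtr// /nsq lerDr sqr_ge0.
Qed.

Lemma normc_real (x : R) : normc (real_complex R x) = `|x|.
Proof. by rewrite normc_sqrtE /nsq/= expr0n addr0 sqrtr_sqr. Qed.

Lemma normc_eq0 z : (normc z == 0) = (z == 0).
Proof. by rewrite normc_sqrtE sqrtr_eq0 le_eqVlt nsq_eq0 ltNge nsq_ge0 orbF. Qed.

Lemma ler_dist_normc z w : `|normc z - normc w| <= normc (z - w).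
Proof.
rewrite ler_norml; apply/andP; split.
  by rewrite lerBrDl lerBlDr -(normc_opp (z - w)) opprB addrC
     (le_trans _ (ler_normcD _ _))// subrK.
by rewrite lerBlDr (le_trans _ (ler_normcD _ _))// subrK.
Qed.

Lemma Imc_inv z : complex.Im z^-1 = - complex.Im z / nsq z.
Proof. by case: z => a b; rewrite mulNr. Qed.

Lemma Rec_inv z : complex.Re z^-1 = complex.Re z / nsq z.
Proof. by case: z. Qed.

End ComplexParts.

Lemma mulmx_col (S : pzSemiRingType) m n p (A : 'M[S]_(m, n)) (B : 'M[S]_(n, p)) j :
  col j (A *m B) = A *m col j B.
Proof. by rewrite !colE mulmxA. Qed.

(** * Resolvents of real symmetric matrices *)

Section Resolvent.
Variables (R : realType) (N : nat) (w : R[i]).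
Hypothesis w_gt0 : 0 < complex.Im w.
Implicit Types (H : 'M[R]_N).
Local Notation eta := (complex.Im w).
Local Notation toC := (map_mx (real_complex R)).

Definition shifted H : 'M[R[i]]_N := toC H - w%:M.
Definition resolvent H : 'M[R[i]]_N := invmx (shifted H).
Local Notation G := resolvent.

(** Pair [shifted H *m v] with the conjugate of [v] and take minus the imaginary part: the quadratic
    form of a real symmetric matrix is real, so only [w] contributes. Invertibility, the Ward
    identity and the contraction bound all come from this. *)
Lemma energy_identity H (v : 'cV[R[i]]_N) : H^T = H ->
  eta * \sum_a nsq (v a 0) = \sum_a
    (complex.Re ((shifted H *m v) a 0) * complex.Im (v a 0) -
     complex.Im ((shifted H *m v) a 0) * complex.Re (v a 0)).
Proof.
move=> Hs.
have E a : (shifted H *m v) a 0 =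
    \sum_b real_complex R (H a b) * v b 0 - w * v a 0.
  rewrite /shifted mulmxBl mul_scalar_mx !mxE; congr (_ - _).
  by apply: eq_bigr => b _; rewrite !mxE.
(* Up to sign this is the imaginary part of the quadratic form of [H]; swapping [a] and [b] changes
   its sign. *)
have anti : \sum_a \sum_b H a b *
    (complex.Re (v b 0) * complex.Im (v a 0) -
     complex.Im (v b 0) * complex.Re (v a 0)) = 0.
  set S := LHS; suff : S = - S by lra.
  rewrite /S {1}exchange_big -sumrN; apply: eq_bigr => a _.
  rewrite -sumrN; apply: eq_bigr => b _.
  have -> : H b a = H a b by rewrite -[in LHS]Hs mxE.
  by ring.
rewrite -[RHS]subr0 -[X in _ = _ - X]anti mulr_sumr -sumrB; apply: eq_bigr => a _.
rewrite E !Rec_add !Imc_add !Rec_opp !Imc_opp Rec_sum Imc_sum !Rec_mul !Imc_mul.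
under eq_bigr do rewrite Rec_mul/= mul0r subr0.
rewrite [X in _ = (_ - (X + _) * _) - _](_ : _ =
  \sum_b H a b * complex.Im (v b 0)); last first.
  by apply: eq_bigr => b _; rewrite Imc_mul/= mul0r addr0.
have -> : \sum_b H a b * (complex.Re (v b 0) * complex.Im (v a 0) -
     complex.Im (v b 0) * complex.Re (v a 0)) =
  (\sum_b H a b * complex.Re (v b 0)) * complex.Im (v a 0) -
  (\sum_b H a b * complex.Im (v b 0)) * complex.Re (v a 0).
  by rewrite !mulr_suml -sumrB; apply: eq_bigr => b _; ring.
by rewrite /nsq; ring.
Qed.

Lemma shifted_tr H : H^T = H -> (shifted H)^T = shifted H.
Proof. by move=> Hs; rewrite /shifted linearB/= tr_scalar_mx map_trmx Hs. Qed.

Lemma shifted_unit H : H^T = H -> shifted H \in unitmx.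
Proof.
move=> Hs; rewrite unitmxE unitfE; apply/det0P => -[v v0 vH].
have Hv : shifted H *m v^T = 0.
  by rewrite -(shifted_tr Hs) -trmx_mul vH trmx0.
have := energy_identity v^T Hs; rewrite Hv.
rewrite [RHS]big1; last by move=> a _; rewrite mxE/= !mul0r subrr.
move/eqP; rewrite mulf_eq0 gt_eqF//= psumr_eq0; last by move=> *; exact: nsq_ge0.
move=> /allP v'0; case/negP: v0; apply/eqP/rowP => a.
by have := v'0 a (mem_index_enum _); rewrite /= nsq_eq0 => /eqP; rewrite !mxE.
Qed.

Lemma mul_shifted_resolvent H : H^T = H -> shifted H *m G H = 1%:M.
Proof. by move=> Hs; rewrite mulmxV ?shifted_unit. Qed.

Lemma mul_resolvent_shifted H : H^T = H -> G H *m shifted H = 1%:M.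
Proof. by move=> Hs; rewrite mulVmx ?shifted_unit. Qed.

Lemma resolvent_sym H a b : H^T = H -> G H a b = G H b a.
Proof. by move=> Hs; rewrite /resolvent -[in RHS](shifted_tr Hs) -trmx_inv mxE. Qed.

(** [energy_identity] for column [a] of the resolvent: [shifted H] maps that column to a unit
    vector, so only the term [a] survives on the right. *)
Lemma ward H a : H^T = H -> eta * \sum_b nsq (G H b a) = complex.Im (G H a a).
Proof.
move=> Hs; have := energy_identity (col a (G H)) Hs.
rewrite -mulmx_col (mul_shifted_resolvent Hs).
under eq_bigr do rewrite mxE.
move=> ->; rewrite (bigD1 a)//= big1 ?addr0; last first.
  by move=> b ba; rewrite !mxE (negbTE ba)/= !mul0r subrr.
by rewrite !mxE eqxx/= mul1r mul0r subr0.
Qed.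

Lemma Im_resolvent_ge0 H a : H^T = H -> 0 <= complex.Im (G H a a).
Proof.
by move=> Hs; rewrite -ward// mulr_ge0 ?(ltW w_gt0)// sumr_ge0// => *; exact: nsq_ge0.
Qed.

Lemma nsq_resolvent_le H a b : H^T = H ->
  eta * nsq (G H b a) <= complex.Im (G H a a).
Proof.
move=> Hs; rewrite -ward// ler_pM2l// (bigD1 b)//= lerDl sumr_ge0// => *.
exact: nsq_ge0.
Qed.

(** Divide the chain [eta * |G_aa|^2 <= Im G_aa <= |G_aa|] by [|G_aa|]. *)
Lemma normc_resolvent_diag_le H a : H^T = H -> normc (G H a a) <= eta^-1.
Proof.
move=> Hs; have := nsq_resolvent_le a a Hs; rewrite -sqr_normcE.
have := Im_le_normc (G H a a); have := ler_norm (complex.Im (G H a a)).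
have := normc_ge0 (G H a a).
set x := normc _; set y := complex.Im _ => x0 h1 h2 h3.
rewrite -[eta^-1]mul1r ler_pdivlMr//.
have [->|xn0] := eqVneq x 0; first by rewrite mul0r ler01.
have xp : 0 < x by rewrite lt_def xn0.
by rewrite -(ler_pM2l xp) mulr1; nra.
Qed.

Lemma Im_resolvent_le H a : H^T = H -> complex.Im (G H a a) <= eta^-1.
Proof.
move=> Hs; rewrite (le_trans (ler_norm _))// (le_trans (Im_le_normc _))//.
exact: normc_resolvent_diag_le.
Qed.

Lemma normc_resolvent_le H a b : H^T = H -> normc (G H a b) <= eta^-1.
Proof.
move=> Hs; have i0 : 0 <= eta^-1 by rewrite invr_ge0 ltW.
rewrite -(ler_pXn2r (ltn0Sn 1)) ?nnegrE ?normc_ge0// sqr_normcE.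
rewrite -(ler_pM2l w_gt0) (le_trans (nsq_resolvent_le _ _ Hs))//.
by rewrite (le_trans (Im_resolvent_le _ Hs))// expr2 mulVKf ?gt_eqF.
Qed.

(** Young's inequality on the right side of [energy_identity] produces half of the left side, which
    is absorbed. *)
Lemma resolvent_contraction H (v : 'cV[R[i]]_N) : H^T = H ->
  eta ^+ 2 * \sum_a nsq ((G H *m v) a 0) <= \sum_a nsq (v a 0).
Proof.
move=> Hs; have := energy_identity (G H *m v) Hs.
rewrite mulmxA (mul_shifted_resolvent Hs) mul1mx => E.
suff : eta * \sum_a nsq ((G H *m v) a 0) <=
   \sum_a (eta * nsq ((G H *m v) a 0) / 2 + (2 * eta)^-1 * nsq (v a 0)).
  rewrite [X in _ <= X -> _]big_split/=.
  have -> : \sum_a eta * nsq ((G H *m v) a 0) / 2 =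
      eta * (\sum_a nsq ((G H *m v) a 0)) / 2.
    by rewrite mulr_sumr mulr_suml.
  rewrite -mulr_sumr; set X := \sum_a _; set Y := \sum_a _ => h.
  have h2 : eta * X / 2 <= (2 * eta)^-1 * Y by lra.
  have e2 : 0 < 2 * eta by rewrite mulr_gt0.
  have : (2 * eta) * (eta * X / 2) <= (2 * eta) * ((2 * eta)^-1 * Y).
    by rewrite ler_pM2l.
  by rewrite mulVKf ?gt_eqF//; lra.
rewrite E; apply: ler_sum => a _.
have e2 : 0 < 2 * eta by rewrite mulr_gt0.
rewrite -(ler_pM2l e2) [leRHS]mulrDr mulVKf ?gt_eqF// /nsq.
have := sqr_ge0 (complex.Re (v a 0) - eta * complex.Im ((G H *m v) a 0)).
have := sqr_ge0 (complex.Im (v a 0) + eta * complex.Re ((G H *m v) a 0)).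
nra.
Qed.

Lemma sum_nsq_sqr_resolvent_le H a : H^T = H ->
  eta ^+ 3 * \sum_b nsq ((G H *m G H) b a) <= complex.Im (G H a a).
Proof.
move=> Hs; rewrite -ward// exprS -mulrA ler_pM2l//.
have := resolvent_contraction (col a (G H)) Hs; rewrite -mulmx_col.
by under eq_bigr do rewrite mxE; under [leRHS]eq_bigr do rewrite mxE.
Qed.

(** Since [G] is symmetric, the diagonal entry of its square is a sum of squares [G_ba^2], whose
    absolute values are exactly the terms of the Ward identity. *)
Lemma normc_sqr_resolvent_diag_le H a : H^T = H ->
  eta * normc ((G H *m G H) a a) <= complex.Im (G H a a).
Proof.
move=> Hs; rewrite -ward// ler_pM2l// mxE (le_trans (ler_normc_sum _ _ _))//.
apply: ler_sum => b _; rewrite normcM (resolvent_sym _ _ Hs) -expr2.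
by rewrite sqr_normcE.
Qed.

Lemma resolvent_identity H H' : H^T = H -> H'^T = H' ->
  G H' = G H - G H' *m toC (H' - H) *m G H.
Proof.
move=> Hs Hs'.
have -> : toC (H' - H) = shifted H' - shifted H.
  by rewrite /shifted opprB addrA subrK map_mxB.
rewrite mulmxBr mulmxBl -(mulmxA _ (shifted H)) mul_shifted_resolvent// mulmx1.
by rewrite mul_resolvent_shifted// mul1mx opprB addrC subrK.
Qed.

End Resolvent.

Lemma ler_of_eq (R : numDomainType) (x y : R) : x = y -> x <= y.
Proof. by move=> ->. Qed.

(** * An entrywise matrix norm for error terms *)

Section NormOne.
Variables (R : realType).

(** Bounds in this norm grow with the dimension. They enter differentiability, integrability and the
    quadratic errors that vanish on subdivision, never the final rate. *)
Definition n1 m n (A : 'M[R[i]]_(m, n)) : R := \sum_a \sum_b normc (A a b).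

Lemma n1_ge0 m n (A : 'M[R[i]]_(m, n)) : 0 <= n1 A.
Proof. by rewrite !sumr_ge0// => a _; rewrite sumr_ge0// => b _; exact: normc_ge0. Qed.

Lemma n1D m n (A B : 'M[R[i]]_(m, n)) : n1 (A + B) <= n1 A + n1 B.
Proof.
rewrite /n1 -big_split/=; apply: ler_sum => a _; rewrite -big_split/=.
by apply: ler_sum => b _; rewrite mxE ler_normcD.
Qed.

Lemma n1N m n (A : 'M[R[i]]_(m, n)) : n1 (- A) = n1 A.
Proof.
rewrite /n1; apply: eq_bigr => a _; apply: eq_bigr => b _.
by rewrite mxE normc_opp.
Qed.

Lemma n1Z m n (x : R[i]) (A : 'M[R[i]]_(m, n)) : n1 (x *: A) = normc x * n1 A.
Proof.
rewrite /n1 mulr_sumr; apply: eq_bigr => a _; rewrite mulr_sumr.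
by apply: eq_bigr => b _; rewrite mxE normcM.
Qed.

Lemma n1M m n p (A : 'M[R[i]]_(m, n)) (B : 'M[R[i]]_(n, p)) :
  n1 (A *m B) <= n1 A * n1 B.
Proof.
have -> : n1 A * n1 B = \sum_a \sum_b normc (A a b) * n1 B.
  by rewrite {1}/n1 mulr_suml; apply: eq_bigr => a _; rewrite mulr_suml.
rewrite {1}/n1; apply: ler_sum => a _.
rewrite (@le_trans _ _ (\sum_c \sum_b normc (A a b) * normc (B b c)))//.
  apply: ler_sum => c _; rewrite mxE (le_trans (ler_normc_sum _ _ _))//.
  by apply: ler_sum => b _; rewrite normcM.
rewrite exchange_big/=; apply: ler_sum => b _; rewrite -mulr_sumr.
rewrite ler_wpM2l ?normc_ge0// /n1 [leRHS](bigD1 b)//= lerDl.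
by rewrite sumr_ge0// => *; rewrite sumr_ge0// => *; exact: normc_ge0.
Qed.

Lemma n1M_le m n p (A : 'M[R[i]]_(m, n)) (B : 'M[R[i]]_(n, p)) x y :
  n1 A <= x -> n1 B <= y -> n1 (A *m B) <= x * y.
Proof.
by move=> ? ?; rewrite (le_trans (n1M _ _))// ler_pM ?n1_ge0.
Qed.

Lemma normc_trace_le n (A : 'M[R[i]]_n) : normc (\tr A) <= n1 A.
Proof.
rewrite /mxtrace (le_trans (ler_normc_sum _ _ _))//; apply: ler_sum => a _.
by rewrite (bigD1 a)//= lerDl sumr_ge0// => *; exact: normc_ge0.
Qed.

Lemma Im_trace_le n (A : 'M[R[i]]_n) x : n1 A <= x -> `|complex.Im (\tr A)| <= x.
Proof.
by move=> h; rewrite (le_trans (Im_le_normc _))// (le_trans (normc_trace_le _)).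
Qed.

End NormOne.

(** * Matrix units and second-order expansions *)

Lemma mul_delta_mulmxE (S : comPzRingType) n (A B : 'M[S]_n) p q b c :
  (A *m delta_mx p q *m B) b c = A b p * B q c.
Proof.
rewrite -(mul_delta_mx (0 : 'I_1)) mulmxA -colE -mulmxA -rowE mxE big_ord1.
by rewrite !mxE.
Qed.

Lemma trace_mul_delta (S : comPzRingType) n (A : 'M[S]_n) p q :
  \tr (A *m delta_mx p q) = A q p.
Proof.
rewrite /mxtrace (bigD1 q)//= big1 ?addr0; last first.
  move=> b bq; rewrite -(mulmx1 (A *m _)) mul_delta_mulmxE mxE.
  by rewrite eq_sym (negbTE bq) mulr0.
by rewrite -(mulmx1 (A *m _)) mul_delta_mulmxE mxE eqxx mulr1.
Qed.

Lemma map_delta_mx (A B : nzRingType) (f : {rmorphism A -> B}) m n p q :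
  map_mx f (@delta_mx A m n p q) = delta_mx p q.
Proof. by apply/matrixP => i j; rewrite !mxE rmorph_nat. Qed.

Definition sym_unit (S : pzSemiRingType) n (p q : 'I_n) : 'M[S]_n :=
  if p == q then delta_mx p p else delta_mx p q + delta_mx q p.

Lemma sym_unit_tr (S : comNzRingType) n (p q : 'I_n) : (sym_unit S p q)^T = sym_unit S p q.
Proof.
rewrite /sym_unit; case: ifP => _; first by rewrite trmx_delta.
by rewrite linearD/= !trmx_delta addrC.
Qed.

Section SecondOrderExpansion.
Variables (S : comNzRingType) (n : nat) (g g' m : 'M[S]_n) (t : S).
Hypothesis g'E : g' = g - t *: (g' *m m *m g).
Let y := g' *m m *m g *m m *m g.

Lemma expansion_resolvent : g' = g - t *: (g *m m *m g) + t ^+ 2 *: y.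
Proof.
rewrite {1}g'E {1}g'E !mulmxBl -!scalemxAl scalerBr scalerA -expr2 -/y.
by rewrite opprD opprK addrA.
Qed.

(** Pure ring algebra from the resolvent identity [g'E]. The remainder is exact, with the factor
    [t ^+ 2] already extracted, so Taylor bounds reduce to norms of products. *)
Lemma expansion_sandwich : g' *m m *m g' = g *m m *m g
  - (t *+ 2) *: (g *m m *m g *m m *m g)
  + t ^+ 2 *: (y *m m *m g + g *m m *m y + (g' *m m *m g) *m m *m (g' *m m *m g)).
Proof.
pose x := g' - g.
have xE : x = - t *: (g' *m m *m g) by rewrite /x {1}g'E addrAC subrr add0r scaleNr.
have xE2 : x = t ^+ 2 *: y - t *: (g *m m *m g).
  rewrite /x {1}expansion_resolvent; move: (t *: _) (_ *: y) => a b.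
  by apply/matrixP => i j; rewrite !mxE; ring.
have xmx : x *m m *m x = t ^+ 2 *: ((g' *m m *m g) *m m *m (g' *m m *m g)).
  by rewrite xE -!(scalemxAl, scalemxAr) scalerA mulrNN -expr2.
have -> : g' *m m *m g' = g *m m *m g + x *m m *m g + g *m m *m x + x *m m *m x.
  have -> : g' = g + x by rewrite /x addrC subrK.
  by rewrite !(mulmxDl, mulmxDr) !addrA.
rewrite xmx xE2; clearbody x y.
rewrite !(mulmxBl, mulmxBr) -!(scalemxAl, scalemxAr) !mulmxA !scalerDr mulr2n scalerDl.
move: (t *: _) (_ *: (y *m _ *m _)) (_ *: (_ *m y)) => a b c.
move: (_ ^+ 2 *: _) (g *m m *m g) => d e.
by apply/matrixP => i j; rewrite !mxE; ring.
Qed.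

(** The three factors [g] are replaced by [h] one at a time. *)
Lemma difference_sandwich2 (h : 'M[S]_n) :
  h *m m *m h *m m *m h - g *m m *m g *m m *m g =
    (h - g) *m m *m h *m m *m h + g *m m *m (h - g) *m m *m h
    + g *m m *m g *m m *m (h - g).
Proof.
rewrite !(mulmxBl, mulmxBr).
move: (h *m m *m h *m m *m h) (g *m m *m g *m m *m g) => a b.
move: (g *m m *m h *m m *m h) (g *m m *m g *m m *m h) => c d.
by apply/matrixP => i j; rewrite !mxE; ring.
Qed.

End SecondOrderExpansion.

Lemma Im_trace_expansion (R : realType) n (A' A B Z : 'M[R[i]]_n) (t : R) :
  A' = A - real_complex R (t *+ 2) *: B + real_complex R (t ^+ 2) *: Z ->
  complex.Im (\tr A') - complex.Im (\tr A) + t * (2 * complex.Im (\tr B)) =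
  t ^+ 2 * complex.Im (\tr Z).
Proof.
move=> ->; rewrite !mxtraceD raddfN/= !mxtraceZ.
move: (\tr A) (\tr B) (\tr Z) => [a a'] [b b'] [z z'] /=.
by ring.
Qed.

Section SecondOrderBounds.
Variables (R : realType) (n : nat) (g g' m : 'M[R[i]]_n) (t : R).
Hypothesis g'E : g' = g - real_complex R t *: (g' *m m *m g).
Variable b : R.
Hypotheses (gb : n1 g <= b) (g'b : n1 g' <= b).
Local Notation mu := (n1 m).

Let n1B : n1 (g' - g) <= `|t| * (b * mu * b).
Proof.
rewrite {1}g'E addrAC subrr add0r n1N n1Z normc_real ler_wpM2l//.
by rewrite !n1M_le.
Qed.

Lemma trace_sandwich_taylor :
  `|complex.Im (\tr (g' *m m *m g')) - complex.Im (\tr (g *m m *m g))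
    + t * (2 * complex.Im (\tr (g *m m *m g *m m *m g)))| <=
  3 * (b ^+ 4 * mu ^+ 3) * t ^+ 2.
Proof.
pose y := g' *m m *m g *m m *m g.
have yb : n1 y <= b * mu * b * mu * b by rewrite !n1M_le.
pose z := y *m m *m g + g *m m *m y + (g' *m m *m g) *m m *m (g' *m m *m g).
have E : g' *m m *m g' = g *m m *m g - real_complex R (t *+ 2) *:
   (g *m m *m g *m m *m g) + real_complex R (t ^+ 2) *: z.
  have -> : real_complex R (t *+ 2) = real_complex R t *+ 2 by rewrite rmorphMn.
  have -> : real_complex R (t ^+ 2) = real_complex R t ^+ 2 by rewrite rmorphXn.
  exact: (expansion_sandwich g'E).
rewrite (Im_trace_expansion E).
rewrite normrM ger0_norm ?sqr_ge0// mulrC ler_wpM2r ?sqr_ge0//.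
rewrite Im_trace_le// /z; clearbody y.
apply: (@le_trans _ _ ((b * mu * b * mu * b) * mu * b + b * mu * (b * mu * b * mu * b)
  + (b * mu * b) * mu * (b * mu * b))); last by apply/ler_of_eq; ring.
rewrite (le_trans (n1D _ _))// lerD//; last by rewrite !n1M_le.
by rewrite (le_trans (n1D _ _))// lerD// !n1M_le.
Qed.

Lemma trace_sandwich2_lipschitz :
  `|complex.Im (\tr (g' *m m *m g' *m m *m g'))
    - complex.Im (\tr (g *m m *m g *m m *m g))| <= 3 * (b ^+ 4 * mu ^+ 3) * `|t|.
Proof.
rewrite -Imc_opp -Imc_add -raddfB/= difference_sandwich2 Im_trace_le//.
pose x := `|t| * (b * mu * b).
apply: (@le_trans _ _ (x * mu * b * mu * b + b * mu * x * mu * b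
  + b * mu * b * mu * x)); last by apply/ler_of_eq; rewrite /x; ring.
rewrite (le_trans (n1D _ _))// lerD//; last by rewrite !n1M_le.
by rewrite (le_trans (n1D _ _))// lerD// !n1M_le.
Qed.

End SecondOrderBounds.

(** * Derivatives of the resolvent trace *)

Section TraceDerivatives.
Variables (R : realType) (N : nat) (w : R[i]).
Hypothesis w_gt0 : 0 < complex.Im w.
Implicit Types (H M : 'M[R]_N).
Local Notation eta := (complex.Im w).
Local Notation toC := (map_mx (real_complex R)).
Local Notation G := (resolvent w).

Local Opaque resolvent.

(* [T1 w H M] and [T2 w H M] are the first two derivatives of [T0 w] at [H] in direction [M]. *)
Definition T0 H : R := complex.Im (\tr (G H)).
Definition T1 H M : R := - complex.Im (\tr (G H *m toC M *m G H)).
Definition T2 H M : R :=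
  2 * complex.Im (\tr (G H *m toC M *m G H *m toC M *m G H)).

Definition gbound : R := N%:R ^+ 2 / eta.

Lemma gbound_ge0 : 0 <= gbound.
Proof. by rewrite divr_ge0 ?exprn_ge0// ltW. Qed.

Lemma n1_resolvent H : H^T = H -> n1 (G H) <= gbound.
Proof.
move=> Hs; rewrite /n1 (@le_trans _ _ (\sum_(a < N) \sum_(b < N) eta^-1))//.
  by apply: ler_sum => a _; apply: ler_sum => b _; exact: normc_resolvent_le.
by rewrite !sumr_const card_ord /gbound -mulrnA -[leLHS]mulr_natl natrM -expr2.
Qed.

Lemma resolvent_identity2 H H' : H^T = H -> H'^T = H' ->
  G H' - G H + G H *m toC (H' - H) *m G H =
  G H' *m toC (H' - H) *m G H *m toC (H' - H) *m G H.
Proof.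
move=> Hs Hs'; set D := toC _.
have e := resolvent_identity w_gt0 Hs Hs'; rewrite -/D in e.
have {}e : G H' - G H = - (G H' *m D *m G H) by rewrite {1}e addrAC subrr add0r.
rewrite {1}e addrC -!mulmxBl; congr (_ *m D *m G H).
by rewrite -[LHS]opprB e opprK.
Qed.

Lemma n1_resolventB H H' : H^T = H -> H'^T = H' ->
  n1 (G H' - G H) <= gbound * n1 (toC (H' - H)) * gbound.
Proof.
move=> Hs Hs'; rewrite {1}(resolvent_identity w_gt0 Hs Hs') addrAC subrr add0r n1N.
by rewrite !n1M_le// n1_resolvent.
Qed.

Lemma T0_bound H : H^T = H -> `|T0 H| <= gbound.
Proof. by move=> Hs; rewrite /T0 Im_trace_le// n1_resolvent. Qed.

Lemma T0_taylor H H' : H^T = H -> H'^T = H' ->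
  `|T0 H' - T0 H - T1 H (H' - H)| <= gbound ^+ 3 * n1 (toC (H' - H)) ^+ 2.
Proof.
move=> Hs Hs'.
have -> : T0 H' - T0 H - T1 H (H' - H) = complex.Im (\tr
    (G H' *m toC (H' - H) *m G H *m toC (H' - H) *m G H)).
  by rewrite -resolvent_identity2// /T0 /T1 linearD/= linearB/= Imc_add Imc_add Imc_opp opprK.
rewrite Im_trace_le//.
apply: (@le_trans _ _ (gbound * n1 (toC (H' - H)) * gbound *
  n1 (toC (H' - H)) * gbound)); last by apply/ler_of_eq; ring.
by rewrite !n1M_le// n1_resolvent.
Qed.

Lemma T1_bound H M : H^T = H -> `|T1 H M| <= gbound ^+ 2 * n1 (toC M).
Proof.
move=> Hs; rewrite /T1 normrN Im_trace_le//.
apply: (@le_trans _ _ (gbound * n1 (toC M) * gbound)); last by apply/ler_of_eq; ring.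
by rewrite !n1M_le// n1_resolvent.
Qed.

Lemma T2_bound H M : H^T = H -> `|T2 H M| <= 2 * gbound ^+ 3 * n1 (toC M) ^+ 2.
Proof.
move=> Hs; rewrite /T2 normrM ger0_norm// -mulrA ler_pM2l// Im_trace_le//.
apply: (@le_trans _ _ (gbound * n1 (toC M) * gbound * n1 (toC M) * gbound)).
  by rewrite !n1M_le// n1_resolvent.
by apply/ler_of_eq; ring.
Qed.

Section AlongLine.
Variables (H H' M : 'M[R]_N) (t : R).
Hypotheses (Hs : H^T = H) (Ms : M^T = M) (H'E : H' = H + t *: M).
Let Hs' : H'^T = H'. Proof. by rewrite H'E linearD/= linearZ/= Hs Ms. Qed.
Local Notation g := gbound.
Local Notation mu := (n1 (toC M)).

Let HB : toC (H' - H) = real_complex R t *: toC M.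
Proof. by rewrite H'E addrAC subrr add0r map_mxZ. Qed.

Let G'E : G H' = G H - real_complex R t *: (G H' *m toC M *m G H).
Proof.
by rewrite {1}(resolvent_identity w_gt0 Hs Hs') HB -scalemxAr -scalemxAl.
Qed.

Lemma T1_taylor : `|T1 H' M - T1 H M - t * T2 H M| <= 3 * (g ^+ 4 * mu ^+ 3) * t ^+ 2.
Proof.
have E (x y z : R) : - (- x - - y - t * (2 * z)) = x - y + t * (2 * z) by ring.
rewrite -normrN /T1 /T2 E.
by apply: (trace_sandwich_taylor G'E); exact: n1_resolvent.
Qed.

Lemma T2_lipschitz : `|T2 H' M - T2 H M| <= 6 * (g ^+ 4 * mu ^+ 3) * `|t|.
Proof.
rewrite /T2 -mulrBr normrM ger0_norm//.
rewrite (_ : 6 * _ * _ = 2 * (3 * (g ^+ 4 * mu ^+ 3) * `|t|)); last by ring.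
by rewrite ler_pM2l//; apply: (trace_sandwich2_lipschitz G'E); exact: n1_resolvent.
Qed.

End AlongLine.

End TraceDerivatives.

(** * Perturbing a symmetric pair of entries *)

Section SymUnit.
Variables (S : comNzRingType) (n : nat).
Implicit Types A B : 'M[S]_n.

Lemma trace_mul_delta2 A B p q r s :
  \tr (A *m delta_mx p q *m B *m delta_mx r s) = A s p * B q r.
Proof. by rewrite trace_mul_delta mul_delta_mulmxE. Qed.

Lemma trace_sym_unit A p q :
  \tr (A *m sym_unit S p q) = if p == q then A p p else A q p + A p q.
Proof.
rewrite /sym_unit; case: ifP => _; first by rewrite trace_mul_delta.
by rewrite mulmxDr mxtraceD !trace_mul_delta.
Qed.

Lemma trace_sym_unit2 A B p q :
  \tr (A *m sym_unit S p q *m B *m sym_unit S p q) =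
  if p == q then A p p * B p p
  else A q p * B q p + A q q * B p p + (A p p * B q q + A p q * B p q).
Proof.
rewrite /sym_unit; case: ifP => _; first by rewrite trace_mul_delta2.
rewrite !(mulmxDr, mulmxDl) !mxtraceD !trace_mul_delta2.
by rewrite addrACA addrA; ring.
Qed.

End SymUnit.

Section ResolventEntries.
Variables (R : realType) (N : nat) (w : R[i]).
Hypothesis w_gt0 : 0 < complex.Im w.
Variable H : 'M[R]_N.
Hypothesis Hs : H^T = H.
Local Notation eta := (complex.Im w).
Local Notation toC := (map_mx (real_complex R)).
Local Notation G := (resolvent w).
Local Notation G2 := (G H *m G H).
Local Opaque resolvent.

Lemma toC_sym_unit p q : toC (sym_unit R p q) = sym_unit R[i] p q  :> 'M[R[i]]_N.
Proof.
rewrite /sym_unit; case: ifP => _; first by rewrite map_delta_mx.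
by rewrite map_mxD !map_delta_mx.
Qed.

Lemma sqr_resolvent_sym p q : G2 p q = G2 q p.
Proof.
rewrite !mxE; apply: eq_bigr => c _.
by rewrite mulrC (resolvent_sym w c q Hs) (resolvent_sym w p c Hs).
Qed.

(** Cyclicity of the trace gathers both resolvents on one side of the perturbation, so a single
    entry of the squared resolvent remains, doubled off the diagonal. *)
Lemma T1_sym_unit_le p q : `|T1 w H (sym_unit R p q)| <= 2 * normc (G2 p q).
Proof.
rewrite /T1 normrN (le_trans (Im_le_normc _))// toC_sym_unit.
rewrite mxtrace_mulC mulmxA trace_sym_unit; case: eqP => [->|_].
  by rewrite ler_peMl ?normc_ge0// ler1n.
rewrite (le_trans (ler_normcD _ _))// (sqr_resolvent_sym q p).
by rewrite mulr_natl mulr2n.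
Qed.

Lemma T2_sym_unit_le p q : `|T2 w H (sym_unit R p q)| <=
  2 * (2 * (normc (G2 p q) * normc (G H p q))
       + normc (G2 p p) * normc (G H q q) + normc (G2 q q) * normc (G H p p)).
Proof.
rewrite /T2 normrM ger0_norm// ler_pM2l// (le_trans (Im_le_normc _))// toC_sym_unit.
rewrite mxtrace_mulC !mulmxA trace_sym_unit2; case: eqP => [->|_].
  rewrite normcM; have : 0 <= normc (G2 q q) * normc (G H q q).
    by rewrite mulr_ge0 ?normc_ge0.
  by move: (normc (G2 q q) * _) => x x0; lra.
rewrite (sqr_resolvent_sym q p) (resolvent_sym w q p Hs).
rewrite (le_trans (ler_normcD _ _))//.
rewrite (le_trans (lerD (ler_normcD _ _) (ler_normcD _ _)))// !normcM.
by apply/ler_of_eq; ring.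
Qed.

(** By the Ward identity a zero diagonal entry would make its whole column vanish, against
    invertibility. *)
Lemma resolvent_diag_neq0 a : G H a a != 0.
Proof.
apply/negP => /eqP r0; have := ward w_gt0 a Hs; rewrite r0 /=.
move/eqP; rewrite mulf_eq0 gt_eqF//= psumr_eq0; last by move=> *; exact: nsq_ge0.
move=> /allP v0; have : col a (G H) = 0.
  apply/colP => b; have := v0 b (mem_index_enum _); rewrite /= nsq_eq0 => /eqP.
  by rewrite !mxE.
move=> c0; have := mul_shifted_resolvent w_gt0 Hs => /(congr1 (col a)).
rewrite mulmx_col c0 mulmx0 => /colP /(_ a); rewrite !mxE eqxx => /eqP.
by rewrite eq_sym oner_eq0.
Qed.

Section DiagonalShift.
Variables (a : 'I_N) (s : R) (H' : 'M[R]_N).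
Hypothesis H'E : H' = H + s *: delta_mx a a.

Lemma diagonal_shift_tr : H'^T = H'.
Proof. by rewrite H'E linearD/= linearZ/= trmx_delta Hs. Qed.

Lemma resolvent_diagonal_shift b c :
  G H' b c = G H b c - real_complex R s * (G H' b a * G H a c).
Proof.
rewrite {1}(resolvent_identity w_gt0 Hs diagonal_shift_tr).
rewrite (_ : H' - H = s *: delta_mx a a); last by rewrite H'E addrAC subrr add0r.
rewrite map_mxZ map_delta_mx -scalemxAr -scalemxAl mxE; congr (_ + _).
by rewrite mxE [LHS]/= mxE mul_delta_mulmxE.
Qed.

End DiagonalShift.
End ResolventEntries.

(** * Rank-one perturbation of a diagonal entry *)

Section DiagonalShiftBounds.
Variables (R : realType) (N : nat) (w : R[i]).
Hypothesis w_gt0 : 0 < complex.Im w.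
Local Notation eta := (complex.Im w).
Local Notation G := (resolvent w).
Local Opaque resolvent.
Variables (H H' : 'M[R]_N) (a : 'I_N) (s : R).
Hypotheses (Hs : H^T = H) (H'E : H' = H + s *: delta_mx a a).

Let Hs' : H'^T = H'. Proof. exact: diagonal_shift_tr H'E. Qed.

(** The Schur complement picture, derived from the resolvent identity: the inverse of [G_aa] moves
    by exactly the shift [s]. All averaging over a diagonal Gaussian rests on this. *)
Lemma inv_resolvent_diagonal_shift : (G H' a a)^-1 = (G H a a)^-1 + real_complex R s.
Proof.
have r0 := resolvent_diag_neq0 w_gt0 Hs a.
have r'0 := resolvent_diag_neq0 w_gt0 Hs' a.
have := resolvent_diagonal_shift w_gt0 Hs H'E a a.
move: (G H a a) (G H' a a) r0 r'0 => r r' r0 r'0 e.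
have -> : real_complex R s = (r - r') / (r' * r).
  apply: (mulIf (mulf_neq0 r'0 r0)); rewrite divfK ?mulf_neq0//.
  by rewrite [in RHS]e; ring.
by field; rewrite r0 r'0.
Qed.

(** By the Schur complement formula this is [eta] plus the imaginary part of the self-energy at [b].
    It is the width of the Poisson kernel seen when the [b]-th diagonal entry moves, and that motion
    leaves it unchanged. *)
Definition im_self_energy (K : 'M[R]_N) b : R := - complex.Im (G K b b)^-1.

Lemma im_self_energyE (K : 'M[R]_N) b : K^T = K ->
  complex.Im (G K b b) = im_self_energy K b * nsq (G K b b).
Proof.
move=> Ks; rewrite /im_self_energy Imc_inv -mulNr opprK divfK//.
by rewrite nsq_eq0 resolvent_diag_neq0.
Qed.

Lemma im_self_energy_ge (K : 'M[R]_N) b : K^T = K -> eta <= im_self_energy K b.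
Proof.
move=> Ks; have := nsq_resolvent_le w_gt0 b b Ks; rewrite im_self_energyE//.
by rewrite ler_pM2r// lt_def nsq_ge0 nsq_eq0 resolvent_diag_neq0.
Qed.

Lemma im_self_energy_le (K : 'M[R]_N) b : K^T = K ->
  im_self_energy K b * normc (G K b b) <= 1.
Proof.
move=> Ks; have r0 := resolvent_diag_neq0 w_gt0 Ks b.
have r1 : 0 < normc (G K b b) by rewrite lt_def normc_eq0 r0 normc_ge0.
rewrite -ler_pdivlMr// div1r -normcV (le_trans (ler_norm _))// normrN.
exact: Im_le_normc.
Qed.

Lemma im_self_energy_shift : im_self_energy H' a = im_self_energy H a.
Proof. by rewrite /im_self_energy inv_resolvent_diagonal_shift Imc_add addr0. Qed.

(** Each entry changes by [s * G'_ba * G_ab]. Cauchy-Schwarz and the Ward identity sum these to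
    [|s| * y * u * u' / eta], while [|s| <= 1 / u + 1 / u']; the bound is uniform in [s] because
    [y * u] and [y * u'] are at most 1. *)
Lemma diagonal_shift_oscillation (P : pred 'I_N) :
  \sum_(b | P b) normc (G H' b b) <= \sum_(b | P b) normc (G H b b) + 2 / eta.
Proof.
have r0 := resolvent_diag_neq0 w_gt0 Hs a.
have r'0 := resolvent_diag_neq0 w_gt0 Hs' a.
have n0 : 0 < normc (G H a a) by rewrite lt_def normc_eq0 r0 normc_ge0.
have n'0 : 0 < normc (G H' a a) by rewrite lt_def normc_eq0 r'0 normc_ge0.
set u := normc (G H a a) in n0; set u' := normc (G H' a a) in n'0.
set y := im_self_energy H a.
have sE : `|s| <= (u + u') / (u' * u).
  have -> : `|s| = normc (real_complex R s) by rewrite normc_real.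
  have -> : real_complex R s = (G H' a a)^-1 - (G H a a)^-1.
    by rewrite inv_resolvent_diagonal_shift addrC addKr.
  have -> : (G H' a a)^-1 - (G H a a)^-1 = (G H a a - G H' a a) / (G H' a a * G H a a).
    by field; rewrite r0 r'0.
  rewrite normcM normcV normcM ler_pM2r ?invr_gt0 ?mulr_gt0//.
  by rewrite (le_trans (ler_normcD _ _))// normc_opp.
have W : eta * \sum_b nsq (G H b a) = y * u ^+ 2.
  by rewrite ward// im_self_energyE// /u sqr_normcE.
have W' : eta * \sum_b nsq (G H' b a) = y * u' ^+ 2.
  by rewrite ward// im_self_energyE// /u' sqr_normcE im_self_energy_shift.
have y0 : 0 < y by rewrite (lt_le_trans w_gt0)// im_self_energy_ge.
have yu : y * u <= 1 by exact: im_self_energy_le.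
have yu' : y * u' <= 1 by rewrite /y -im_self_energy_shift im_self_energy_le.
rewrite -lerBlDl -sumrB.
(* With this weight the two Ward sums both become [y * u * u' / eta]. *)
pose k := u / u'.
have k0 : 0 < k by rewrite divr_gt0.
(* Cauchy-Schwarz in the weighted form [2 p q <= k p^2 + k^-1 q^2] *)
apply: (@le_trans _ _ (\sum_b `|s| * ((k * nsq (G H' b a) + k^-1 * nsq (G H b a)) / 2))).
  rewrite (le_trans (ler_norm _))// (le_trans (ler_norm_sum _ _ _))//.
  rewrite big_mkcond; apply: ler_sum => b _.
  have nn : 0 <= `|s| * ((k * nsq (G H' b a) + k^-1 * nsq (G H b a)) / 2).
    by rewrite mulr_ge0// divr_ge0// addr_ge0// mulr_ge0 ?nsq_ge0 ?invr_ge0 ?ltW.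
  case: ifP => // _.
  rewrite (le_trans (ler_dist_normc _ _))// (resolvent_diagonal_shift w_gt0 Hs H'E).
  rewrite addrAC subrr add0r normc_opp normcM normc_real normcM ler_wpM2l//.
  rewrite (resolvent_sym w a b Hs) -!sqr_normcE.
  move: (normc _) (normc _) => p q.
  rewrite -subr_ge0 (_ : _ - _ = k^-1 / 2 * (k * q - p) ^+ 2).
    by rewrite mulr_ge0 ?sqr_ge0// divr_ge0// invr_ge0 ltW.
  by field; rewrite gt_eqF.
rewrite -mulr_sumr -mulr_suml big_split/= -!mulr_sumr.
have -> : \sum_b nsq (G H b a) = y * u ^+ 2 / eta.
  by rewrite -W mulrC mulKf ?gt_eqF.
have -> : \sum_b nsq (G H' b a) = y * u' ^+ 2 / eta.
  by rewrite -W' mulrC mulKf ?gt_eqF.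
have -> : (k * (y * u' ^+ 2 / eta) + k^-1 * (y * u ^+ 2 / eta)) / 2 = y * u * u' / eta.
  by rewrite /k; field; rewrite !gt_eqF.
apply: (@le_trans _ _ ((u + u') / (u' * u) * (y * u * u' / eta))).
  by rewrite ler_wpM2r// divr_ge0 ?(ltW w_gt0)// !mulr_ge0 ?ltW.
have -> : (u + u') / (u' * u) * (y * u * u' / eta) = (y * u + y * u') / eta.
  by field; rewrite !gt_eqF.
by rewrite ler_pM2r ?invr_gt0//; lra.
Qed.

(** As a function of [s] this is a Poisson kernel whose centre and width depend on [H] alone. *)
Lemma Im_resolvent_shiftE : complex.Im (G H' a a) =
  im_self_energy H a / ((complex.Re (G H a a)^-1 + s) ^+ 2 + im_self_energy H a ^+ 2).
Proof.
rewrite -[G H' a a]invrK inv_resolvent_diagonal_shift Imc_inv /nsq Rec_add Imc_add addr0.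
by rewrite /im_self_energy sqrrN.
Qed.

Lemma normc_resolvent_shiftE : normc (G H' a a) =
  (Num.sqrt ((complex.Re (G H a a)^-1 + s) ^+ 2 + im_self_energy H a ^+ 2))^-1.
Proof.
rewrite -[G H' a a]invrK inv_resolvent_diagonal_shift normcV normc_sqrtE /nsq Rec_add Imc_add addr0.
by rewrite /im_self_energy sqrrN.
Qed.

End DiagonalShiftBounds.

Section PoissonTrace.
Variables (R : realType) (n : nat) (w : R[i]).
Hypothesis w_gt0 : 0 < complex.Im w.
Variable H : 'M[R]_(2 ^ n).
Hypothesis Hs : H^T = H.

(** With [G = X + i Y] and [B = H - Re w], the real and imaginary parts of [shifted w H *m G = 1]
    read [B X + eta Y = 1] and [B Y = eta X]. Eliminating [X] gives [(B^2 + eta^2) Y = eta], so [Y]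
    is the matrix Poisson kernel. *)
Lemma nuPE : nuP H w = (2^-1) ^+ n * T0 w H.
Proof.
rewrite /nuP /T0; congr (_ * _).
set B := H - _; set Q := B *m B + _.
pose X := map_mx (@complex.Re R) (resolvent w H).
pose Y := map_mx (@complex.Im R) (resolvent w H).
have SE : shifted w H = map_mx (real_complex R) B - (0 +i* complex.Im w)%C%:M.
  rewrite /shifted map_mxB map_scalar_mx/= -addrA -opprD -raddfD/=.
  congr (_ - _%:M); case: (w) => p q; apply/eqP; rewrite eq_complex/=.
  by apply/andP; split; apply/eqP; rewrite ?addr0 ?add0r.
clearbody B.
have SG a b : \sum_c real_complex R (B a c) * resolvent w H c b -
    (0 +i* complex.Im w)%C * resolvent w H a b = (a == b)%:R.
  have /matrixP/(_ a b) := mul_shifted_resolvent w_gt0 Hs.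
  rewrite SE mulmxBl mul_scalar_mx !mxE => <-; congr (_ - _).
  by apply: eq_bigr => c _; rewrite ?mxE.
have BX : B *m X + complex.Im w *: Y = 1%:M.
  apply/matrixP => a b; rewrite !mxE; have /(congr1 (@complex.Re R)) := SG a b.
  rewrite Rec_add Rec_opp Rec_sum Rec_mul/= mul0r sub0r opprK.
  rewrite (_ : complex.Re _ = (a == b)%:R); last by case: (a == b).
  move=> <-; congr (_ + _); apply: eq_bigr => c _.
  by rewrite Rec_mul/= mul0r subr0 mxE.
have BY : B *m Y = complex.Im w *: X.
  apply/matrixP => a b; rewrite !mxE; have /(congr1 (@complex.Im R)) := SG a b.
  rewrite Imc_add Imc_opp Imc_sum Imc_mul/= mul0r add0r.
  rewrite (_ : complex.Im (_ %:R) = 0); last by case: (a == b).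
  move/eqP; rewrite subr_eq0 => /eqP <-; apply: eq_bigr => c _.
  by rewrite Imc_mul/= mul0r addr0 mxE.
have QY : Q *m ((complex.Im w)^-1 *: Y) = 1%:M.
  rewrite -scalemxAr /Q mulmxDl -mulmxA BY mul_scalar_mx -scalemxAr expr2 -scalerA.
  by rewrite -scalerDr BX scalerA mulVf ?gt_eqF// scale1r.
have [Qu _] := mulmx1_unit QY.
have -> : invmx Q = (complex.Im w)^-1 *: Y.
  by rewrite -[LHS]mulmx1 -QY mulmxA mulVmx// mul1mx.
rewrite scalerA mulfV ?gt_eqF// scale1r /mxtrace Imc_sum.
by apply: eq_bigr => a _; rewrite mxE.
Qed.
End PoissonTrace.

Local Open Scope classical_set_scope.

(** * Gaussian integrals on the line *)

Lemma measurable_invr (R : realType) : measurable_fun [set: R] (@GRing.inv R).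
Proof.
(* [powR] is the library's measurable power; it agrees with the inverse on positive reals. *)
rewrite (_ : GRing.inv = fun x : R => x * powR (x ^+ 2) (- 1)); last first.
  apply/funext => x; have [->|x0] := eqVneq x 0; first by rewrite invr0 mul0r.
  by rewrite powR_inv1 ?sqr_ge0//; field.
apply: measurable_funM => //.
by apply: (measurableT_comp (measurable_powR (- 1))) => //; exact: measurable_funX.
Qed.

Lemma measurable_sqrtr (R : realType) : measurable_fun [set: R] (@Num.sqrt R).
Proof. by apply: continuous_measurable_fun; exact: sqrt_continuous. Qed.

Section NormalIntegrals.
Variable R : realType.
Notation mu := (@lebesgue_measure R).
Notation gauss := (normal_prob (0 : R) 1).
Notation pdf := (normal_pdf (0 : R) 1).

Lemma ge0_integral_normal (f : R -> \bar R) : (forall x, 0 <= f x)%E ->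
  measurable_fun [set: R] f ->
  (\int[gauss]_x f x = \int[mu]_x (f x * (pdf x)%:E))%E.
Proof.
move=> f0 mf; have dom := normal_prob_dominates (0 : R) 1.
rewrite -(Radon_Nikodym_SigmaFinite.change_of_variables dom)//.
apply: ae_eq_integral => //.
- apply: emeasurable_funM => //; apply: (measurable_int mu).
  exact: Radon_Nikodym_SigmaFinite.f_integrable.
- apply: emeasurable_funM => //; apply/measurable_EFinP.
  exact: measurable_normal_pdf.
- apply: ae_eqe_mul2l; apply: integral_ae_eq => //=.
  + exact: Radon_Nikodym_SigmaFinite.f_integrable.
  + by apply/measurable_EFinP; exact: measurable_normal_pdf.
  + by move=> E _ mE; rewrite -Radon_Nikodym_SigmaFinite.f_integral.
Qed.

Lemma integral_normal (f : R -> \bar R) : gauss.-integrable setT f ->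
  (\int[gauss]_x f x = \int[mu]_x (f x * (pdf x)%:E))%E.
Proof.
move=> intf; have mf := measurable_int _ intf.
have dom := normal_prob_dominates (0 : R) 1.
rewrite -(Radon_Nikodym_change_of_variables dom)//.
apply: ae_eq_integral => //.
- by apply: emeasurable_funM => //; apply: (measurable_int mu).
- apply: emeasurable_funM => //; apply/measurable_EFinP.
  exact: measurable_normal_pdf.
- apply: ae_eqe_mul2l; apply: integral_ae_eq => //.
  + by apply: Radon_Nikodym_integrable; exact: dom.
  + by apply/measurable_EFinP; exact: measurable_normal_pdf.
  + by move=> E _ mE; rewrite -Radon_Nikodym_integral//; exact: dom.
Qed.

Definition sym_itv (n : nat) : set R := `[- n.+1%:R, n.+1%:R]%classic.

Lemma bigcup_sym_itv : \bigcup_n sym_itv n = setT.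
Proof.
apply/seteqP; split => // x _; exists (Num.truncn `|x|) => //=.
rewrite /sym_itv/= in_itv/= -ler_norml ltW//.
by have /andP[_] := truncn_itv (normr_ge0 x).
Qed.

Lemma nondecreasing_sym_itv : nondecreasing_seq sym_itv.
Proof.
move=> m n mn; apply/subsetPset => x; rewrite /sym_itv/= !in_itv/= -!ler_norml => h.
by rewrite (le_trans h)// ler_nat.
Qed.

Lemma cvg_integral_sym_itv (f : R -> \bar R) : (forall x, 0 <= f x)%E ->
  measurable_fun [set: R] f ->
  (\int[mu]_(x in sym_itv n) f x @[n --> \oo] --> \int[mu]_x f x)%E.
Proof.
move=> f0 mf; rewrite -bigcup_sym_itv.
apply: ge0_nondecreasing_set_cvg_integral.
- exact: nondecreasing_sym_itv.
- by move=> i; exact: measurable_itv.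
- by move=> i; exact: measurable_funTS.
- by move=> i x _; exact: f0.
Qed.

Lemma derivable_oo_LRcontinuousT (F : R -> R) a b :
  (forall x : R, derivable F x 1) -> derivable_oo_LRcontinuous F a b.
Proof.
move=> dF; have cF x : {for x, continuous F}.
  by apply: differentiable_continuous; apply/derivable1_diffP.
by split => [x _||]; [exact: dF|exact/cvg_at_right_filter/cF|exact/cvg_at_left_filter/cF].
Qed.

Lemma FTC2_sym_itv (f F : R -> R) n : (forall x : R, is_derive x 1 F (f x)) ->
  continuous f ->
  (\int[mu]_(x in sym_itv n) (f x)%:E = (F n.+1%:R - F (- n.+1%:R))%:E)%E.
Proof.
move=> dF cf; rewrite EFinB; apply: continuous_FTC2.
- by rewrite (@lt_trans _ _ 0)// oppr_lt0.
- exact: continuous_subspaceT.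
- by apply: derivable_oo_LRcontinuousT => x; exact: ex_derive.
- by move=> x _; rewrite derive1E; exact: derive_val.
Qed.

Lemma normal_pdf01E x : pdf x = normal_peak 1 * expR (- x ^+ 2 / 2).
Proof.
rewrite normal_pdfE ?oner_neq0// /normal_fun subr0 expr1n.
by rewrite [1 *+ 2]mulr2n.
Qed.

Lemma is_derive_normal_pdf (x : R) : is_derive x 1 pdf (- x * pdf x).
Proof.
have -> : pdf = fun y => normal_peak 1 * expR (- y ^+ 2 / 2).
  by apply/funext => y; exact: normal_pdf01E.
apply: is_derive_eq.
by rewrite /GRing.scale/=; field.
Qed.

Lemma is_derive_poisson (x y s : R) : 0 < y ->
  is_derive s 1 (fun s => atan ((x + Num.sqrt 2 * s) / y) / Num.sqrt 2)
    (y / ((x + Num.sqrt 2 * s) ^+ 2 + y ^+ 2)).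
Proof.
move=> y0; have s2 : Num.sqrt 2 != 0 :> R by rewrite gt_eqF// sqrtr_gt0.
apply: is_derive_eq.
rewrite /GRing.scale/=.
set u := x + _.
have uy : u ^+ 2 + y ^+ 2 != 0 by rewrite gt_eqF// ltr_wpDl ?sqr_ge0// exprn_gt0.
by field; rewrite uy s2 gt_eqF.
Qed.

(** The factor [Num.sqrt 2] is the standard deviation of a level-0 diagonal entry; the mass
    [pi / Num.sqrt 2] that it yields is rounded up to [pi]. *)
Lemma poisson_line_integral_le (x y : R) : 0 < y ->
  (\int[gauss]_s (y / ((x + Num.sqrt 2 * s) ^+ 2 + y ^+ 2))%:E <= pi%:E)%E.
Proof.
move=> y0; set f := fun s => y / ((x + Num.sqrt 2 * s) ^+ 2 + y ^+ 2).
have den s : 0 < (x + Num.sqrt 2 * s) ^+ 2 + y ^+ 2.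
  by rewrite ltr_wpDl ?sqr_ge0// exprn_gt0.
have f0 s : 0 <= f s by rewrite divr_ge0 ?ltW// den.
have cf : continuous f.
  move=> s; apply: differentiable_continuous; apply/derivable1_diffP.
  apply: derivableM => //; apply: derivableV; first by rewrite gt_eqF ?den.
  by apply: derivableD => //; apply: derivableX; apply: derivableD => //; exact: derivableM.
have mf : measurable_fun [set: R] f by exact: continuous_measurable_fun.
have s2 : 1 <= Num.sqrt 2 :> R by rewrite -[leLHS]sqrtr1 ler_wsqrtr// ler1n.
have itv n : (\int[mu]_(s in sym_itv n) (f s)%:E <= pi%:E)%E.
  rewrite (FTC2_sym_itv n (fun s => is_derive_poisson x s y0) cf) lee_fin -mulrBl.
  rewrite ler_pdivrMr ?(lt_le_trans _ s2)// (@le_trans _ _ pi)//; last first.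
    by rewrite ler_peMr// ltW// pi_gt0.
  have := atan_ltpi2 ((x + Num.sqrt 2 * n.+1%:R) / y).
  have := atan_gtNpi2 ((x + Num.sqrt 2 * - n.+1%:R) / y).
  by lra.
rewrite ge0_integral_normal//; last by apply/measurable_EFinP.
apply: (@le_trans _ _ (\int[mu]_s (f s)%:E)%E).
  apply: ge0_le_integral => //.
  - by move=> s _; rewrite mule_ge0 ?lee_fin ?f0 ?normal_pdf_ge0.
  - apply: emeasurable_funM; apply/measurable_EFinP => //.
    exact: measurable_normal_pdf.
  - exact/measurable_EFinP.
  move=> s _; rewrite -EFinM lee_fin ler_piMr ?f0//.
  rewrite (le_trans (normal_pdf_ub _ _ (oner_neq0 _)))//.
  rewrite /normal_peak invf_le1 ?sqrtr_gt0.
    rewrite -[leLHS]sqrtr1 ler_wsqrtr// expr1n mul1r mulr2n.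
    by have := pi_ge2 R; lra.
  by rewrite expr1n mul1r mulrn_wgt0// pi_gt0.
have fE0 s : (0 <= (f s)%:E)%E by rewrite lee_fin.
have cv := cvg_integral_sym_itv fE0 ((measurable_EFinP _ _).2 mf).
rewrite -(cvg_lim _ cv)//; apply: lime_le; first by apply/cvg_ex; eexists; exact: cv.
exact: nearW.
Qed.

Lemma integral_normal_sqr_lty : (\int[gauss]_s (s ^+ 2)%:E < +oo)%E.
Proof.
have m2 : measurable_fun [set: R] (fun s : R => s ^+ 2) by exact: measurable_funX.
rewrite ge0_integral_normal//; last 2 first.
- by move=> s; rewrite lee_fin sqr_ge0.
- exact/measurable_EFinP.
have s20 : Num.sqrt 2 != 0 :> R by rewrite gt_eqF// sqrtr_gt0.
(* [s^2 * exp (- s^2 / 2) <= 4 * exp (- s^2 / 4)], and the right side is a multiple of the Gaussian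
   density of variance 2. *)
pose k : R := 4 * normal_peak 1 / normal_peak (Num.sqrt 2).
apply: (@le_lt_trans _ _ (\int[mu]_s (k%:E * (normal_pdf 0 (Num.sqrt 2) s)%:E))%E).
  apply: ge0_le_integral => //.
  - by move=> s _; rewrite mule_ge0// lee_fin ?sqr_ge0 ?normal_pdf_ge0.
  - apply: emeasurable_funM; apply/measurable_EFinP => //.
    exact: measurable_normal_pdf.
  - by apply/measurable_EFinP/measurable_funM => //; exact: measurable_normal_pdf.
  move=> s _; rewrite -!EFinM lee_fin normal_pdf01E normal_pdfE//.
  rewrite /normal_fun subr0 sqr_sqrtr//.
  rewrite (_ : k * _ = normal_peak 1 * (4 * expR (- s ^+ 2 / (2 *+ 2)))); last first.
    by rewrite /k; field; rewrite gt_eqF// normal_peak_gt0.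
  rewrite mulrCA ler_wpM2l ?normal_peak_ge0//.
  have -> : - s ^+ 2 / 2 = s ^+ 2 / 4 * -1 + - s ^+ 2 / (2 *+ 2).
    by rewrite mulr2n; field.
  rewrite expRD mulrA ler_wpM2r ?expR_ge0//.
  rewrite mulrN1 expRN ler_pdivrMr ?expR_gt0//.
  by have := expR_ge1Dx (s ^+ 2 / 4); lra.
rewrite ge0_integralZl//.
- by rewrite integral_normal_pdf mule1 ltry.
- by apply/measurable_EFinP; exact: measurable_normal_pdf.
- by move=> s _; rewrite lee_fin normal_pdf_ge0.
- by rewrite lee_fin /k divr_ge0 ?mulr_ge0 ?normal_peak_ge0.
Qed.

(* Halving [y] increases [1 / sqrt (u^2 + y^2)] by at most the Poisson kernel of width [y]. *)
Lemma inv_sqrt_half_le (u y : R) : 0 < y ->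
  (Num.sqrt (u ^+ 2 + (y / 2) ^+ 2))^-1 <=
  (Num.sqrt (u ^+ 2 + y ^+ 2))^-1 + y / (u ^+ 2 + y ^+ 2).
Proof.
move=> y0.
have p0 : 0 < u ^+ 2 + y ^+ 2 by rewrite ltr_wpDl ?sqr_ge0// exprn_gt0.
have q0 : 0 < u ^+ 2 + (y / 2) ^+ 2.
  by rewrite ltr_wpDl ?sqr_ge0// exprn_gt0// divr_gt0.
have := sqr_sqrtr (ltW p0); have := sqr_sqrtr (ltW q0).
have : 0 < Num.sqrt (u ^+ 2 + y ^+ 2) by rewrite sqrtr_gt0.
have : 0 < Num.sqrt (u ^+ 2 + (y / 2) ^+ 2) by rewrite sqrtr_gt0.
move: (Num.sqrt _) (Num.sqrt _) => b a a0 b0 ea eb.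
have u0 := sqr_ge0 u.
have ab : b <= 2 * a by rewrite -(ler_pXn2r (ltn0Sn 1)) ?nnegrE ?mulr_ge0 ?(ltW a0) ?(ltW b0)//; nra.
have yb : y <= b by rewrite -(ler_pXn2r (ltn0Sn 1)) ?nnegrE ?(ltW y0) ?(ltW b0)//; nra.
rewrite -eb -subr_ge0 (_ : _ - _ = (a * b + y * a - b ^+ 2) / (a * b ^+ 2)); last first.
  by field; rewrite !gt_eqF.
apply: divr_ge0; last by rewrite mulr_ge0 ?sqr_ge0 ?(ltW a0).
rewrite subr_ge0.
have ay : y <= 2 * a by nra.
have : b - a <= y / 2 by nra.
nra.
Qed.

(** The width is halved [l] times, from [y0] down to [y0 / 2 ^+ l], at the price of one Poisson
    kernel per dyadic scale. Each kernel has bounded mass, so the logarithm of the width appears as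
    the number [l] of scales. *)
Lemma inv_sqrt_le_poisson_sum (u y y0 : R) (l : nat) : 0 < y0 -> y0 / 2 ^+ l <= y ->
  (Num.sqrt (u ^+ 2 + y ^+ 2))^-1 <=
  y0^-1 + \sum_(k < l) (y0 / 2 ^+ k) / (u ^+ 2 + (y0 / 2 ^+ k) ^+ 2).
Proof.
move=> y00 yl.
have pos k : 0 < y0 / 2 ^+ k by rewrite divr_gt0// exprn_gt0.
have posq t : 0 < t -> 0 < u ^+ 2 + t ^+ 2.
  by move=> t0; rewrite ltr_wpDl ?sqr_ge0// exprn_gt0.
apply: (@le_trans _ _ (Num.sqrt (u ^+ 2 + (y0 / 2 ^+ l) ^+ 2))^-1).
  have y_gt0 := lt_le_trans (pos l) yl.
  rewrite lef_pV2 ?posrE ?sqrtr_gt0 ?posq// ler_wsqrtr// lerD2l.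
  by rewrite ler_pXn2r// nnegrE ltW.
elim: l {yl} => [|l ih].
  rewrite big_ord0 addr0 expr0 divr1 lef_pV2 ?posrE ?sqrtr_gt0 ?posq//.
  by rewrite -[leLHS](ger0_norm (ltW y00)) -sqrtr_sqr ler_wsqrtr// lerDr sqr_ge0.
rewrite big_ord_recr/= addrA -[X in _ + X / _]/(y0 / 2 ^+ l).
have -> : y0 / 2 ^+ l.+1 = (y0 / 2 ^+ l) / 2 by rewrite exprSr invfM mulrA.
by rewrite (le_trans (inv_sqrt_half_le _ (pos l)))// lerD2r.
Qed.

Lemma continuous_poisson_line (x y : R) : 0 < y ->
  continuous (fun s => y / ((x + Num.sqrt 2 * s) ^+ 2 + y ^+ 2)).
Proof.
move=> y0 s; apply: differentiable_continuous; apply/derivable1_diffP.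
apply: derivableM => //; apply: derivableV.
  by rewrite gt_eqF// ltr_wpDl ?sqr_ge0// exprn_gt0.
by apply: derivableD => //; apply: derivableX; apply: derivableD => //; exact: derivableM.
Qed.

Lemma inv_sqrt_line_integral_le (x y y0 : R) (l : nat) : 0 < y0 -> y0 / 2 ^+ l <= y ->
  (\int[gauss]_s ((Num.sqrt ((x + Num.sqrt 2 * s) ^+ 2 + y ^+ 2))^-1)%:E
   <= (y0^-1 + l%:R * pi)%:E)%E.
Proof.
move=> y00 yl.
pose P k s := (y0 / 2 ^+ k) / ((x + Num.sqrt 2 * s) ^+ 2 + (y0 / 2 ^+ k) ^+ 2).
have pos k : 0 < y0 / 2 ^+ k by rewrite divr_gt0// exprn_gt0.
have y_gt0 := lt_le_trans (pos l) yl.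
have P0 k s : 0 <= P k s.
  by rewrite divr_ge0 ?addr_ge0 ?sqr_ge0// ltW.
have mP k : measurable_fun [set: R] (P k).
  by apply: continuous_measurable_fun; exact: continuous_poisson_line.
apply: (@le_trans _ _ (\int[gauss]_s ((y0^-1)%:E + \sum_(k < l) (P k s)%:E))%E).
  apply: ge0_le_integral => //.
  - apply/measurable_EFinP; apply: (measurableT_comp (@measurable_invr R)) => //.
    apply: (measurableT_comp (@measurable_sqrtr R)) => //; apply: measurable_funD => //.
    by apply: measurable_funX; apply: measurable_funD => //; exact: measurable_funM.
  - apply: emeasurable_funD => //; apply: emeasurable_sum => k.
    by apply/measurable_EFinP; exact: mP.
  by move=> s _; rewrite sumEFin -EFinD lee_fin; exact: inv_sqrt_le_poisson_sum.
rewrite ge0_integralD//; last 3 first.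
- by rewrite lee_fin invr_ge0 ltW.
- by move=> s _; rewrite sume_ge0// => k _; rewrite lee_fin.
- by apply: emeasurable_sum => k; apply/measurable_EFinP; exact: mP.
rewrite integral_cst// ge0_integral_sum//; last 2 first.
- by move=> k; apply/measurable_EFinP; exact: mP.
- by move=> k s _; rewrite lee_fin.
rewrite [X in (_ * X)%E](_ : _ = 1%E); last exact: probability_setT.
rewrite mule1 EFinD leeD2l//.
apply: (@le_trans _ _ (\sum_(k < l) pi%:E)%E).
  by apply: lee_sum => k _; exact: poisson_line_integral_le.
by rewrite sumEFin sumr_const card_ord mulr_natl.
Qed.

End NormalIntegrals.

Lemma le_integrable_normr d (T : measurableType d) (R : realType)
    (mu : {measure set T -> \bar R}) (f g : T -> R) :
  measurable_fun setT f -> (forall x, `|f x| <= g x) ->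
  mu.-integrable setT (EFin \o g) -> mu.-integrable setT (EFin \o f).
Proof.
move=> mf fg ig; apply: le_integrable ig => //; first exact/measurable_EFinP.
move=> x _ /=; rewrite lee_fin (le_trans (fg x))//; exact: ler_norm.
Qed.

(** * Gaussian integration by parts in one variable *)

Section Stein.
Variable R : realType.
Notation mu := (@lebesgue_measure R).
Notation gauss := (normal_prob (0 : R) 1).
Notation pdf := (normal_pdf (0 : R) 1).

Lemma integrable_normal_sqr : gauss.-integrable setT (fun s : R => (s ^+ 2)%:E).
Proof.
apply/integrableP; split.
  by apply/measurable_EFinP; exact: measurable_funX.
under eq_integral do rewrite /= ger0_norm ?sqr_ge0//.
exact: integral_normal_sqr_lty.
Qed.

Lemma integrable_normal_quadratic (f : R -> R) (C : R) :
  measurable_fun [set: R] f -> (forall s, `|f s| <= C * (1 + s ^+ 2)) ->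
  gauss.-integrable setT (EFin \o f).
Proof.
move=> mf fC; apply: (@le_integrable_normr _ _ _ gauss f _ mf fC).
rewrite (_ : EFin \o _ = (fun s : R => C%:E * (1%:E + (s ^+ 2)%:E))%E); last first.
  by apply/funext => s /=; rewrite -EFinD -EFinM.
apply: integrableZl => //; apply: integrableD => //.
  exact: finite_measure_integrable_cst.
exact: integrable_normal_sqr.
Qed.

(** [- q * pdf] is a primitive of [(s * q - q') * pdf]; over growing symmetric intervals the
    boundary terms vanish because [q] is bounded, and dominated convergence passes to the whole
    line. *)
Lemma stein (q q' : R -> R) (C : R) :
  (forall s : R, is_derive s 1 q (q' s)) -> continuous q' ->
  (forall s, `|q s| <= C) -> (forall s, `|q' s| <= C) ->
  (\int[gauss]_s (s * q s)%:E = \int[gauss]_s (q' s)%:E)%E.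
Proof.
move=> dq cq' qC q'C.
have cq : continuous q.
  by move=> s; apply: differentiable_continuous; apply/derivable1_diffP; exact: ex_derive.
have mq : measurable_fun [set: R] q by exact: continuous_measurable_fun.
have mq' : measurable_fun [set: R] q' by exact: continuous_measurable_fun.
have C0 : 0 <= C by rewrite (le_trans _ (qC 0)).
have isq : gauss.-integrable setT (EFin \o (fun s => s * q s)).
  apply: (@integrable_normal_quadratic _ C); first exact: measurable_funM.
  move=> s; rewrite normrM mulrC ler_pM ?normr_ge0//.
  by have := sqr_ge0 (`|s| - 1); rewrite -[s ^+ 2]real_normK ?num_real//; nra.
have iq' : gauss.-integrable setT (EFin \o q').
  apply: (@integrable_normal_quadratic _ C) => // s.
  by rewrite (le_trans (q'C s))// ler_peMr// lerDl sqr_ge0.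
pose h s := (s * q s - q' s) * pdf s.
have idiff : gauss.-integrable setT (EFin \o (fun s => s * q s - q' s)).
  apply: (@integrable_normal_quadratic _ (2 * C)).
    by apply: measurable_funB => //; exact: measurable_funM.
  move=> s; rewrite (le_trans (ler_normB _ _))// normrM.
  have := qC s; have := q'C s; have := sqr_ge0 (`|s| - 1).
  have := normr_ge0 s; have := normr_ge0 (q s).
  by rewrite -[s ^+ 2]real_normK ?num_real//; nra.
suff h0 : (\int[gauss]_s (s * q s - q' s)%:E = 0)%E.
  move: h0; under eq_integral do rewrite EFinB.
  rewrite integralB// => /eqP; rewrite sube_eq ?add0e.
  - by move=> /eqP.
  - exact: integrable_fin_num.
  by rewrite fin_num_adde_defr// fin_numN; exact: integrable_fin_num.
have -> : (\int[gauss]_s (s * q s - q' s)%:E = \int[mu]_s (h s)%:E)%E.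
  by rewrite (integral_normal idiff); apply: eq_integral => s _; rewrite -EFinM.
have mh : measurable_fun [set: R] h.
  apply: measurable_funM; last exact: measurable_normal_pdf.
  by apply: measurable_funB => //; exact: measurable_funM.
have ih : mu.-integrable setT (EFin \o h).
  apply/integrableP; split; first exact/measurable_EFinP.
  have /integrableP[_] := idiff.
  rewrite ge0_integral_normal//; last first.
    by apply: measurableT_comp => //; exact: (measurable_int _ idiff).
  congr (_ < _)%E; apply: eq_integral => s _.
  by rewrite /= -EFinM /h normrM (ger0_norm (normal_pdf_ge0 _ _ _)).
have dh (s : R) : is_derive s 1 (fun s => - (q s * pdf s)) (h s).
  have dp := @is_derive_normal_pdf R s.
  apply: is_derive_eq; rewrite /GRing.scale/= /h; ring.
have ch : continuous h.
  move=> s; apply: cvgM; last exact: continuous_normal_pdf.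
  by apply: cvgB; [apply: cvgM; [exact: cvg_id|exact: cq]|exact: cq'].
have itv n : (\int[mu]_(s in sym_itv n) (h s)%:E =
    (- (q n.+1%:R * pdf n.+1%:R) + q (- n.+1%:R) * pdf (- n.+1%:R))%:E)%E.
  by rewrite (FTC2_sym_itv n dh ch) opprK.
have peak1 : normal_peak (1 : R) <= 1.
  rewrite /normal_peak invf_le1 ?sqrtr_gt0.
    rewrite -[leLHS]sqrtr1 ler_wsqrtr// expr1n mul1r mulr2n.
    by have := pi_ge2 R; lra.
  by rewrite expr1n mul1r mulrn_wgt0// pi_gt0.
have pdfN s : pdf (- s) = pdf s by rewrite !normal_pdf01E sqrrN.
(* Decay like [1 / (n + 1)] suffices for the boundary terms, and [expR x >= 1 + x] gives it. *)
have pdf_le n : pdf n.+1%:R <= harmonic n.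
  rewrite normal_pdf01E /harmonic -[leRHS]mul1r ler_pM ?normal_peak_ge0 ?expR_ge0//.
  rewrite mulNr expRN lef_pV2 ?posrE ?expR_gt0//.
  rewrite (le_trans _ (expR_ge1Dx _))//.
  by have := sqr_ge0 (n.+1%:R - 1 : R); lra.
have lim0 : (\int[mu]_(s in sym_itv n) (h s)%:E @[n --> \oo] --> 0%E)%E.
  under eq_fun do rewrite itv.
  apply: cvg_EFin; first exact: nearW.
  apply: norm_cvg0.
  apply: (@squeeze_cvgr _ _ _ _ (cst 0) (fun n => (2 * C) * harmonic n)).
  - apply: nearW => n; rewrite normr_ge0/= pdfN (le_trans (ler_normD _ _))//.
    rewrite normrN !normrM (ger0_norm (normal_pdf_ge0 _ _ _)) -mulrDl.
    rewrite ler_pM ?normal_pdf_ge0 ?addr_ge0 ?normr_ge0//.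
    by have := qC n.+1%:R; have := qC (- n.+1%:R); lra.
  - exact: cvg_cst.
  - by rewrite -[X in _ --> X](mulr0 (2 * C)); apply: cvgMr; exact: cvg_harmonic.
have lim1 : (\int[mu]_(s in sym_itv n) (h s)%:E @[n --> \oo] -->
    \int[mu]_s (h s)%:E)%E.
  under eq_fun do rewrite integral_mkcond.
  have [|||||_ _] := @dominated_convergence _ _ _ mu setT measurableT
    (fun n => (EFin \o h) \_ (sym_itv n)) (EFin \o h) (abse \o (EFin \o h)).
  - move=> n; apply/(measurable_restrictT _ _).1; first exact: measurable_itv.
    by apply: measurable_funTS; exact/measurable_EFinP.
  - exact/measurable_EFinP.
  - apply: aeW => s _.
    apply: cvg_near_cst.
    have : (\bigcup_n sym_itv n) s by rewrite bigcup_sym_itv.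
    move=> [N _ Ns]; exists N => // n /= Nn; rewrite patchE mem_set//.
    by have /subsetPset := nondecreasing_sym_itv R Nn; exact.
  - exact: integrable_abse.
  - apply: aeW => s n _; rewrite patchE; case: ifP => // _.
    by rewrite /= normr0 lee_fin.
  by [].
by rewrite -(cvg_lim _ lim1)// (cvg_lim _ lim0).
Qed.

End Stein.

(** * Resampling one coordinate of a Gaussian configuration *)

Section Configurations.
Variables (R : realType) (K : finType).
Notation gauss := (normal_prob (0 : R) 1).

Definition box (A : K -> set R) : set (K -> R) := [set x | forall k, A k (x k)].

Definition boxes : set (set (K -> R)) :=
  [set B | exists A : K -> set R, (forall k, measurable (A k)) /\ B = box A].

(** The product sigma-algebra, generated by boxes because box probabilities are what independence
    provides; boxes are stable under intersection, so they determine the law. *)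
Definition cfg := g_sigma_algebraType boxes.

Lemma measurable_box (A : K -> set R) : (forall k, measurable (A k)) ->
  measurable (box A : set cfg).
Proof. by move=> mA; apply: sub_sigma_algebra; exists A. Qed.

Lemma setI_closed_boxes : setI_closed boxes.
Proof.
move=> _ _ [A [mA ->]] [B [mB ->]]; exists (fun k => A k `&` B k); split.
  by move=> k; exact: measurableI.
apply/seteqP; split => [x [Ax Bx] k|x ABx]; first by split; [exact: Ax|exact: Bx].
by split => k; have [] := ABx k.
Qed.

Lemma boxT : boxes setT.
Proof. by exists (fun=> setT); split => //; apply/seteqP; split. Qed.

Lemma measurable_coord k : measurable_fun [set: cfg] (fun x : cfg => x k).
Proof.
move=> _ B mB; rewrite setTI.
rewrite (_ : _ @^-1` _ = box (fun j => if j == k then B else setT)).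
  by apply: measurable_box => j; case: ifP.
apply/seteqP; split => [x Bx j|x /(_ k)]; last by rewrite eqxx.
by case: eqP => // ->.
Qed.

Lemma measurable_to_cfg d (T : measurableType d) (f : T -> cfg) :
  (forall k, measurable_fun [set: T] (fun t => f t k)) -> measurable_fun [set: T] f.
Proof.
move=> mf; apply: (@measurability _ _ T cfg _ f boxes erefl) => _ [_ [A [mA ->]] <-].
rewrite setTI (_ : f @^-1` box A = \bigcap_k (fun t => f t k) @^-1` A k).
  apply: fin_bigcap_measurable => // k _.
  by rewrite -[X in measurable X]setTI; exact: mf.
by apply/seteqP; split => t ft k; [move=> _; exact: ft|exact: ft].
Qed.

Definition upd (x : cfg) (k : K) (s : R) : cfg := fun j => if j == k then s else x j.

Lemma updE x k s : upd x k s k = s.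
Proof. by rewrite /upd eqxx. Qed.

Lemma measurable_upd k : measurable_fun [set: cfg * R] (fun p => upd p.1 k p.2).
Proof.
apply: measurable_to_cfg => j; rewrite /upd; case: (j == k); first exact: measurable_snd.
by apply: (measurableT_comp (measurable_coord j)) => //; exact: measurable_fst.
Qed.

Variable mu : probability cfg R.
Hypothesis mu_box : forall A : K -> set R, (forall k, measurable (A k)) ->
  mu (box A) = (\prod_k gauss (A k))%E.

(** Overwriting coordinate [k] by an independent standard Gaussian preserves the law. This gives
    integration over one coordinate with the others frozen, without splitting the configuration
    space into factors. *)
Lemma resample_measure k (B : set cfg) : measurable B ->
  pushforward (mu \x gauss)%E (fun p => upd p.1 k p.2) B = mu B.
Proof.
move=> mB.
pose m1 : {measure set cfg -> \bar R} :=
  measure_function_pushforward__canonical__measure_function_Measure (mu \x gauss)%E (measurable_upd k).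
apply: (@measure_unique _ R cfg boxes (fun=> setT) _ _ _ _ m1 mu) => //.
- exact: setI_closed_boxes.
- by move=> _; exact: boxT.
- by rewrite bigcup_const.
- move=> _ [A [mA ->]].
  (* The preimage of a box is a rectangle: the constraint on coordinate [k] passes to the fresh
     Gaussian and disappears from the old configuration. *)
  rewrite /= /pushforward (_ : _ @^-1` _ =
      box (fun j => if j == k then setT else A j) `*` A k).
    have mA' j : measurable (if j == k then setT else A j) by case: ifP.
    rewrite product_measure1E; [|exact: measurable_box|exact: mA].
    rewrite (mu_box mA).
    transitivity ((\prod_j gauss (if j == k then setT else A j)) * gauss (A k))%E.
      by congr (_ * _)%E; exact: mu_box.
    rewrite [in LHS](bigD1 k)//= [in RHS](bigD1 k)//=.
    rewrite [X in (X * _ * _)%E](_ : _ = 1%E); last by rewrite eqxx; exact: probability_setT.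
    rewrite mul1e muleC; congr (_ * _)%E.
    by apply: eq_bigr => j /negbTE ->.
  apply/seteqP; split => -[x s] /=.
    move=> h; split; last by have := h k; rewrite /upd eqxx.
    by move=> j; have := h j; rewrite /upd; case: eqP.
  by move=> [h1 h2] j; have := h1 j; rewrite /upd; case: eqP => // ->.
- move=> _; rewrite /= /pushforward preimage_setT -setXTT product_measure1E//.
  rewrite [X in (X * _)%E](_ : _ = 1%E); last exact: probability_setT.
  by rewrite [X in (_ * X)%E](_ : _ = 1%E) ?mule1 ?ltry//; exact: probability_setT.
Qed.

Lemma ge0_resample k (f : cfg -> \bar R) : measurable_fun [set: cfg] f ->
  (forall x, 0 <= f x)%E ->
  (\int[mu]_x f x = \int[mu]_x \int[gauss]_s f (upd x k s))%E.
Proof.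
move=> mf f0.
pose m1 : {measure set cfg -> \bar R} :=
  measure_function_pushforward__canonical__measure_function_Measure (mu \x gauss)%E (measurable_upd k).
transitivity (\int[m1]_x f x)%E.
  apply: eq_measure_integral => A mA _; apply/esym.
  exact: resample_measure.
rewrite ge0_integral_pushforward//; last exact: measurable_upd.
rewrite preimage_setT.
have mfu : measurable_fun setT (f \o (fun p : cfg * R => upd p.1 k p.2)).
  by apply: measurableT_comp => //; exact: measurable_upd.
by rewrite (@fubini_tonelli1 _ _ _ _ R mu gauss _ mfu (fun p => f0 _)).
Qed.

Lemma measurable_resample k (f : cfg -> \bar R) : measurable_fun [set: cfg] f ->
  (forall x, 0 <= f x)%E ->
  measurable_fun [set: cfg] (fun x => \int[gauss]_s f (upd x k s))%E.
Proof.
move=> mf f0.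
have mfu : measurable_fun setT (f \o (fun p : cfg * R => upd p.1 k p.2)).
  by apply: measurableT_comp => //; exact: measurable_upd.
exact: (@measurable_fun_fubini_tonelli_F _ _ _ _ R gauss _ mfu (fun p => f0 _)).
Qed.

Lemma integral_resample k (f : cfg -> R) : mu.-integrable setT (EFin \o f) ->
  (\int[mu]_x (f x)%:E = \int[mu]_x \int[gauss]_s (f (upd x k s))%:E)%E.
Proof.
move=> intf; have mf := measurable_int _ intf.
pose m1 : {measure set cfg -> \bar R} :=
  measure_function_pushforward__canonical__measure_function_Measure (mu \x gauss)%E (measurable_upd k).
have mu1 A : measurable A -> mu A = m1 A by move=> mA; apply/esym; exact: resample_measure.
have mfu : measurable_fun setT ((EFin \o f) \o (fun p : cfg * R => upd p.1 k p.2)).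
  by apply: measurableT_comp => //; exact: measurable_upd.
have intfu : (mu \x gauss)%E.-integrable setT ((EFin \o f) \o (fun p : cfg * R => upd p.1 k p.2)).
  apply/integrableP; split => //.
  have /integrableP[_] := intf; congr (_ < _)%E.
  transitivity (\int[m1]_x `|(EFin \o f) x|)%E.
    by apply: eq_measure_integral => A mA _; exact: mu1.
  rewrite ge0_integral_pushforward//; first exact: measurable_upd.
  by apply: measurableT_comp => //.
transitivity (\int[m1]_x (f x)%:E)%E.
  by apply: eq_measure_integral => A mA _; exact: mu1.
rewrite (_ : (fun x => (f x)%:E) = EFin \o f)//.
rewrite integral_pushforward//; last exact: measurable_upd.
by rewrite preimage_setT -(@integral12_prod_meas1 _ _ _ _ R mu gauss _ intfu).
Qed.

End Configurations.

(** * Measurability of resolvent entries *)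

Section ComplexMeasurability.
Context d (T : measurableType d) (R : realType).
Implicit Types f g : T -> R[i].

Definition cmeasurable f := measurable_fun setT (fun t => complex.Re (f t)) /\
  measurable_fun setT (fun t => complex.Im (f t)).

Lemma cmeasurable_cst z : cmeasurable (fun=> z).
Proof. by split. Qed.

Lemma cmeasurable_real (h : T -> R) : measurable_fun setT h ->
  cmeasurable (fun t => real_complex R (h t)).
Proof. by split. Qed.

Lemma cmeasurableD f g : cmeasurable f -> cmeasurable g -> cmeasurable (fun t => f t + g t).
Proof.
move=> [f1 f2] [g1 g2]; split.
  by under eq_fun do rewrite Rec_add; exact: measurable_funD.
by under eq_fun do rewrite Imc_add; exact: measurable_funD.
Qed.

Lemma cmeasurableM f g : cmeasurable f -> cmeasurable g -> cmeasurable (fun t => f t * g t).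
Proof.
move=> [f1 f2] [g1 g2]; split.
  by under eq_fun do rewrite Rec_mul; apply: measurable_funB; exact: measurable_funM.
by under eq_fun do rewrite Imc_mul; apply: measurable_funD; exact: measurable_funM.
Qed.

Lemma cmeasurable_sum (I : Type) (s : seq I) (F : I -> T -> R[i]) :
  (forall i, cmeasurable (F i)) -> cmeasurable (fun t => \sum_(i <- s) F i t).
Proof.
move=> mF; elim: s => [|i s ih].
  by under eq_fun do rewrite big_nil; exact: cmeasurable_cst.
by under eq_fun do rewrite big_cons; exact: cmeasurableD.
Qed.

Lemma cmeasurable_prod (I : Type) (s : seq I) (F : I -> T -> R[i]) :
  (forall i, cmeasurable (F i)) -> cmeasurable (fun t => \prod_(i <- s) F i t).
Proof.
move=> mF; elim: s => [|i s ih].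
  by under eq_fun do rewrite big_nil; exact: cmeasurable_cst.
by under eq_fun do rewrite big_cons; exact: cmeasurableM.
Qed.

Lemma measurable_nsq f : cmeasurable f -> measurable_fun setT (fun t => nsq (f t)).
Proof. by move=> [f1 f2]; apply: measurable_funD; exact: measurable_funX. Qed.

Lemma measurable_normc f : cmeasurable f -> measurable_fun setT (fun t => normc (f t)).
Proof.
move=> mf; under eq_fun do rewrite normc_sqrtE.
by apply: (measurableT_comp (@measurable_sqrtr R)); exact: measurable_nsq.
Qed.

Lemma cmeasurableV f : cmeasurable f -> cmeasurable (fun t => (f t)^-1).
Proof.
move=> mf; have [f1 f2] := mf.
have mi : measurable_fun setT (fun t => (nsq (f t))^-1).
  by apply: (measurableT_comp (@measurable_invr R)); exact: measurable_nsq.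
split.
  by under eq_fun do rewrite Rec_inv; exact: measurable_funM.
under eq_fun do rewrite Imc_inv; apply: measurable_funM => //.
exact: measurableT_comp.
Qed.

Lemma cmeasurable_mulmx m n p (A : T -> 'M[R[i]]_(m, n)) (B : T -> 'M[R[i]]_(n, p)) :
  (forall i j, cmeasurable (fun t => A t i j)) ->
  (forall i j, cmeasurable (fun t => B t i j)) ->
  forall i j, cmeasurable (fun t => (A t *m B t) i j).
Proof.
move=> mA mB i j; under eq_fun do rewrite mxE.
by apply: cmeasurable_sum => k; exact: cmeasurableM.
Qed.

Lemma cmeasurable_det n (A : T -> 'M[R[i]]_n) :
  (forall i j, cmeasurable (fun t => A t i j)) -> cmeasurable (fun t => \det (A t)).
Proof.
move=> mA; apply: cmeasurable_sum => s; apply: cmeasurableM; first exact: cmeasurable_cst.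
by apply: cmeasurable_prod => i; exact: mA.
Qed.

(** Cramer's formula writes each entry as a quotient of polynomials in the entries; invertibility at
    every point selects that branch of [invmx]. *)
Lemma cmeasurable_invmx n (A : T -> 'M[R[i]]_n) : (forall t, A t \in unitmx) ->
  (forall i j, cmeasurable (fun t => A t i j)) ->
  forall i j, cmeasurable (fun t => invmx (A t) i j).
Proof.
move=> uA mA i j; under eq_fun do rewrite /invmx uA !mxE.
apply: cmeasurableM; first by apply: cmeasurableV; exact: cmeasurable_det.
apply: cmeasurableM; first exact: cmeasurable_cst.
apply: cmeasurable_det => i' j'; under eq_fun do rewrite !mxE; exact: mA.
Qed.

Lemma cmeasurable_resolvent N (w : R[i]) (H : T -> 'M[R]_N) : 0 < complex.Im w ->
  (forall t, (H t)^T = H t) -> (forall i j, measurable_fun setT (fun t => H t i j)) ->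
  forall i j, cmeasurable (fun t => resolvent w (H t) i j).
Proof.
move=> w0 Hs mH; apply: cmeasurable_invmx => [t|i j]; first exact: shifted_unit.
under eq_fun do rewrite !mxE; apply: cmeasurableD.
  exact: cmeasurable_real.
exact: cmeasurable_cst.
Qed.

End ComplexMeasurability.

(** * Resolvents averaged over a diagonal entry *)

Section RandomMatrix.
Variables (R : realType) (N : nat) (K : finType) (p q : K -> 'I_N).
Local Notation cfg := (cfg R K).
Implicit Types (a : K -> R) (x : cfg).

(** Both truncations and all interpolants have this form over the same Gaussian coordinates and
    differ only in [a], so one averaging estimate serves them all. *)
Definition gmx a x : 'M[R]_N := \sum_k (a k * x k) *: sym_unit R (p k) (q k).

Lemma gmx_tr a x : (gmx a x)^T = gmx a x.
Proof.
by rewrite linear_sum; apply: eq_bigr => k _; rewrite linearZ/= sym_unit_tr.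
Qed.

Lemma gmx_upd a x k s : gmx a (upd x k s) =
  gmx a x + (a k * (s - x k)) *: sym_unit R (p k) (q k).
Proof.
rewrite /gmx (bigD1 k)//= [in RHS](bigD1 k)//= updE addrAC -scalerDl; congr (_ *: _ + _).
  by rewrite -mulrDr addrC subrK.
by apply: eq_bigr => j /negbTE jk; rewrite /upd jk.
Qed.

Lemma measurable_gmx a i j : measurable_fun [set: cfg] (fun x => gmx a x i j).
Proof.
rewrite (_ : (fun x => _) = fun x : cfg => \sum_k (a k * x k) * sym_unit R (p k) (q k) i j).
  apply: measurable_sum => k; apply: measurable_funM => //.
  by apply: measurable_funM => //; exact: measurable_coord.
by apply/funext => x; rewrite summxE; apply: eq_bigr => k _; rewrite mxE.
Qed.

Variable w : R[i].
Hypothesis w_gt0 : 0 < complex.Im w.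
Local Notation eta := (complex.Im w).
Local Notation G := (resolvent w).
Local Opaque resolvent.

Lemma cmeasurable_gmx_resolvent a i j : cmeasurable (fun x : cfg => G (gmx a x) i j).
Proof. by apply: cmeasurable_resolvent => // *; [exact: gmx_tr|exact: measurable_gmx]. Qed.

Section Wegner.
Variable mu : probability cfg R.
Notation gauss := (normal_prob (0 : R) 1).
Hypothesis mu_box : forall A : K -> set R, (forall k, measurable (A k)) ->
  mu (box A) = (\prod_k gauss (A k))%E.
Variables (a : K -> R) (diag : 'I_N -> K).
Hypothesis diagE : forall b, [/\ p (diag b) = b, q (diag b) = b & a (diag b) = Num.sqrt 2].

Lemma gmx_upd_diag x b s : gmx a (upd x (diag b) s) =
  gmx a (upd x (diag b) 0) + (Num.sqrt 2 * s) *: delta_mx b b.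
Proof.
have [pE qE aE] := diagE b.
rewrite !gmx_upd pE qE aE /sym_unit eqxx -addrA -scalerDl.
by congr (_ + _ *: _); ring.
Qed.

(** Based at [x] and not at the coordinate reset to zero, since the decoupling of a product compares
    the resampled sum with its value at [x]. *)
Lemma gmx_upd_diag_self x b s : gmx a (upd x (diag b) s) =
  gmx a x + (Num.sqrt 2 * (s - x (diag b))) *: delta_mx b b.
Proof. by have [pE qE aE] := diagE b; rewrite gmx_upd pE qE aE /sym_unit eqxx. Qed.

Lemma measurable_Im_gmx i j : measurable_fun [set: cfg] (fun x => complex.Im (G (gmx a x) i j)).
Proof. by have [] := cmeasurable_gmx_resolvent a i j. Qed.

Lemma measurable_normc_gmx i j : measurable_fun [set: cfg] (fun x => normc (G (gmx a x) i j)).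
Proof. by apply: measurable_normc; exact: cmeasurable_gmx_resolvent. Qed.

Lemma measurable_upd_fix (x : cfg) k : measurable_fun [set: R] (upd x k).
Proof.
apply: measurable_to_cfg => j; rewrite /upd; case: (j == k) => //.
Qed.

Lemma integral_gauss_Im_le x b :
  (\int[gauss]_s (complex.Im (G (gmx a (upd x (diag b) s)) b b))%:E <= pi%:E)%E.
Proof.
have Hs := gmx_tr a (upd x (diag b) 0).
under eq_integral do rewrite (Im_resolvent_shiftE w_gt0 Hs (gmx_upd_diag x b _)).
apply: poisson_line_integral_le; rewrite (lt_le_trans w_gt0)//.
exact: im_self_energy_ge.
Qed.

(** A Wegner estimate: the conditional bound holds for every frozen configuration and is uniform in
    [eta]. *)
Lemma wegner b : (\int[mu]_x (complex.Im (G (gmx a x) b b))%:E <= pi%:E)%E.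
Proof.
have I0 x : (0 <= (complex.Im (G (gmx a x) b b))%:E)%E.
  by rewrite lee_fin Im_resolvent_ge0//; exact: gmx_tr.
rewrite (ge0_resample mu_box (diag b))//; last by apply/measurable_EFinP; exact: measurable_Im_gmx.
apply: (@le_trans _ _ (\int[mu]_x pi%:E)%E); last first.
  rewrite integral_cst// [X in (_ * X)%E](_ : _ = 1%E) ?mule1//.
  exact: probability_setT.
apply: ge0_le_integral => //.
- by move=> x _; exact: integral_ge0.
- apply: (@measurable_resample _ _ (diag b) (fun x => (complex.Im (G (gmx a x) b b))%:E)) => //.
  by apply/measurable_EFinP; exact: measurable_Im_gmx.
by move=> x _; exact: integral_gauss_Im_le.
Qed.

Lemma integral_normc_resolvent_le b (y0 : R) (l : nat) : 0 < y0 -> eta = y0 / 2 ^+ l ->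
  (\int[mu]_x (normc (G (gmx a x) b b))%:E <= (y0^-1 + l%:R * pi)%:E)%E.
Proof.
move=> y00 etaE.
have I0 x : (0 <= (normc (G (gmx a x) b b))%:E)%E by rewrite lee_fin normc_ge0.
rewrite (ge0_resample mu_box (diag b))//; last by apply/measurable_EFinP; exact: measurable_normc_gmx.
apply: (@le_trans _ _ (\int[mu]_x (y0^-1 + l%:R * pi)%:E)%E); last first.
  rewrite integral_cst// [X in (_ * X)%E](_ : _ = 1%E) ?mule1//.
  exact: probability_setT.
apply: ge0_le_integral => //.
- by move=> x _; exact: integral_ge0.
- apply: (@measurable_resample _ _ (diag b) (fun x => (normc (G (gmx a x) b b))%:E)) => //.
  by apply/measurable_EFinP; exact: measurable_normc_gmx.
move=> x _; have Hs := gmx_tr a (upd x (diag b) 0).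
under eq_integral do rewrite (normc_resolvent_shiftE w_gt0 Hs (gmx_upd_diag x b _)).
apply: inv_sqrt_line_integral_le => //; rewrite -etaE.
exact: im_self_energy_ge.
Qed.

Lemma integral_Im_mul_normc_le b (P : pred 'I_N) (C : R) :
  (\int[mu]_x (\sum_(c | P c) normc (G (gmx a x) c c))%:E <= C%:E)%E ->
  (\int[mu]_x (complex.Im (G (gmx a x) b b) * \sum_(c | P c) normc (G (gmx a x) c c))%:E
   <= (pi * (C + 2 / eta))%:E)%E.
Proof.
pose X x := \sum_(c | P c) normc (G (gmx a x) c c) => XC.
have X0 x : 0 <= X x by rewrite sumr_ge0// => *; exact: normc_ge0.
have I0 x : 0 <= complex.Im (G (gmx a x) b b).
  by rewrite Im_resolvent_ge0//; exact: gmx_tr.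
have mX : measurable_fun [set: cfg] X.
  rewrite (_ : X = fun x => \sum_c if P c then normc (G (gmx a x) c c) else 0); last first.
    by apply/funext => x; rewrite /X big_mkcond.
  apply: measurable_sum => c.
  by case: (P c) => //; exact: measurable_normc_gmx.
have mI := measurable_Im_gmx b b.
have e0 : 0 <= 2 / eta by rewrite divr_ge0// ltW.
rewrite (ge0_resample mu_box (diag b)); last 2 first.
- by apply/measurable_EFinP; exact: measurable_funM.
- by move=> x; rewrite lee_fin; apply: mulr_ge0; [exact: I0|exact: X0].
apply: (@le_trans _ _ (\int[mu]_x (pi%:E * (X x + 2 / eta)%:E))%E); last first.
  rewrite ge0_integralZl//; last 3 first.
  - by apply/measurable_EFinP; exact: measurable_funD.
  - by move=> x _; rewrite lee_fin addr_ge0.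
  - by rewrite lee_fin ltW// pi_gt0.
  rewrite EFinM lee_pmul2l//; last by rewrite lte_fin pi_gt0.
  under eq_integral do rewrite EFinD.
  rewrite ge0_integralD//; last 2 first.
  - by move=> x _; rewrite lee_fin.
  - exact/measurable_EFinP.
  rewrite integral_cst// [X in (_ * X)%E](_ : _ = 1%E) ?mule1; last exact: probability_setT.
  by rewrite EFinD leeD2r.
apply: ge0_le_integral => //.
- by move=> x _; apply: integral_ge0 => s _; rewrite lee_fin; apply: mulr_ge0; [exact: I0|exact: X0].
- apply: (@measurable_resample _ _ (diag b) (fun x => (complex.Im (G (gmx a x) b b) * X x)%:E)).
    by apply/measurable_EFinP; exact: measurable_funM.
  by move=> x; rewrite lee_fin mulr_ge0.
- by apply/measurable_EFinP/measurable_funM => //; exact: measurable_funD.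
move=> x _.
(* The resampled sum is replaced by its value at [x] plus the oscillation, which is constant for the
   inner integral. *)
apply: (@le_trans _ _ (\int[gauss]_s ((X x + 2 / eta)%:E *
    (complex.Im (G (gmx a (upd x (diag b) s)) b b))%:E))%E).
  apply: ge0_le_integral => //.
  - by move=> s _; rewrite lee_fin; apply: mulr_ge0; [exact: I0|exact: X0].
  - apply/measurable_EFinP; apply: (measurableT_comp (measurable_funM mI mX)).
    exact: measurable_upd_fix.
  - apply/measurable_EFinP/measurable_funM => //; apply: (measurableT_comp mI).
    exact: measurable_upd_fix.
  move=> s _; rewrite -EFinM lee_fin mulrC ler_wpM2r//.
  apply: (diagonal_shift_oscillation w_gt0 (gmx_tr a x)).
  exact: gmx_upd_diag_self.
rewrite ge0_integralZl//; last 3 first.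
- apply/measurable_EFinP; apply: (measurableT_comp mI).
  exact: measurable_upd_fix.
- by move=> s _; rewrite lee_fin.
- by rewrite lee_fin addr_ge0.
rewrite muleC lee_wpmul2r//; first by rewrite lee_fin addr_ge0.
exact: integral_gauss_Im_le.
Qed.

End Wegner.
End RandomMatrix.

(** * Interpolation with a smoothed absolute value *)

(** Turns a quadratic Taylor bound into a derivative, so that the trace functionals are
    differentiated along lines from the resolvent identity alone. *)
Lemma is_derive_quadratic (R : realType) (f : R -> R) (s f1 C : R) :
  (forall s', `|f s' - f s - (s' - s) * f1| <= C * (s' - s) ^+ 2) ->
  is_derive s 1 f f1.
Proof.
move=> fC; have C0 : 0 <= C.
  have := le_trans (normr_ge0 _) (fC (s + 1)).
  by rewrite addrAC subrr add0r expr1n mulr1.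
have cv : h^-1 *: (f (h *: (1 : R) + s) - f s) @[h --> 0^'] --> f1.
  apply/cvgrPdist_le => e e0; near=> h.
  have h0 : h != 0 by near: h; exact: nbhs_dnbhs_neq.
  have hC : (C + 1) * `|h| <= e.
    rewrite mulrC -ler_pdivlMr ?ltr_pwDr//.
    near: h; apply: dnbhs0_le; rewrite divr_gt0// ltr_pwDr//.
  rewrite distrC /GRing.scale/= mulr1.
  have -> : h^-1 * (f (h + s) - f s) - f1 = h^-1 * (f (h + s) - f s - (h + s - s) * f1).
    by rewrite addrK; field.
  rewrite normrM normfV ler_pdivrMl ?normr_gt0//.
  rewrite (le_trans (fC _))// addrK -[h ^+ 2]real_normK ?num_real// expr2.
  by have := normr_ge0 h; nra.
apply: DeriveDef; first by apply/cvg_ex; exists f1.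
exact/cvg_lim.
Unshelve. all: by end_near. Qed.

Section SmoothAbs.
Variables (R : realType) (eps : R).
Hypothesis eps_gt0 : 0 < eps.

Definition sabs (x : R) : R := Num.sqrt (x ^+ 2 + eps ^+ 2).
Definition sabs1 (x : R) : R := x / sabs x.
Definition sabs2 (x : R) : R := eps ^+ 2 / sabs x ^+ 3.

Let arg_gt0 x : 0 < x ^+ 2 + eps ^+ 2.
Proof. by rewrite ltr_wpDl ?sqr_ge0// exprn_gt0. Qed.

Lemma sabs_gt0 x : 0 < sabs x.
Proof. by rewrite sqrtr_gt0. Qed.

Lemma sqr_sabs x : sabs x ^+ 2 = x ^+ 2 + eps ^+ 2.
Proof. by rewrite sqr_sqrtr// ltW. Qed.

Lemma normr_le_sabs x : `|x| <= sabs x.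
Proof. by rewrite -sqrtr_sqr ler_wsqrtr// lerDl sqr_ge0. Qed.

Lemma sabs0 : sabs 0 = eps.
Proof. by rewrite /sabs expr0n add0r sqrtr_sqr gtr0_norm. Qed.

Lemma sabs_ge x : eps <= sabs x.
Proof. by rewrite -[leLHS](gtr0_norm eps_gt0) -sqrtr_sqr ler_wsqrtr// lerDr sqr_ge0. Qed.

Lemma sabs_le x : sabs x <= `|x| + eps.
Proof.
rewrite -(ler_pXn2r (ltn0Sn 1)) ?nnegrE ?addr_ge0 ?(ltW (sabs_gt0 _)) ?(ltW eps_gt0)//.
rewrite sqr_sabs -[x ^+ 2]real_normK ?num_real//.
by have := mulr_ge0 (normr_ge0 x) (ltW eps_gt0); nra.
Qed.

Lemma normr_sabs1_le x : `|sabs1 x| <= 1.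
Proof.
rewrite normrM normfV (gtr0_norm (sabs_gt0 x)) ler_pdivrMr ?sabs_gt0// mul1r.
exact: normr_le_sabs.
Qed.

Lemma sabs2_ge0 x : 0 <= sabs2 x.
Proof. by rewrite divr_ge0 ?sqr_ge0// exprn_ge0// ltW// sabs_gt0. Qed.

Lemma sabs2_le x : sabs2 x <= eps^-1.
Proof.
rewrite /sabs2 ler_pdivrMr ?exprn_gt0 ?sabs_gt0// ler_pdivlMl// -exprS.
by rewrite ler_pXn2r// ?nnegrE ?(ltW (sabs_gt0 _)) ?(ltW eps_gt0)// sabs_ge.
Qed.

(* AM-GM: [sabs y <= (sabs y ^ 2 + sabs x ^ 2) / (2 sabs x)]. *)
Lemma sabs_taylor_le x y :
  sabs y <= sabs x + sabs1 x * (y - x) + (y - x) ^+ 2 / (2 * eps).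
Proof.
have a0 := sabs_gt0 x.
apply: (@le_trans _ _ (sabs x + sabs1 x * (y - x) + (y - x) ^+ 2 / (2 * sabs x))).
  rewrite -(ler_pM2l (_ : 0 < 2 * sabs x)) ?mulr_gt0//.
  have -> : 2 * sabs x * (sabs x + sabs1 x * (y - x) + (y - x) ^+ 2 / (2 * sabs x)) =
      2 * sabs x ^+ 2 + 2 * x * (y - x) + (y - x) ^+ 2.
    by rewrite /sabs1; field; rewrite gt_eqF.
  have := sqr_ge0 (sabs y - sabs x); have := sqr_sabs x; have := sqr_sabs y.
  by move: (sabs x) (sabs y) => A B; nra.
rewrite lerD2l ler_wpM2l ?sqr_ge0// lef_pV2 ?posrE ?mulr_gt0// ler_pM2l//.
exact: sabs_ge.
Qed.

Lemma is_derive_sabs (x : R) : is_derive x 1 sabs (sabs1 x).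
Proof.
have ds := is_derive1_sqrt (arg_gt0 x).
apply: is_derive_eq; rewrite /sabs1 /sabs /GRing.scale/=.
by field; rewrite gt_eqF// sqrtr_gt0.
Qed.

Lemma is_derive_sabs1 (x : R) : is_derive x 1 sabs1 (sabs2 x).
Proof.
have ds := is_derive_sabs x; have a0 : sabs x != 0 by rewrite gt_eqF// sabs_gt0.
have dv := is_deriveV a0 ds.
apply: is_derive_eq; rewrite /GRing.scale/= /sabs2 /sabs1.
rewrite (_ : eps ^+ 2 = sabs x ^+ 2 - x ^+ 2); last by rewrite sqr_sabs addrC addKr.
by field.
Qed.

Lemma continuous_sabs : continuous sabs.
Proof.
move=> x; apply: differentiable_continuous; apply/derivable1_diffP.
by have ds := is_derive_sabs x; exact: ex_derive.
Qed.

Lemma continuous_sabs1 : continuous sabs1.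
Proof.
move=> x; apply: differentiable_continuous; apply/derivable1_diffP.
by have ds := is_derive_sabs1 x; exact: ex_derive.
Qed.

Lemma continuous_sabs2 : continuous sabs2.
Proof.
move=> x; apply: cvgM; first exact: cvg_cst.
apply: cvgV; first by rewrite expf_neq0// gt_eqF// sabs_gt0.
apply: (@continuous_comp _ _ _ sabs (fun y => y ^+ 3)); first exact: continuous_sabs.
exact: exprn_continuous.
Qed.

End SmoothAbs.

Lemma continuous_lipschitz_bound (R : realType) (f : R -> R) (C : R) :
  (forall s s', `|f s' - f s| <= C * `|s' - s|) -> continuous f.
Proof.
move=> fC s; have C0 : 0 <= C.
  have := le_trans (normr_ge0 _) (fC s (s + 1)).
  by rewrite addrAC subrr add0r normr1 mulr1.
apply/cvgrPdist_le => e e0; near=> s'.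
rewrite distrC (le_trans (fC _ _))//.
apply: (@le_trans _ _ ((C + 1) * `|s' - s|)).
  by rewrite ler_wpM2r// lerDl.
rewrite mulrC -ler_pdivlMr ?ltr_pwDr// distrC.
near: s'; apply: cvgr_dist_le; first exact: cvg_id.
by rewrite divr_gt0// ltr_pwDr.
Unshelve. all: by end_near. Qed.

Section TraceDerivativeLinear.
Variables (R : realType) (N : nat) (w : R[i]).
Implicit Types (H M : 'M[R]_N).
Local Opaque resolvent.

Lemma T1Z H M c : T1 w H (c *: M) = c * T1 w H M.
Proof.
rewrite /T1 map_mxZ -scalemxAr -scalemxAl mxtraceZ Imc_mul/= mul0r addr0.
by rewrite mulrN.
Qed.

Lemma T1_sum (I : Type) (r : seq I) H (F : I -> 'M[R]_N) :
  T1 w H (\sum_(i <- r) F i) = \sum_(i <- r) T1 w H (F i).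
Proof.
elim: r => [|i r ih].
  by rewrite !big_nil /T1 map_mx0 mulmx0 mul0mx mxtrace0/= oppr0.
rewrite !big_cons -ih /T1 map_mxD mulmxDr mulmxDl mxtraceD Imc_add.
by rewrite opprD.
Qed.

End TraceDerivativeLinear.

(** * Integration by parts along a matrix line *)

Section LineStein.
Variables (R : realType) (N : nat) (w : R[i]).
Hypothesis w_gt0 : 0 < complex.Im w.
Variables (A M : 'M[R]_N) (t F0 c0 eps : R).
Hypotheses (As : A^T = A) (Ms : M^T = M) (eps_gt0 : 0 < eps) (c0_ge0 : 0 <= c0).
Notation gauss := (normal_prob (0 : R) 1).
Local Notation g := (gbound N w).
Local Notation mu := (n1 (map_mx (real_complex R) M)).

Let H s := A + (t * s) *: M.
Let X s := c0 * (T0 w (H s) - F0).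

Let Hs s : (H s)^T = H s.
Proof. by rewrite linearD/= linearZ/= As Ms. Qed.

Let HE s s' : H s' = H s + (t * (s' - s)) *: M.
Proof. by rewrite /H -addrA -scalerDl; congr (_ + _ *: _); ring. Qed.

Let dT0 (s : R) : is_derive s 1 (fun s => T0 w (H s)) (t * T1 w (H s) M).
Proof.
apply: (@is_derive_quadratic _ _ _ _ (g ^+ 3 * (t * mu) ^+ 2)) => s'.
have := T0_taylor w_gt0 (Hs s) (Hs s').
have -> : H s' - H s = (t * (s' - s)) *: M by rewrite (HE s s') addrAC subrr add0r.
rewrite T1Z map_mxZ n1Z normc_real.
have -> : g ^+ 3 * (`|t * (s' - s)| * mu) ^+ 2 = g ^+ 3 * (t * mu) ^+ 2 * (s' - s) ^+ 2.
  by rewrite [(`|_| * mu) ^+ 2]exprMn real_normK ?num_real//; ring.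
by rewrite [t * (s' - s)]mulrC -[_ * _ * T1 _ _ _]mulrA.
Qed.

Let dT1 (s : R) : is_derive s 1 (fun s => T1 w (H s) M) (t * T2 w (H s) M).
Proof.
apply: (@is_derive_quadratic _ _ _ _ (3 * (g ^+ 4 * mu ^+ 3) * t ^+ 2)) => s'.
have := T1_taylor w_gt0 (Hs s) Ms (HE s s').
by rewrite [(t * _) ^+ 2]exprMn [t * (s' - s)]mulrC -[_ * _ * T2 _ _ _]mulrA [3 * _ * (_ * _)]mulrA.
Qed.

Let cT2 : continuous (fun s => T2 w (H s) M).
Proof.
apply: (@continuous_lipschitz_bound _ _ (6 * (g ^+ 4 * mu ^+ 3) * `|t|)) => s s'.
have := T2_lipschitz w_gt0 (Hs s) Ms (HE s s').
by rewrite normrM [6 * _ * (_ * _)]mulrA.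
Qed.

Let derivable_continuous (f f' : R -> R) :
  (forall s : R, is_derive s 1 f (f' s)) -> continuous f.
Proof.
move=> df s; apply: differentiable_continuous; apply/derivable1_diffP.
exact: ex_derive.
Qed.

Let cX : continuous X.
Proof.
move=> s; apply: cvgM; first exact: cvg_cst.
by apply: cvgB; [exact: (derivable_continuous dT0)|exact: cvg_cst].
Qed.

Let dX (s : R) : is_derive s 1 X (c0 * (t * T1 w (H s) M)).
Proof.
have d0 := dT0 s; apply: is_derive_eq; rewrite /GRing.scale/=; ring.
Qed.

(** [stein] applied to [sabs1 eps (X s) * T1 w (H s) M]. The reference value [F0] stays frozen along
    the line, so differentiating the gap only differentiates the moving trace. *)
Lemma line_stein :
  (\int[gauss]_s (s * (sabs1 eps (X s) * T1 w (H s) M))%:E =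
   \int[gauss]_s (t * (sabs2 eps (X s) * c0 * T1 w (H s) M ^+ 2 +
                     sabs1 eps (X s) * T2 w (H s) M))%:E)%E.
Proof.
have g0 := gbound_ge0 N w_gt0; have mu0 : 0 <= mu := n1_ge0 _.
have T1b s := T1_bound w_gt0 M (Hs s).
have T2b s := T2_bound w_gt0 M (Hs s).
pose C1 := g ^+ 2 * mu.
pose C2 := 2 * g ^+ 3 * mu ^+ 2.
have C10 : 0 <= C1 by rewrite mulr_ge0 ?exprn_ge0.
have C20 : 0 <= C2.
  by rewrite mulr_ge0 ?exprn_ge0// mulr_ge0 ?exprn_ge0.
have e0 : 0 <= eps^-1 by rewrite invr_ge0 ltW.
pose C3 := `|t| * (eps^-1 * c0 * C1 ^+ 2 + C2).
have C30 : 0 <= C3.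
  by rewrite mulr_ge0// addr_ge0// mulr_ge0 ?sqr_ge0// mulr_ge0.
(* [C1] bounds the function and [C3] its derivative; [stein] takes one constant for both. *)
apply: (@stein _ _ _ (C1 + C3)).
- move=> s; have ds := is_derive_sabs1 eps_gt0 (X s).
  have d0 := dX s; have d1 := dT1 s.
  have d2 : is_derive s 1 (sabs1 eps \o X) (sabs2 eps (X s) * (c0 * (t * T1 w (H s) M))).
    exact: is_derive1_comp.
  by apply: (is_derive_eq (is_deriveM d2 d1)); rewrite /GRing.scale/=; ring.
- move=> s; apply: cvgM; first exact: cvg_cst.
  apply: cvgD.
    apply: cvgM.
      apply: cvgM; last exact: cvg_cst.
      by apply: (@continuous_comp _ _ _ X (sabs2 eps)); [exact: cX|exact: continuous_sabs2].
    apply: (@continuous_comp _ _ _ (fun s => T1 w (H s) M) (fun y => y ^+ 2)).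
      exact: (derivable_continuous dT1).
    exact: exprn_continuous.
  apply: cvgM; last exact: cT2.
  by apply: (@continuous_comp _ _ _ X (sabs1 eps)); [exact: cX|exact: continuous_sabs1].
- move=> s; rewrite normrM (le_trans (ler_wpM2r _ (normr_sabs1_le eps_gt0 _)))// mul1r.
  by rewrite (le_trans (T1b s))// lerDl.
move=> s; rewrite normrM (@le_trans _ _ C3) ?lerDr// ler_wpM2l//.
rewrite (le_trans (ler_normD _ _))// lerD//.
  have := sabs2_ge0 eps_gt0 (X s); have := sabs2_le eps_gt0 (X s).
  move: (sabs2 eps (X s)) => u u1 u0.
  rewrite 2!normrM normrX (ger0_norm c0_ge0) (ger0_norm u0).
  apply: ler_pM; rewrite ?exprn_ge0 ?mulr_ge0//.
    by rewrite ler_wpM2r.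
  by rewrite ler_pXn2r ?nnegrE//; exact: T1b.
rewrite normrM (le_trans (ler_wpM2r _ (normr_sabs1_le eps_gt0 _)))// mul1r.
exact: T2b.
Qed.

End LineStein.

(* The quadratic errors vanish as [[0, 1]] is subdivided. *)
Lemma telescope_le (R : realType) (phi : R -> R) (B C : R) :
  (forall u h, 0 <= u -> 0 <= h -> u + h <= 1 -> phi (u + h) <= phi u + h * B + h ^+ 2 * C) ->
  phi 1 <= phi 0 + B.
Proof.
move=> phiE.
have step n k : (k <= n.+1)%N ->
    phi (k%:R / n.+1%:R) <= phi 0 + (k%:R / n.+1%:R) * B + k%:R * (n.+1%:R^-1 ^+ 2 * C).
  elim: k => [|k ih] kn; first by rewrite !mul0r !addr0.
  have n0 : 0 <= n.+1%:R^-1 :> R by rewrite invr_ge0.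
  have e : k.+1%:R / n.+1%:R = k%:R / n.+1%:R + n.+1%:R^-1 :> R.
    by rewrite -natr1 mulrDl mul1r.
  have := phiE (k%:R / n.+1%:R) n.+1%:R^-1; rewrite -e => /(_ _ n0 _)/=.
  rewrite divr_ge0// ler_pdivrMr// mul1r ler_nat => /(_ isT kn) h.
  have k1 : k.+1%:R = k%:R + 1 :> R by rewrite natr1.
  rewrite (le_trans h)// e k1; have := ih (ltnW kn).
  by move: (n.+1%:R^-1) (k%:R) (phi 0) (phi (k%:R / _)) => t j y z; lra.
rewrite leNgt; apply/negP => lt.
pose d := phi 1 - (phi 0 + B).
have d0 : 0 < d by rewrite subr_gt0.
pose n := Num.truncn (`|C| / d).
have nC : `|C| / d < n.+1%:R.
  by have /andP[] := truncn_itv (divr_ge0 (normr_ge0 C) (ltW d0)).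
have := step n n.+1 (leqnn _); rewrite divff ?pnatr_eq0// mul1r expr2.
rewrite mulrA [X in _ <= _ + X * _](_ : _ = n.+1%:R^-1); last first.
  by rewrite mulrA mulfV ?mul1r// pnatr_eq0.
move: nC; rewrite ltr_pdivrMr// mulrC -ltr_pdivrMr// => nC.
have : n.+1%:R^-1 * C <= `|C| / n.+1%:R.
  by rewrite mulrC ler_wpM2r ?invr_ge0// ler_norm.
move: nC; rewrite /d; move: (n.+1%:R^-1 * C) (`|C| / n.+1%:R) => y z; lra.
Qed.

Lemma sqr_sum_le (R : realFieldType) (I : finType) (y : I -> R) :
  (\sum_i y i) ^+ 2 <= #|I|%:R * \sum_i y i ^+ 2.
Proof.
have -> : (\sum_i y i) ^+ 2 = \sum_i \sum_j y i * y j.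
  by rewrite expr2 mulr_suml; apply: eq_bigr => i _; rewrite mulr_sumr.
have -> : #|I|%:R * \sum_i y i ^+ 2 = \sum_i \sum_(j : I) y i ^+ 2.
  by rewrite mulr_sumr; apply: eq_bigr => i _; rewrite sumr_const mulr_natl.
have -> : \sum_i \sum_(j : I) y i ^+ 2 = \sum_i \sum_j (y i ^+ 2 + y j ^+ 2) / 2.
  under [RHS]eq_bigr do (rewrite -mulr_suml big_split/=; rewrite mulrDl).
  rewrite big_split/= -!mulr_suml [X in _ = _ + X / 2]exchange_big/=.
  by move: (\sum_i \sum_j _) => A; lra.
apply: ler_sum => i _; apply: ler_sum => j _.
by have := sqr_ge0 (y i - y j); rewrite sqrrB; lra.
Qed.

Lemma Rintegral_sum d (T : measurableType d) (R : realType)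
    (mu : {measure set T -> \bar R}) (I : Type) (r : seq I) (F : I -> T -> R) :
  (forall i, mu.-integrable setT (EFin \o F i)) ->
  \int[mu]_x (\sum_(i <- r) F i x) = \sum_(i <- r) \int[mu]_x F i x.
Proof.
move=> iF; rewrite /Rintegral.
under eq_integral do rewrite -sumEFin.
rewrite integral_sum//= -sum_fine// => i _.
by apply: integrable_fin_num => //; exact: iF.
Qed.

(** * Growth of the smoothed gap along the interpolation *)

Section Interpolation.
Variables (R : realType) (N : nat) (K : finType) (p q : K -> 'I_N) (w : R[i]).
Local Notation cfg := (cfg R K).
Hypothesis w_gt0 : 0 < complex.Im w.
Local Notation toC := (map_mx (real_complex R)).
Local Notation unit k := (sym_unit R (p k) (q k)).
Local Notation g := (gbound N w).
Local Opaque resolvent.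
Notation gauss := (normal_prob (0 : R) 1).

Section Measurability.
Variable a : K -> R.

Lemma cmeasurable_trace n (A : cfg -> 'M[R[i]]_n) :
  (forall i j, cmeasurable (fun x => A x i j)) -> cmeasurable (fun x => \tr (A x)).
Proof. by move=> mA; apply: cmeasurable_sum => i; exact: mA. Qed.

Lemma measurable_T0 : measurable_fun [set: cfg] (fun x => T0 w (gmx p q a x)).
Proof.
by apply: (cmeasurable_trace _).2 => i j; exact: cmeasurable_gmx_resolvent.
Qed.

Lemma measurable_T1 M : measurable_fun [set: cfg] (fun x => T1 w (gmx p q a x) M).
Proof.
apply: measurableT_comp => //; apply: (cmeasurable_trace _).2.
apply: cmeasurable_mulmx; last by move=> *; exact: cmeasurable_gmx_resolvent.
apply: cmeasurable_mulmx => *; first exact: cmeasurable_gmx_resolvent.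
exact: cmeasurable_cst.
Qed.

Lemma measurable_T2 M : measurable_fun [set: cfg] (fun x => T2 w (gmx p q a x) M).
Proof.
apply: measurable_funM => //; apply: (cmeasurable_trace _).2.
have mG := cmeasurable_gmx_resolvent p q w_gt0 a.
have mM i j : cmeasurable (fun _ : cfg => toC M i j) by exact: cmeasurable_cst.
apply: cmeasurable_mulmx => //; apply: cmeasurable_mulmx => //.
by apply: cmeasurable_mulmx => //; exact: cmeasurable_mulmx.
Qed.

End Measurability.

Variable mu : probability cfg R.
Hypothesis mu_box : forall A : K -> set R, (forall k, measurable (A k)) ->
  mu (box A) = (\prod_k gauss (A k))%E.

(** An integrable majorant for the unbounded integrands: those linear in a coordinate from the
    first-order term, and the quadratic error of a step. *)
Definition weight (x : cfg) : R := 1 + \sum_k x k ^+ 2.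

Lemma weight_ge1 x : 1 <= weight x.
Proof. by rewrite lerDl sumr_ge0// => *; exact: sqr_ge0. Qed.

Lemma integrable_coord_sqr k : mu.-integrable setT (fun x : cfg => (x k ^+ 2)%:E).
Proof.
have m2 : measurable_fun [set: cfg] (fun x : cfg => x k ^+ 2).
  by apply: measurable_funX; exact: measurable_coord.
apply/integrableP; split; first exact/measurable_EFinP.
under eq_integral do rewrite /= ger0_norm ?sqr_ge0//.
rewrite (ge0_resample mu_box k); last 2 first.
- exact/measurable_EFinP.
- by move=> x; rewrite lee_fin sqr_ge0.
under eq_integral => x _ do under eq_integral do rewrite updE.
rewrite integral_cst// [X in (_ * X)%E](_ : _ = 1%E) ?mule1; last exact: probability_setT.
exact: integral_normal_sqr_lty.
Qed.

Lemma integrable_weight : mu.-integrable setT (EFin \o weight).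
Proof.
rewrite (_ : EFin \o weight = (fun x => 1%:E + \sum_k (x k ^+ 2)%:E)%E); last first.
  by apply/funext => x /=; rewrite sumEFin EFinD.
apply: integrableD => //; first exact: finite_measure_integrable_cst.
by apply: integrable_sum => // k _; exact: integrable_coord_sqr.
Qed.

Lemma integrable_le_weight (f : cfg -> R) (C : R) : measurable_fun [set: cfg] f ->
  (forall x, `|f x| <= C * weight x) -> mu.-integrable setT (EFin \o f).
Proof.
move=> mf fC; apply: (le_integrable_normr mf fC).
rewrite (_ : EFin \o _ = (fun x => C%:E * (weight x)%:E)%E); last first.
  by apply/funext => x /=; rewrite EFinM.
by apply: integrableZl => //; exact: integrable_weight.
Qed.

Lemma integrable_bounded (f : cfg -> R) (C : R) : measurable_fun [set: cfg] f ->
  (forall x, `|f x| <= C) -> mu.-integrable setT (EFin \o f).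
Proof.
move=> mf fC; apply: (@integrable_le_weight _ C) => // x.
rewrite (le_trans (fC x))// ler_peMr ?weight_ge1//.
exact: (le_trans (normr_ge0 _) (fC x)).
Qed.

Variables (lo hi : K -> R).
Hypothesis disjoint_coef : forall k, lo k * hi k = 0.
Variables (c0 eps : R).
Hypotheses (c0_ge0 : 0 <= c0) (eps_gt0 : 0 < eps).

Definition interp u (x : cfg) := gmx p q (fun k => lo k + u * hi k) x.
Local Notation H := interp.
Local Notation V := (gmx p q hi).
Definition trace_gap u x := c0 * (T0 w (H u x) - T0 w (H 0 x)).
Local Notation X := trace_gap.
Local Notation f u k x := (sabs1 eps (X u x) * T1 w (H u x) (unit k)).

Lemma interpD u h x : H (u + h) x = H u x + h *: V x.
Proof.
rewrite /H /gmx scaler_sumr -big_split/=; apply: eq_bigr => k _.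
by rewrite scalerA -scalerDl; congr (_ *: _); ring.
Qed.

Lemma interp_tr u x : (H u x)^T = H u x. Proof. exact: gmx_tr. Qed.

Lemma measurable_trace_gap u : measurable_fun [set: cfg] (X u).
Proof. by apply: measurable_funM => //; apply: measurable_funB; exact: measurable_T0. Qed.

Lemma measurable_sabs1 u : measurable_fun [set: cfg] (fun x => sabs1 eps (X u x)).
Proof.
apply: (measurableT_comp _ (measurable_trace_gap u)).
by apply: continuous_measurable_fun; exact: continuous_sabs1.
Qed.

Lemma measurable_sabs2 u : measurable_fun [set: cfg] (fun x => sabs2 eps (X u x)).
Proof.
apply: (measurableT_comp _ (measurable_trace_gap u)).
by apply: continuous_measurable_fun; exact: continuous_sabs2.
Qed.

Local Notation fd u k x := (u * hi k * (sabs2 eps (X u x) * c0 * T1 w (H u x) (unit k) ^+ 2 +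
                     sabs1 eps (X u x) * T2 w (H u x) (unit k))).
Local Notation mk k := (n1 (toC (unit k))).
Local Notation bnd k := (c0 * (g ^+ 2 * mk k) ^+ 2 / eps + 2 * g ^+ 3 * mk k ^+ 2).

Lemma normr_f_le u k x : `|f u k x| <= g ^+ 2 * mk k.
Proof.
rewrite normrM (le_trans (ler_wpM2r _ (normr_sabs1_le eps_gt0 _)))// mul1r.
by apply: T1_bound => //; exact: interp_tr.
Qed.

(** The integrand left by integration by parts in coordinate [k], after removing [u * hi k] and
    using [sabs2 <= 1 / eps] and [|sabs1| <= 1]. *)
Definition drift u k x := c0 * T1 w (H u x) (unit k) ^+ 2 / eps + `|T2 w (H u x) (unit k)|.

Lemma normr_drift_le u k x : `|drift u k x| <= bnd k.
Proof.
have b1 := T1_bound w_gt0 (unit k) (interp_tr u x).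
have b2 := T2_bound w_gt0 (unit k) (interp_tr u x).
rewrite ger0_norm; last by rewrite addr_ge0// divr_ge0 ?(ltW eps_gt0)// mulr_ge0// sqr_ge0.
rewrite lerD// ler_wpM2r ?invr_ge0 ?(ltW eps_gt0)// ler_wpM2l//.
by rewrite -[T1 _ _ _ ^+ 2]real_normK ?num_real// ler_pXn2r ?nnegrE// (le_trans _ b1).
Qed.

Lemma measurable_drift u k : measurable_fun [set: cfg] (drift u k).
Proof.
apply: measurable_funD.
  apply: measurable_funM => //; apply: measurable_funM => //.
  by apply: measurable_funX; exact: measurable_T1.
by apply: measurableT_comp => //; exact: measurable_T2.
Qed.

Lemma integrable_drift u k : mu.-integrable setT (EFin \o drift u k).
Proof. exact: (integrable_bounded (measurable_drift u k) (normr_drift_le u k)). Qed.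

Lemma integrable_coord_f u k :
  mu.-integrable setT (EFin \o (fun x : cfg => x k * f u k x)).
Proof.
apply: (@integrable_le_weight _ (g ^+ 2 * mk k)).
  apply: measurable_funM; first exact: measurable_coord.
  by apply: measurable_funM; [exact: measurable_sabs1|exact: measurable_T1].
move=> x; rewrite normrM mulrC ler_pM ?normr_f_le//.
rewrite /weight (bigD1 k)//=.
have : 0 <= \sum_(i | i != k) x i ^+ 2 by rewrite sumr_ge0// => *; exact: sqr_ge0.
have := sqr_ge0 (`|x k| - 1); rewrite -[x k ^+ 2]real_normK ?num_real//; nra.
Qed.

Lemma integrable_scale (h : cfg -> R) c : mu.-integrable setT (EFin \o h) ->
  mu.-integrable setT (EFin \o (fun x => c * h x)).
Proof.
move=> ih; rewrite (_ : EFin \o _ = (fun x => c%:E * (h x)%:E)%E).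
  exact: integrableZl.
by apply/funext => x /=; rewrite EFinM.
Qed.

(** Integration by parts supplies a factor [u * hi k]; with the [hi k] in front and [u <= 1] the
    variance [hi k ^+ 2] results. *)
Lemma stein_term_le u k : 0 <= u <= 1 ->
  hi k * \int[mu]_x (x k * f u k x) <= hi k ^+ 2 * \int[mu]_x drift u k x.
Proof.
move=> /andP[u0 u1].
have [->|hk] := eqVneq (hi k) 0; first by rewrite expr0n !mul0r.
have lk : lo k = 0 by move/eqP: (disjoint_coef k); rewrite mulf_eq0 (negbTE hk) orbF => /eqP.
have mf : measurable_fun [set: cfg] (fun x : cfg => f u k x).
  by apply: measurable_funM; [exact: measurable_sabs1|exact: measurable_T1].
have mfd : measurable_fun [set: cfg] (fun x : cfg => fd u k x).
  apply: measurable_funM => //; apply: measurable_funD; apply: measurable_funM.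
  - by apply: measurable_funM => //; exact: measurable_sabs2.
  - by apply: measurable_funX; exact: measurable_T1.
  - exact: measurable_sabs1.
  - exact: measurable_T2.
have fd_le x : `|fd u k x| <= u * `|hi k| * drift u k x.
  rewrite normrM normrM (ger0_norm u0) ler_wpM2l ?mulr_ge0//.
  rewrite (le_trans (ler_normD _ _))// lerD//.
    have := sabs2_ge0 eps_gt0 (X u x); have := sabs2_le eps_gt0 (X u x).
    move: (sabs2 eps (X u x)) => v v1 v0.
    rewrite ger0_norm; last by rewrite mulr_ge0 ?sqr_ge0// mulr_ge0.
    by rewrite -mulrA [leRHS]mulrC ler_wpM2r// mulr_ge0// sqr_ge0.
  by rewrite normrM (le_trans (ler_wpM2r _ (normr_sabs1_le eps_gt0 _)))// mul1r.
have ifd : mu.-integrable setT (EFin \o (fun x : cfg => fd u k x)).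
  apply: (le_integrable_normr mfd fd_le).
  rewrite (_ : EFin \o _ = (fun x => (u * `|hi k|)%:E * (drift u k x)%:E)%E); last first.
    by apply/funext => x /=; rewrite EFinM.
  by apply: integrableZl => //; exact: integrable_drift.
have ixf := integrable_coord_f u k.
have E : \int[mu]_x (x k * f u k x) = \int[mu]_x fd u k x.
  rewrite /Rintegral (integral_resample mu_box k ixf) (integral_resample mu_box k ifd).
  congr fine; apply: eq_integral => x _.
  have Hupd s : H u (upd x k s) = H u (upd x k 0) + (u * hi k * s) *: unit k.
    rewrite /H !gmx_upd lk add0r -addrA -scalerDl; congr (_ + _ *: _); ring.
  have H0 s : H 0 (upd x k s) = H 0 x.
    by rewrite /H gmx_upd lk mul0r addr0 mul0r scale0r addr0.
  have XE s : X u (upd x k s) =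
      c0 * (T0 w (H u (upd x k 0) + (u * hi k * s) *: unit k) - T0 w (H 0 x)).
    by rewrite /X H0 Hupd.
  transitivity (\int[gauss]_s (s * (sabs1 eps (c0 * (T0 w (H u (upd x k 0) +
      (u * hi k * s) *: unit k) - T0 w (H 0 x))) *
      T1 w (H u (upd x k 0) + (u * hi k * s) *: unit k) (unit k)))%:E)%E.
    by apply: eq_integral => s _; rewrite (XE s) (Hupd s) updE.
  rewrite (line_stein w_gt0 _ _ (interp_tr u _) (sym_unit_tr _ _ _) eps_gt0 c0_ge0).
  by apply: eq_integral => s _; rewrite (XE s) (Hupd s).
rewrite E.
have h1 : hi k * \int[mu]_x fd u k x <= `|hi k| * \int[mu]_x (u * `|hi k| * drift u k x).
  rewrite (le_trans (ler_norm _))// normrM ler_wpM2l//.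
  rewrite (le_trans (le_normr_Rintegral _ _))//.
  apply: le_Rintegral => //.
  - rewrite (_ : EFin \o _ = abse \o (EFin \o (fun x => fd u k x)))//.
    exact: integrable_abse.
  rewrite (_ : EFin \o _ = (fun x => (u * `|hi k|)%:E * (drift u k x)%:E)%E).
    by apply: integrableZl => //; exact: integrable_drift.
  by apply/funext => x /=; rewrite EFinM.
rewrite (le_trans h1)// RintegralZl//; last exact: integrable_drift.
have d0 : 0 <= \int[mu]_x drift u k x.
  apply: Rintegral_ge0 => x _.
  by rewrite addr_ge0// divr_ge0 ?(ltW eps_gt0)// mulr_ge0// sqr_ge0.
rewrite mulrA ler_wpM2r//.
rewrite -[hi k ^+ 2]real_normK ?num_real// expr2.
by have := normr_ge0 (hi k); nra.
Qed.

Lemma n1_hi_le x : n1 (toC (V x)) ^+ 2 <=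
  #|K|%:R * (\sum_k (hi k * mk k) ^+ 2) * weight x.
Proof.
have h1 : n1 (toC (V x)) <= \sum_k `|hi k * x k| * mk k.
  rewrite /gmx raddf_sum/=; elim/big_rec2: _ => [|k y A _ ih].
    by rewrite /n1 big1// => i _; rewrite big1// => j _; rewrite mxE normc0.
  rewrite (le_trans (n1D _ _))// lerD//.
  by rewrite map_mxZ n1Z normc_real.
have s0 : 0 <= \sum_k `|hi k * x k| * mk k.
  by rewrite sumr_ge0// => k _; rewrite mulr_ge0 ?n1_ge0.
apply: (@le_trans _ _ ((\sum_k `|hi k * x k| * mk k) ^+ 2)).
  by rewrite ler_pXn2r ?nnegrE ?n1_ge0.
rewrite (le_trans (sqr_sum_le _))// -mulrA ler_wpM2l// mulr_suml.
apply: ler_sum => k _.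
rewrite !normrM !exprMn !real_normK ?num_real// mulrAC ler_wpM2l//.
  by rewrite mulr_ge0 ?sqr_ge0.
by rewrite /weight (bigD1 k)//= addrCA lerDl addr_ge0// sumr_ge0// => *; exact: sqr_ge0.
Qed.

Lemma T0_lipschitz (A B : 'M[R]_N) : A^T = A -> B^T = B ->
  `|T0 w B - T0 w A| <= g ^+ 2 * n1 (toC (B - A)).
Proof.
move=> As Bs; rewrite /T0 -Imc_opp -Imc_add -raddfB/= Im_trace_le//.
by rewrite (le_trans (n1_resolventB w_gt0 As Bs))//; apply/ler_of_eq; ring.
Qed.

Let C1 := c0 * g ^+ 3 + c0 ^+ 2 * g ^+ 4 / (2 * eps).

(** A pointwise substitute for differentiating the expectation in [u]. In [C1] the cubic power of
    [g] is the Taylor remainder of the trace, and the term over [eps] is the quadratic term of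
    [sabs] combined with the Lipschitz bound. *)
Lemma sabs_step u h x : 0 <= h ->
  sabs eps (X (u + h) x) <= sabs eps (X u x) +
    h * (c0 * (sabs1 eps (X u x) * T1 w (H u x) (V x))) + h ^+ 2 * (C1 * n1 (toC (V x)) ^+ 2).
Proof.
move=> h0; set v := n1 (toC (V x)).
have v0 : 0 <= v by exact: n1_ge0.
have g0 := gbound_ge0 N w_gt0.
rewrite (le_trans (sabs_taylor_le eps_gt0 (X u x) _))// -!addrA lerD2l.
have DE : X (u + h) x - X u x = c0 * (T0 w (H (u + h) x) - T0 w (H u x)).
  by rewrite /X; ring.
have HB : H (u + h) x - H u x = h *: V x by rewrite interpD addrAC subrr add0r.
have tay := T0_taylor w_gt0 (interp_tr u x) (interp_tr (u + h) x).
have lip := T0_lipschitz (interp_tr u x) (interp_tr (u + h) x).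
rewrite HB T1Z map_mxZ n1Z normc_real (ger0_norm h0) -/v in tay.
rewrite HB map_mxZ n1Z normc_real (ger0_norm h0) -/v in lip.
have s1 := normr_sabs1_le eps_gt0 (X u x).
rewrite DE; move: (T0 w (H (u + h) x) - T0 w (H u x)) tay lip => D tay lip.
have p1 : sabs1 eps (X u x) * (c0 * D) <= h * (c0 * (sabs1 eps (X u x) * T1 w (H u x) (V x)))
     + h ^+ 2 * (c0 * g ^+ 3 * v ^+ 2).
  rewrite -lerBlDl.
  rewrite (_ : _ - _ = c0 * (sabs1 eps (X u x) * (D - h * T1 w (H u x) (V x)))); last by ring.
  rewrite (_ : _ * (_ * v ^+ 2) = c0 * (g ^+ 3 * (h * v) ^+ 2)); last by ring.
  rewrite ler_wpM2l// (le_trans (ler_norm _))// normrM (le_trans _ tay)//.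
  by rewrite ler_piMl.
have p2 : (c0 * D) ^+ 2 / (2 * eps) <= h ^+ 2 * (c0 ^+ 2 * g ^+ 4 / (2 * eps) * v ^+ 2).
  rewrite (_ : h ^+ 2 * _ = (c0 ^+ 2 * (g ^+ 2 * (h * v)) ^+ 2) / (2 * eps)); last first.
    by field; rewrite gt_eqF.
  rewrite ler_wpM2r ?invr_ge0 ?mulr_ge0 ?(ltW eps_gt0)// exprMn ler_wpM2l ?sqr_ge0//.
  rewrite -[D ^+ 2]real_normK ?num_real// ler_pXn2r ?nnegrE//.
  by rewrite (le_trans _ lip).
by rewrite (le_trans (lerD p1 p2))// -addrA lerD2l -mulrDr -mulrDl.
Qed.

Variable B : R.
Hypothesis drift_le : forall u, 0 <= u <= 1 ->
  c0 * \sum_k (hi k ^+ 2 * \int[mu]_x drift u k x) <= B.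

Let phi u := \int[mu]_x sabs eps (X u x).

Lemma measurable_sabs u : measurable_fun [set: cfg] (fun x => sabs eps (X u x)).
Proof.
apply: (measurableT_comp _ (measurable_trace_gap u)).
by apply: continuous_measurable_fun; exact: continuous_sabs.
Qed.

Lemma integrable_sabs u : mu.-integrable setT (EFin \o (fun x => sabs eps (X u x))).
Proof.
apply: (@integrable_bounded _ (c0 * (g + g) + eps)); first exact: measurable_sabs.
move=> x; rewrite ger0_norm ?(ltW (sabs_gt0 eps_gt0 _))//.
rewrite (le_trans (sabs_le eps_gt0 _))// lerD2r normrM (ger0_norm c0_ge0) ler_wpM2l//.
by rewrite (le_trans (ler_normB _ _))// lerD// T0_bound//; exact: interp_tr.
Qed.

Lemma phi_step u h : 0 <= u -> 0 <= h -> u + h <= 1 ->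
  phi (u + h) <= phi u + h * B +
    h ^+ 2 * \int[mu]_x (C1 * n1 (toC (V x)) ^+ 2).
Proof.
move=> u0 h0 uh1.
have u01 : 0 <= u <= 1 by rewrite u0 (le_trans _ uh1)// lerDl.
pose Dr x := \sum_k c0 * (hi k * (x k * f u k x)).
(* By linearity of [T1] in the direction, the first-order term splits into one integration by parts
   per Gaussian. *)
have DrE x : c0 * (sabs1 eps (X u x) * T1 w (H u x) (V x)) = Dr x.
  rewrite /gmx T1_sum !mulr_sumr; apply: eq_bigr => k _.
  by rewrite T1Z; ring.
have iDr k : mu.-integrable setT (EFin \o (fun x : cfg => c0 * (hi k * (x k * f u k x)))).
  by do 2!apply: integrable_scale; exact: integrable_coord_f.
have iD : mu.-integrable setT (EFin \o Dr).
  rewrite (_ : EFin \o _ = (fun x => \sum_k (c0 * (hi k * (x k * f u k x)))%:E)%E).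
    by apply: integrable_sum => // k _; exact: iDr.
  by apply/funext => x /=; rewrite sumEFin.
have DB : \int[mu]_x Dr x <= B.
  rewrite Rintegral_sum// (le_trans _ (drift_le u01))// mulr_sumr.
  apply: ler_sum => k _.
  rewrite RintegralZl//; last by apply: integrable_scale; exact: integrable_coord_f.
  rewrite RintegralZl//; last exact: integrable_coord_f.
  by rewrite ler_wpM2l// stein_term_le.
have iV : mu.-integrable setT (EFin \o (fun x => C1 * n1 (toC (V x)) ^+ 2)).
  apply: integrable_scale.
  apply: (@integrable_le_weight _ (#|K|%:R * (\sum_k (hi k * mk k) ^+ 2))).
    apply: measurable_funX; rewrite /n1.
    apply: measurable_sum => i; apply: measurable_sum => j.
    apply: measurable_normc.
    rewrite (_ : (fun x => _) = fun x => real_complex R (V x i j)).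
      by apply: cmeasurable_real; exact: measurable_gmx.
    by apply/funext => x; rewrite mxE.
  by move=> x; rewrite ger0_norm ?sqr_ge0//; exact: n1_hi_le.
rewrite /phi.
apply: (@le_trans _ _ (\int[mu]_x ((sabs eps (X u x) + h * Dr x) +
    h ^+ 2 * (C1 * n1 (toC (V x)) ^+ 2)))).
  apply: le_Rintegral => //.
  - exact: integrable_sabs.
  - rewrite (_ : EFin \o _ = (fun x => ((sabs eps (X u x))%:E + (h * Dr x)%:E)
        + (h ^+ 2 * (C1 * n1 (toC (V x)) ^+ 2))%:E)%E).
      apply: integrableD => //; last exact: integrable_scale.
      by apply: integrableD => //; [exact: integrable_sabs|exact: integrable_scale].
    by apply/funext => x /=; rewrite !EFinD.
  - by move=> x _; rewrite -DrE; exact: sabs_step.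
rewrite RintegralD//; last 2 first.
- rewrite (_ : EFin \o _ = (fun x => ((sabs eps (X u x))%:E + (h * Dr x)%:E))%E).
    by apply: integrableD => //; [exact: integrable_sabs|exact: integrable_scale].
  by apply/funext => x /=; rewrite !EFinD.
- exact: integrable_scale.
rewrite RintegralD//; last 2 first.
- exact: integrable_sabs.
- exact: integrable_scale.
rewrite (RintegralZl h measurableT iD) (RintegralZl (h ^+ 2) measurableT iV).
by rewrite lerD2r lerD2l ler_wpM2l.
Qed.

Lemma interpolation_le :
  (\int[mu]_x `|X 1 x|%:E <= (eps + B)%:E)%E.
Proof.
have h := telescope_le phi_step.
(* The gap vanishes at [u = 0], so the smoothing itself costs exactly [eps]. *)
have phi0 : phi 0 = eps.
  rewrite /phi; under eq_Rintegral do rewrite /trace_gap subrr mulr0 (sabs0 eps_gt0).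
  by rewrite Rintegral_cst// [X in fine X](_ : _ = 1%E) ?mulr1//; exact: probability_setT.
rewrite phi0 in h.
apply: (@le_trans _ _ (\int[mu]_x (sabs eps (X 1 x))%:E)%E).
  apply: ge0_le_integral => //.
  - by apply/measurable_EFinP/measurableT_comp => //; exact: measurable_trace_gap.
  - by apply/measurable_EFinP; exact: measurable_sabs.
  by move=> x _; rewrite lee_fin normr_le_sabs.
rewrite -[leLHS]fineK; last by apply: integrable_fin_num => //; exact: integrable_sabs.
by rewrite lee_fin.
Qed.

End Interpolation.

(** * The drift summed over a block *)

Section PairDrift.
Variables (R : realType) (N : nat) (w : R[i]).
Hypothesis w_gt0 : 0 < complex.Im w.
Variables (c0 eps : R).
Hypotheses (c0_ge0 : 0 <= c0) (eps_gt0 : 0 < eps).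
Variable e : rel 'I_N.
Hypothesis e_sym : symmetric e.
Local Notation eta := (complex.Im w).
Local Notation G := (resolvent w).
Local Opaque resolvent.

Definition pair_drift (H : 'M[R]_N) i j : R :=
  c0 * T1 w H (sym_unit R i j) ^+ 2 / eps + `|T2 w H (sym_unit R i j)|.

Lemma pair_drift_ge0 H i j : 0 <= pair_drift H i j.
Proof. by rewrite addr_ge0// divr_ge0 ?(ltW eps_gt0)// mulr_ge0// sqr_ge0. Qed.

Section Deterministic.
Variable H : 'M[R]_N.
Hypothesis Hs : H^T = H.
Local Notation G2 := (G H *m G H).

Lemma pair_drift_le i j : pair_drift H i j <=
  (4 * c0 / eps + 2 * eta) * nsq (G2 j i) + 2 / eta * nsq (G H j i)
  + (2 * (normc (G2 i i) * normc (G H j j)) + 2 * (normc (G2 j j) * normc (G H i i))).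
Proof.
have t1 := T1_sym_unit_le w Hs i j; have t2 := T2_sym_unit_le w Hs i j.
rewrite (sqr_resolvent_sym w Hs i j) in t1 t2.
rewrite (resolvent_sym w i j Hs) in t2.
rewrite -!sqr_normcE /pair_drift.
have t1' : c0 * T1 w H (sym_unit R i j) ^+ 2 / eps <= 4 * c0 / eps * normc (G2 j i) ^+ 2.
  rewrite (_ : 4 * c0 / eps * normc (G2 j i) ^+ 2 = c0 * (2 * normc (G2 j i)) ^+ 2 / eps); last first.
    by field; rewrite gt_eqF.
  rewrite ler_wpM2r ?invr_ge0 ?(ltW eps_gt0)// ler_wpM2l//.
  rewrite -[T1 _ _ _ ^+ 2]real_normK ?num_real// ler_pXn2r ?nnegrE//.
  by rewrite mulr_ge0 ?normc_ge0.
(* The weight [eta] makes both parts contribute the same [2 / eta ^+ 2] times [Im G_ii] after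
   summation over [j]. *)
have t2' : 4 * (normc (G2 j i) * normc (G H j i)) <=
    2 * eta * normc (G2 j i) ^+ 2 + 2 / eta * normc (G H j i) ^+ 2.
  move: (normc (G2 j i)) (normc (G H j i)) => y z.
  rewrite -subr_ge0 (_ : _ - _ = 2 / eta * (eta * y - z) ^+ 2); last first.
    by field; rewrite gt_eqF.
  by rewrite mulr_ge0 ?sqr_ge0// divr_ge0// ltW.
rewrite mulrDl; move: t1' t2 t2'.
move: (c0 * T1 _ _ _ ^+ 2 / eps) (`|T2 _ _ _|) => y z.
move: (4 * c0 / eps * _ ^+ 2) (2 * eta * _ ^+ 2) (2 / eta * _ ^+ 2) => y1 y2 y3.
by move: (normc (G2 j i) * _) (normc (G2 i i) * _) (normc (G2 j j) * _) => z1 z2 z3; lra.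
Qed.

(** The sums of squared entries are enlarged from blocks to whole columns, where the Ward identity
    and the contraction bound apply. Only the diagonal products keep the block, and there
    [|G2_ii| <= Im G_ii / eta]. *)
Lemma sum_pair_drift_le : \sum_i \sum_(j | e i j) pair_drift H i j <=
  (4 * c0 / (eps * eta ^+ 3) + 4 / eta ^+ 2) * \sum_i complex.Im (G H i i)
  + 4 / eta * \sum_i complex.Im (G H i i) * \sum_(j | e i j) normc (G H j j).
Proof.
have e0 : 0 <= eta^-1 by rewrite invr_ge0 ltW.
(* Symmetry of the block relation lets the two diagonal products share one bound. *)
pose Y := \sum_i \sum_(j | e i j) normc (G2 i i) * normc (G H j j).
have YE : \sum_i \sum_(j | e i j) normc (G2 j j) * normc (G H i i) = Y.
  rewrite /Y; under eq_bigr do rewrite big_mkcond.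
  rewrite exchange_big/=; apply: eq_bigr => i _; rewrite [RHS]big_mkcond.
  by apply: eq_bigr => j _; rewrite e_sym.
have Yle : Y <= eta^-1 * \sum_i complex.Im (G H i i) * \sum_(j | e i j) normc (G H j j).
  rewrite mulr_sumr; apply: ler_sum => i _; rewrite -mulr_sumr mulrA.
  rewrite ler_wpM2r ?sumr_ge0//; first by move=> *; exact: normc_ge0.
  by rewrite ler_pdivlMl// normc_sqr_resolvent_diag_le.
have S1 i : \sum_(j | e i j) nsq (G2 j i) <= complex.Im (G H i i) / eta ^+ 3.
  rewrite ler_pdivlMr ?exprn_gt0// mulrC (le_trans _ (sum_nsq_sqr_resolvent_le w_gt0 i Hs))//.
  rewrite ler_pM2l ?exprn_gt0// big_mkcond; apply: ler_sum => j _.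
  by case: ifP => // _; exact: nsq_ge0.
have S2 i : \sum_(j | e i j) nsq (G H j i) <= complex.Im (G H i i) / eta.
  rewrite ler_pdivlMr// mulrC -(ward w_gt0 i Hs) ler_pM2l// big_mkcond.
  by apply: ler_sum => j _; case: ifP => // _; exact: nsq_ge0.
apply: (@le_trans _ _ (\sum_i ((4 * c0 / eps + 2 * eta) * (complex.Im (G H i i) / eta ^+ 3)
    + 2 / eta * (complex.Im (G H i i) / eta)) + (2 * Y + 2 * Y))).
  rewrite -{2}YE {1}/Y !mulr_sumr -!big_split/=; apply: ler_sum => i _.
  rewrite !mulr_sumr -big_split/=.
  apply: (@le_trans _ _ (\sum_(j | e i j) ((4 * c0 / eps + 2 * eta) * nsq (G2 j i) + 2 / eta * nsq (G H j i)
  + (2 * (normc (G2 i i) * normc (G H j j)) + 2 * (normc (G2 j j) * normc (G H i i)))))).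
    by apply: ler_sum => j _; exact: pair_drift_le.
  rewrite big_split/= lerD2r big_split/= -!mulr_sumr lerD// ler_wpM2l//.
    by rewrite addr_ge0 ?divr_ge0 ?mulr_ge0 ?(ltW w_gt0) ?(ltW eps_gt0).
  by rewrite divr_ge0 ?(ltW w_gt0).
rewrite lerD//.
  rewrite mulr_sumr; apply: ler_sum => i _; apply/ler_of_eq.
  by field; rewrite !gt_eqF.
by move: Yle; rewrite -mulrA; move: (eta^-1 * _) => y; lra.
Qed.

End Deterministic.
End PairDrift.

(** * Expectation of the drift *)

Section ExpectedDrift.
Variables (R : realType) (N : nat) (K : finType) (p q : K -> 'I_N) (w : R[i]).
Local Notation cfg := (cfg R K).
Hypothesis w_gt0 : 0 < complex.Im w.
Local Notation eta := (complex.Im w).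
Local Notation G := (resolvent w).
Local Opaque resolvent.
Notation gauss := (normal_prob (0 : R) 1).
Variable mu : probability cfg R.
Hypothesis mu_box : forall A : K -> set R, (forall k, measurable (A k)) ->
  mu (box A) = (\prod_k gauss (A k))%E.
Variables (a : K -> R) (diag : 'I_N -> K).
Hypothesis diagE : forall b, [/\ p (diag b) = b, q (diag b) = b & a (diag b) = Num.sqrt 2].
Variables (c0 eps : R).
Hypotheses (c0_ge0 : 0 <= c0) (eps_gt0 : 0 < eps).
Variable e : rel 'I_N.
Hypothesis e_sym : symmetric e.
Variables (s : nat) (y0 : R) (l : nat).
Hypotheses (y0_gt0 : 0 < y0) (etaE : eta = y0 / 2 ^+ l).
Hypothesis e_card : forall i, (#|[pred j | e i j]| <= s)%N.
Local Notation H x := (gmx p q a x).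
Local Notation L := (y0^-1 + l%:R * pi).

Lemma measurable_pair_drift i j : measurable_fun [set: cfg] (fun x => pair_drift w c0 eps (H x) i j).
Proof.
apply: measurable_funD.
  apply: measurable_funM => //; apply: measurable_funM => //.
  by apply: measurable_funX; exact: measurable_T1.
by apply: measurableT_comp => //; exact: measurable_T2.
Qed.

Lemma integral_block_normc_le i :
  (\int[mu]_x (\sum_(j | e i j) normc (G (H x) j j))%:E <= (s%:R * L)%:E)%E.
Proof.
have L0 : 0 <= L by rewrite addr_ge0 ?invr_ge0 ?(ltW y0_gt0)// mulr_ge0// ltW// pi_gt0.
under eq_integral do rewrite big_mkcond -sumEFin.
rewrite ge0_integral_sum//; last 2 first.
- move=> j; apply/measurable_EFinP; case: (e i j) => //.
  exact: measurable_normc_gmx.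
- by move=> j x _; case: (e i j) => //; rewrite lee_fin normc_ge0.
apply: (@le_trans _ _ (\sum_j (if e i j then L else 0)%:E)%E).
  apply: lee_sum => j _; case: (e i j); last by rewrite integral0.
  exact: (integral_normc_resolvent_le w_gt0 mu_box diagE).
rewrite sumEFin lee_fin -big_mkcond sumr_const -[L *+ _]mulr_natl ler_wpM2r// ler_nat.
exact: e_card.
Qed.

(** The constant 12 is the 4 already multiplying [1 / eta ^+ 2], plus 8 from [4 / eta] times the
    oscillation [2 / eta] of the decoupling. *)
Lemma expected_pair_drift_le :
  (\int[mu]_x (\sum_i \sum_(j | e i j) pair_drift w c0 eps (H x) i j)%:E <=
  (N%:R * pi * (4 * c0 / (eps * eta ^+ 3) + 12 / eta ^+ 2 + 4 / eta * (s%:R * L)))%:E)%E.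
Proof.
have e0 : 0 <= eta by exact: ltW.
pose A := 4 * c0 / (eps * eta ^+ 3) + 4 / eta ^+ 2.
have A0 : 0 <= A.
  by rewrite addr_ge0 ?divr_ge0 ?mulr_ge0 ?exprn_ge0// ltW.
have B0 : 0 <= 4 / eta by rewrite divr_ge0.
pose I i x := complex.Im (G (H x) i i).
pose X i x := \sum_(j | e i j) normc (G (H x) j j).
have I0 i x : 0 <= I i x by apply: Im_resolvent_ge0 => //; exact: gmx_tr.
have X0 i x : 0 <= X i x by rewrite sumr_ge0// => *; exact: normc_ge0.
have mI i : measurable_fun [set: cfg] (I i) by exact: measurable_Im_gmx.
have mX i : measurable_fun [set: cfg] (X i).
  rewrite (_ : X i = fun x => \sum_j if e i j then normc (G (H x) j j) else 0); last first.
    by apply/funext => x; rewrite /X big_mkcond.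
  by apply: measurable_sum => j; case: (e i j) => //; exact: measurable_normc_gmx.
have mIX i : measurable_fun [set: cfg] (fun x => I i x * X i x) by exact: measurable_funM.
apply: (@le_trans _ _ (\int[mu]_x (A%:E * \sum_i (I i x)%:E + (4 / eta)%:E * \sum_i (I i x * X i x)%:E))%E).
  apply: ge0_le_integral => //.
  - move=> x _; rewrite lee_fin sumr_ge0// => i _; rewrite sumr_ge0// => j _.
    exact: pair_drift_ge0.
  - apply/measurable_EFinP; apply: measurable_sum => i.
    rewrite (_ : (fun x => _) = fun x => \sum_j if e i j then pair_drift w c0 eps (H x) i j else 0); last first.
      by apply/funext => x; rewrite big_mkcond.
    by apply: measurable_sum => j; case: (e i j) => //; exact: measurable_pair_drift.
  - apply: emeasurable_funD; apply: emeasurable_funM => //; apply: emeasurable_sum => i.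
      by apply/measurable_EFinP; exact: mI.
    by apply/measurable_EFinP; exact: mIX.
  move=> x _; rewrite !sumEFin -!EFinM -EFinD lee_fin.
  by apply: sum_pair_drift_le => //; exact: gmx_tr.
rewrite ge0_integralD//; last 4 first.
- by move=> x _; rewrite mule_ge0 ?lee_fin// sume_ge0// => i _; rewrite lee_fin.
- apply: emeasurable_funM => //; apply: emeasurable_sum => i.
  by apply/measurable_EFinP; exact: mI.
- by move=> x _; rewrite mule_ge0 ?lee_fin// sume_ge0// => i _; rewrite lee_fin mulr_ge0.
- apply: emeasurable_funM => //; apply: emeasurable_sum => i.
  by apply/measurable_EFinP; exact: mIX.
rewrite ge0_integralZl//; last 2 first.
- by apply: emeasurable_sum => i; apply/measurable_EFinP; exact: mI.
- by move=> x _; rewrite sume_ge0// => i _; rewrite lee_fin.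
rewrite ge0_integralZl//; last 2 first.
- by apply: emeasurable_sum => i; apply/measurable_EFinP; exact: mIX.
- by move=> x _; rewrite sume_ge0// => i _; rewrite lee_fin mulr_ge0.
rewrite ge0_integral_sum//; last 2 first.
- by move=> i; apply/measurable_EFinP; exact: mI.
- by move=> i x _; rewrite lee_fin.
rewrite ge0_integral_sum//; last 2 first.
- by move=> i; apply/measurable_EFinP; exact: mIX.
- by move=> i x _; rewrite lee_fin mulr_ge0.
have b1 : (\sum_i \int[mu]_x (I i x)%:E <= (N%:R * pi)%:E)%E.
  apply: (@le_trans _ _ (\sum_(i < N) pi%:E)%E).
    by apply: lee_sum => i _; exact: (wegner w_gt0 mu_box diagE).
  by rewrite sumEFin sumr_const card_ord mulr_natl.
have b2 : (\sum_i \int[mu]_x (I i x * X i x)%:E <= (N%:R * (pi * (s%:R * L + 2 / eta)))%:E)%E.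
  apply: (@le_trans _ _ (\sum_(i < N) (pi * (s%:R * L + 2 / eta))%:E)%E).
    apply: lee_sum => i _; apply: (integral_Im_mul_normc_le w_gt0 mu_box diagE).
    exact: integral_block_normc_le.
  by rewrite sumEFin sumr_const card_ord -[_ *+ N]mulr_natl.
apply: (@le_trans _ _ (A%:E * (N%:R * pi)%:E + (4 / eta)%:E * (N%:R * (pi * (s%:R * L + 2 / eta)))%:E)%E).
  by rewrite leeD// lee_wpmul2l ?lee_fin.
rewrite -!EFinM -EFinD lee_fin; apply/ler_of_eq; rewrite /A.
by field; rewrite !gt_eqF.
Qed.

Lemma sum_expected_pair_drift_le :
  \sum_i \sum_(j | e i j) \int[mu]_x pair_drift w c0 eps (H x) i j <=
  N%:R * pi * (4 * c0 / (eps * eta ^+ 3) + 12 / eta ^+ 2 + 4 / eta * (s%:R * L)).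
Proof.
have d0 i j x : 0 <= pair_drift w c0 eps (H x) i j by exact: pair_drift_ge0.
rewrite -lee_fin; apply: le_trans expected_pair_drift_le.
under eq_integral => x _.
  rewrite -sumEFin; under eq_bigr => i _ do rewrite -sumEFin big_mkcond.
  over.
have mj i j : measurable_fun [set: cfg] (fun x =>
    if e i j then (pair_drift w c0 eps (H x) i j)%:E else 0%E).
  by case: (e i j) => //; apply/measurable_EFinP; exact: measurable_pair_drift.
rewrite ge0_integral_sum//; last 2 first.
- by move=> i; apply: emeasurable_sum => j; exact: mj.
- by move=> i x _; rewrite sume_ge0// => j _; case: (e i j); rewrite ?lee_fin.
rewrite -sumEFin; apply: lee_sum => i _.
rewrite ge0_integral_sum//; last first.
- by move=> j x _; case: (e i j); rewrite ?lee_fin.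
rewrite -sumEFin big_mkcond; apply: lee_sum => j _.
case: (e i j); last by rewrite integral0.
have : (0 <= \int[mu]_x (pair_drift w c0 eps (H x) i j)%:E)%E.
  by apply: integral_ge0 => x _; rewrite lee_fin.
(* [fine] sends [+oo] to 0, so the comparison holds for an infinite integral too; nonnegativity
   excludes [-oo]. *)
rewrite /Rintegral; case: (\int[mu]_x _)%E => [r||]//= _.
Qed.

End ExpectedDrift.

(** * Summation over levels and the rate *)

Lemma sum_geometric_tail_le (R : realFieldType) (x : R) (m n : nat) : 0 <= x <= 2^-1 -> (m <= n)%N ->
  \sum_(r < n.+1 | (m < r)%N) x ^+ r <= x ^+ m.
Proof.
move=> /andP[x0 x1].
(* Carrying the last power along closes the induction: [x <= 1/2] gives
   [2 * x ^+ n.+1 <= x ^+ n]. *)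
suff h : (m <= n)%N -> \sum_(r < n.+1 | (m < r)%N) x ^+ r + x ^+ n <= x ^+ m.
  by move=> mn; rewrite (le_trans _ (h mn))// lerDl exprn_ge0.
elim: n => [|n ih].
  by rewrite leqn0 => /eqP ->; rewrite big1 ?add0r// => i; rewrite ltnNge -ltnS ltn_ord.
rewrite leq_eqVlt => /predU1P[->|].
  by rewrite big1 ?add0r// => i; rewrite ltnNge -ltnS ltn_ord.
rewrite ltnS => mn; rewrite big_mkcond big_ord_recr/= -big_mkcond ltnS mn.
rewrite (le_trans _ (ih mn))// -addrA lerD2l exprS.
by have := exprn_ge0 n x0; nra.
Qed.

(** The powers decrease, so [m * x ^+ m] is at most the sum of the first [m] of them, which is
    [(1 - x ^+ m) / (1 - x)]. *)
Lemma natr_exprn_le (R : realFieldType) (x : R) (m : nat) : 0 <= x < 1 ->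
  m%:R * x ^+ m <= (1 - x)^-1.
Proof.
move=> /andP[x0 x1]; have d0 : 0 < 1 - x by rewrite subr_gt0.
rewrite -div1r ler_pdivlMr//; suff h : m%:R * x ^+ m * (1 - x) <= 1 - x ^+ m.
  by rewrite (le_trans h)// gerBl exprn_ge0.
elim: m => [|m ih]; first by rewrite expr0 subrr mulr1 mul0r.
have y0 := exprn_ge0 m x0; have y1 := exprn_ile1 m x0 (ltW x1).
rewrite exprS -natr1; move: ih y0 y1; move: (x ^+ m) (m%:R) => y k ih y0 y1.
have h1 : x * (k * y * (1 - x)) <= x * (1 - y) by rewrite ler_wpM2l.
have h2 : x * y <= 1 by rewrite mulr_ile1// ltW.
have h3 : 0 <= (1 - x) * (1 - x * y) by rewrite mulr_ge0 ?subr_ge0// ltW.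
by lra.
Qed.

Section Rate.
Variables (R : realType) (rho y0 : R) (m n l : nat).
Hypotheses (rho_gt0 : 0 < rho) (rho_lt1 : rho < 1) (y0_gt0 : 0 < y0).
Hypotheses (mn : (m <= n)%N) (nl : (n <= l)%N).
Local Notation D := (2 ^+ (l - m) : R).
Local Notation c0 := ((2^-1) ^+ n : R).
Local Notation eta := (y0 / 2 ^+ l).
Local Notation L := (y0^-1 + l%:R * pi).
(** Both the smoothing width and the target bound; the smoothing therefore accounts for the summand
    1 in [rate_const]. *)
Definition rate : R := 2 ^+ (l - m) ^+ 3 * rho ^+ m.
Definition rate_const : R := 1 + 2 * pi * (4 / y0 ^+ 3 + 12 / y0 ^+ 2 +
   4 / y0 * (y0^-1 + pi * ((1 - rho)^-1 + 1))).

Lemma rate_gt0 : 0 < rate.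
Proof. by rewrite mulr_gt0 ?exprn_gt0. Qed.

Lemma rate_le :
  rate + \sum_(r < n.+1 | (m < r)%N) 2 * (rho ^+ 2 / 4) ^+ r *
     (pi * (4 * c0 / (rate * eta ^+ 3) + 12 / eta ^+ 2 + 4 / eta * ((2 ^ r)%:R * L)))
  <= rate_const * rate.
Proof.
have ml : (m <= l)%N by exact: leq_trans nl.
have D1 : 1 <= D by rewrite exprn_ege1 ?ler1n.
have D0 : 0 < D by rewrite (lt_le_trans _ D1).
have y00 : 0 < y0^-1 by rewrite invr_gt0.
have pi0 : 0 < pi :> R by exact: pi_gt0.
have L0 : 0 <= L by rewrite addr_ge0 ?(ltW y00)// mulr_ge0// ltW.
have E2 : 2 ^+ l = D * 2 ^+ m :> R by rewrite -exprD subnK.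
pose A := 4 * c0 / (rate * eta ^+ 3) + 12 / eta ^+ 2.
have eta0 : 0 < eta by rewrite divr_gt0 ?exprn_gt0.
have A0 : 0 <= A.
  rewrite addr_ge0// divr_ge0//; last by rewrite exprn_ge0// ltW.
  by rewrite mulr_ge0 ?exprn_ge0// ltW// rate_gt0.
have r0 := rate_gt0.
have rm0 : 0 < rho ^+ m by rewrite exprn_gt0.
have rm1 : rho ^+ m <= 1 by rewrite exprn_ile1 ?ltW.
have rr : rho ^+ 2 <= 1 by rewrite exprn_ile1 ?ltW.
have q1 : 0 <= rho ^+ 2 / 4 <= 2^-1.
  rewrite divr_ge0 ?sqr_ge0//=.
  by move: rr; lra.
have q2 : 0 <= rho ^+ 2 / 2 <= 2^-1.
  rewrite divr_ge0 ?sqr_ge0//=.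
  by move: rr; lra.
have S : \sum_(r < n.+1 | (m < r)%N) 2 * (rho ^+ 2 / 4) ^+ r *
     (pi * (4 * c0 / (rate * eta ^+ 3) + 12 / eta ^+ 2 + 4 / eta * ((2 ^ r)%:R * L)))
   <= 2 * pi * (A * (rho ^+ 2 / 4) ^+ m + 4 / eta * L * (rho ^+ 2 / 2) ^+ m).
  (* The block size [2 ^ r] in the last term raises the ratio from [rho ^+ 2 / 4] to [rho ^+ 2 / 2];
     both are at most 1/2, so each tail is controlled by its power at [m]. *)
  apply: (@le_trans _ _ (2 * pi * (A * (\sum_(r < n.+1 | (m < r)%N) (rho ^+ 2 / 4) ^+ r) +
      4 / eta * L * \sum_(r < n.+1 | (m < r)%N) (rho ^+ 2 / 2) ^+ r))).
    rewrite !mulr_sumr -big_split/= mulr_sumr; apply: ler_sum => r _; apply/ler_of_eq.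
    rewrite (_ : rho ^+ 2 / 2 = rho ^+ 2 / 4 * 2); last by lra.
    rewrite -/A natrX [(_ * 2) ^+ r]exprMn; move: ((rho ^+ 2 / 4) ^+ r) (2 ^+ r) (2 ^+ l) => X Y Z; ring.
  have p2 : 0 <= 2 * pi :> R by rewrite mulr_ge0 ?ltW.
  rewrite ler_wpM2l// lerD// ler_wpM2l ?sum_geometric_tail_le//.
  by rewrite mulr_ge0// divr_ge0 ?ltW.
rewrite (le_trans (lerD (lexx _) S))// /rate_const [leRHS]mulrDl mul1r lerD2l -[leRHS]mulrA.
rewrite ler_pM2l ?mulr_gt0//.
have M0 : 0 < 2 ^+ m :> R by rewrite exprn_gt0.
have mE : 2 ^+ m != 0 :> R by rewrite gt_eqF.
have De : D != 0 by rewrite gt_eqF.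
have ye : y0 != 0 by rewrite gt_eqF.
have rme : rho ^+ m != 0 by rewrite gt_eqF.
have q4 : (rho ^+ 2 / 4) ^+ m = (rho ^+ m) ^+ 2 / (2 ^+ m) ^+ 2.
  rewrite (_ : 4 = 2 ^+ 2 :> R); last by rewrite -natrX.
  by rewrite exprMn exprVn -!exprM (mulnC 2).
have q5 : (rho ^+ 2 / 2) ^+ m = (rho ^+ m) ^+ 2 / 2 ^+ m.
  by rewrite exprMn exprVn -!exprM (mulnC 2).
rewrite q4 q5 /A /rate E2.
(* In the [eps^-1] term [eta ^+ 3] leaves [2 ^+ (3 * m)] against a variance of order [4^-m]; the
   normalization [2^-n], with [m <= n], cancels the remaining [2 ^+ m]. *)
have c0le : c0 <= (2 ^+ m)^-1.
  by rewrite -exprVn ler_wiXn2l// invf_le1// ler1n.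
(* The logarithmic factor [l] splits: [m] is absorbed by one [rho ^+ m], and [l - m <= 2 ^ (l - m)]
   by a power of [D] left over from [D ^+ 3]. *)
have Dl : l%:R <= m%:R + D :> R.
  by rewrite -{1}(subnKC ml) natrD lerD2l -natrX ler_nat ltnW// ltn_expl.
have mr : m%:R * rho ^+ m <= (1 - rho)^-1 by apply: natr_exprn_le; rewrite ltW.
move: (D) (2 ^+ m) (rho ^+ m) (c0) => d M r c in D1 D0 M0 mE De rm0 rm1 rme c0le Dl mr *.
set k := (1 - rho)^-1 in mr *; have k0 : 0 <= k by rewrite (le_trans _ mr)// mulr_ge0// ltW.
have d3 : 1 <= d ^+ 3 by rewrite exprn_ege1.
have d23 : d ^+ 2 <= d ^+ 3 by rewrite [leRHS]exprS ler_peMl// sqr_ge0.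
have cM : c * M <= 1 by rewrite -ler_pdivlMr// div1r.
have rL : r * L <= d * (y0^-1 + pi * (k + 1)).
  apply: (@le_trans _ _ (1 * (d * y0^-1) + (d * k + d) * pi)); last by apply/ler_of_eq; ring.
  rewrite mulrDr lerD//; first by rewrite ler_pM ?(ltW rm0) ?ler_peMl ?(ltW y00).
  rewrite mulrA ler_wpM2r ?(ltW pi0)//.
  have h1 : r * l%:R <= r * (m%:R + d) by rewrite ler_wpM2l// ltW.
  have h2 : k <= d * k by rewrite ler_peMl.
  have h3 : r * d <= d by rewrite ler_piMl// ltW.
  by rewrite (le_trans h1)// mulrDr lerD// mulrC (le_trans mr).
apply: (@le_trans _ _ (4 / y0 ^+ 3 * (c * M * r) + 12 / y0 ^+ 2 * (d ^+ 2 * (r * r))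
    + 4 / y0 * (d * r * (r * L)))).
  by apply/ler_of_eq; field; rewrite ye De mE rme.
rewrite [leRHS]mulrDl [X in _ <= X + _]mulrDl; apply: lerD; first apply: lerD.
- rewrite ler_pM2l ?divr_gt0 ?exprn_gt0// ler_wpM2r ?(ltW rm0)//.
  exact: le_trans d3.
- rewrite ler_pM2l ?divr_gt0 ?exprn_gt0//.
  by rewrite ler_pM ?sqr_ge0 ?mulr_ge0 ?(ltW rm0)// ler_piMl// ltW.
rewrite -[leRHS]mulrA ler_pM2l ?divr_gt0//.
apply: (@le_trans _ _ (d * r * (d * (y0^-1 + pi * (k + 1))))).
  by rewrite ler_wpM2l// mulr_ge0// ltW.
rewrite (_ : _ * _ * _ = (y0^-1 + pi * (k + 1)) * (d ^+ 2 * r)); last by ring.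
have p0 : 0 <= y0^-1 + pi * (k + 1).
  by rewrite addr_ge0 ?(ltW y00)// mulr_ge0 ?(ltW pi0)// addr_ge0.
by rewrite ler_wpM2l// ler_wpM2r// ltW.
Qed.
End Rate.

(** * The hierarchical model *)

Definition same_block (N r : nat) : rel 'I_N := fun i j => (i %/ 2 ^ r == j %/ 2 ^ r)%N.

Lemma same_block_sym N r : symmetric (@same_block N r).
Proof. by move=> i j; rewrite /same_block eq_sym. Qed.

(** Within a block the residue modulo [2 ^ r] determines the index. *)
Lemma card_same_block N r (i : 'I_N) : (#|[pred j | same_block r i j]| <= 2 ^ r)%N.
Proof.
have r0 : (0 < 2 ^ r)%N by rewrite expn_gt0.
pose f (j : 'I_N) : 'I_(2 ^ r) := Ordinal (ltn_pmod j r0).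
rewrite -(card_ord (2 ^ r)) -(@card_in_imset _ _ f); first exact: max_card.
move=> j k; rewrite !inE /same_block => /eqP ij /eqP ik /(congr1 val)/= e.
by apply/val_inj; rewrite /= (divn_eq j (2 ^ r)) (divn_eq k (2 ^ r)) e -ij -ik.
Qed.

Lemma hdist_sym n i j : hdist n i j = hdist n j i.
Proof. by apply: eq_find => r; rewrite eq_sym. Qed.

Lemma hdist_le_block n r (i j : Bn n) : (r <= n)%N -> (hdist n i j <= r)%N -> same_block r i j.
Proof.
rewrite /hdist /same_block => rn; set P := fun _ => _ => h.
(* [find] returns the length [n.+1] on failure, so [r <= n] certifies that the search in [hdist]
   succeeds. *)
have hn : (find P (iota 0 n.+1) < n.+1)%N by rewrite (leq_ltn_trans h).
have hP : has P (iota 0 n.+1) by rewrite has_find size_iota.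
have := nth_find 0%N hP; rewrite /P nth_iota// add0n => /eqP e.
rewrite -(subnKC h) expnD !divnMA.
by move: e; rewrite /P => ->.
Qed.

Lemma phi_sdC (R : realType) n r (i j : Bn n) : phi_sd R r i j = phi_sd R r j i.
Proof. by rewrite /phi_sd eq_sym hdist_sym. Qed.

Lemma sqr_phi_sd_le (R : realType) n r (i j : Bn n) : (r <= n)%N ->
  phi_sd R r i j ^+ 2 <= if same_block r i j then 2 * (2^-1) ^+ r else 0.
Proof.
move=> rn; have h0 : 0 <= (2^-1) ^+ r :> R by rewrite exprn_ge0.
rewrite /phi_sd; case: eqVneq => [->|_].
  by rewrite /same_block eqxx sqr_sqrtr// mulr_ge0.
case: ifP => [/andP[_ hr]|_].
  by rewrite hdist_le_block// sqr_sqrtr// ler_peMl// ler1n.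
by rewrite expr0n/=; case: ifP => _ //; rewrite mulr_ge0.
Qed.

Lemma sym_unitE (S : pzSemiRingType) N (p q i j : 'I_N) :
  sym_unit S p q i j = ((i == p) && (j == q) || (i == q) && (j == p))%:R.
Proof.
rewrite /sym_unit; case: eqVneq => [->|pq]; first by rewrite mxE orbb.
rewrite !mxE; case: eqVneq => [->|]; last by rewrite add0r.
by rewrite (negbTE pq) addr0 orbF.
Qed.

(** Support on the upper triangle keeps an off-diagonal pair from being counted twice; this matches
    sums of symmetric units with the symmetrized entries of [Phi]. *)
Lemma sum_sym_unit (S : comNzRingType) N (F : 'I_N -> 'I_N -> S) (i j : 'I_N) :
  (forall p q : 'I_N, (q < p)%N -> F p q = 0) ->
  (\sum_p \sum_q F p q *: sym_unit S p q) i j = if (i <= j)%N then F i j else F j i.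
Proof.
move=> F0; wlog ij : i j / (i <= j)%N => [h|].
  have [ij|ji] := leqP i j; first by rewrite h// ij.
  transitivity ((\sum_p \sum_q F p q *: sym_unit S p q)^T j i); first by rewrite [RHS]mxE.
  rewrite (_ : _^T = \sum_p \sum_q F p q *: sym_unit S p q).
    by rewrite h ltnW.
  rewrite linear_sum; apply: eq_bigr => p _; rewrite linear_sum; apply: eq_bigr => q _.
  by rewrite linearZ/= sym_unit_tr.
rewrite ij summxE (bigD1 i)//= summxE (bigD1 j)//= mxE sym_unitE !eqxx/= mulr1.
have z p q : (p, q) != (i, j) -> (F p q *: sym_unit S p q) i j = 0.
  move=> npq; rewrite mxE sym_unitE; have [/F0->|pq] := ltnP q p; first by rewrite mul0r.
  rewrite (eq_sym i p) (eq_sym j q) -xpair_eqE (negbTE npq)/=.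
  have [iq|_] := eqVneq i q; last by rewrite mulr0.
  have [jp|_] := eqVneq j p; last by rewrite mulr0.
  have e : i = j by apply/val_inj/anti_leq; rewrite ij iq jp pq.
  by case/eqP: npq; rewrite -iq -jp e.
rewrite big1 ?addr0; last by move=> q jq; rewrite z// xpair_eqE negb_and jq orbT.
rewrite big1 ?addr0// => p ip; rewrite summxE big1// => q _.
by rewrite z// xpair_eqE negb_and ip.
Qed.

Lemma sum_Idx (V : nmodType) n (F : Idx n -> V) :
  \sum_k F k = \sum_(r < n.+1) \sum_(i < 2 ^ n) \sum_(j < 2 ^ n) F (r, i, j).
Proof. by rewrite pair_bigA/= pair_bigA/=; apply: eq_bigr => -[[r i] j]. Qed.

Section Coefficients.
Variables (R : realType) (c : R) (n : nat).
Local Notation row := (fun k : Idx n => k.1.2).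
Local Notation col := (fun k : Idx n => k.2).

Definition scale (r : nat) : R := powR 2 (- ((1 + c) * r%:R) / 2).

(** [Q] selects levels, so the truncations and the part between them share one index set; the order
    condition gives each entry and level exactly one Gaussian. *)
Definition coef (Q : pred nat) (k : Idx n) : R :=
  if (k.1.2 <= k.2)%N && Q k.1.1 then scale k.1.1 * phi_sd R k.1.1 k.1.2 k.2 else 0.

Lemma sqr_scale r : scale r ^+ 2 = (powR 2 (- (c / 2)) ^+ 2 / 2) ^+ r.
Proof.
have pX x k : powR 2 x ^+ k = powR 2 (x * k%:R) :> R.
  by rewrite powRrM powR_mulrn ?powR_ge0.
set y := - (c / 2).
rewrite /scale -[in RHS](powR_inv1 (ler0n R 2)) !pX -powRD ?pnatr_eq0 ?implybT// pX; congr powR.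
by rewrite /y; field.
Qed.

(** The squared level scale is [(rho ^+ 2 / 2) ^+ r] with [rho = 2^(- c / 2)]; the entry variance of
    [Phi], at most [2 * 2^-r], turns the ratio into [rho ^+ 2 / 4]. *)
Lemma sqr_coef_le Q k : coef Q k ^+ 2 <=
  if Q k.1.1 && same_block k.1.1 k.1.2 k.2
  then 2 * (powR 2 (- (c / 2)) ^+ 2 / 4) ^+ k.1.1 else 0.
Proof.
case: k => [[r i] j]/=; rewrite /coef/=.
have p0 : 0 <= powR 2 (- (c / 2)) ^+ 2 :> R by exact: sqr_ge0.
have h0 : 0 <= 2 * (powR 2 (- (c / 2)) ^+ 2 / 4) ^+ r :> R.
  by rewrite mulr_ge0// exprn_ge0// divr_ge0.
case: (Q r); last by rewrite andbF expr0n.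
rewrite andbT/=; case: ifP => _; last by rewrite expr0n/=; case: ifP.
rewrite exprMn sqr_scale.
have rn : (r <= n)%N by rewrite -ltnS.
have h := sqr_phi_sd_le R i j rn.
have h1 : 0 <= (powR 2 (- (c / 2)) ^+ 2 / 2) ^+ r :> R by rewrite exprn_ge0// divr_ge0.
rewrite (le_trans (ler_wpM2l h1 h))//.
case: ifP => _; last by rewrite mulr0.
rewrite mulrCA ler_wpM2l// -exprMn; apply/ler_of_eq; congr (_ ^+ _).
by field.
Qed.

Lemma Hnm_gmx d (T : measurableType d) (m : nat) (g : Idx n -> T -> R) t :
  Hnm c n m g t = gmx row col (coef (fun r => r <= m)%N) (fun k => g k t).
Proof.
rewrite /Hnm /gmx sum_Idx big_mkcond/=; apply: eq_bigr => r _.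
rewrite /coef/=; case: ifP => rm; last first.
  rewrite big1// => i _; rewrite big1// => j _.
  by rewrite andbF mul0r scale0r.
apply/matrixP => i j.
rewrite [RHS](sum_sym_unit (F := fun i j => (if (i <= j)%N && true then scale r * phi_sd R r i j else 0) *
   g (r, i, j) t)); last by move=> p q; rewrite ltnNge => /negbTE ->; rewrite mul0r.
rewrite !mxE; case: ifP => ij/=; first by rewrite mulrA.
by rewrite ltnW ?ltnNge ?ij//= phi_sdC mulrA.
Qed.
End Coefficients.

Section Gap.
Variables (R : realType) (c : R) (n m l : nat) (w : R[i]) (y0 : R).
Hypotheses (c_gt0 : 0 < c) (y0_gt0 : 0 < y0) (wE : complex.Im w = y0 / 2 ^+ l).
Hypotheses (mn : (m <= n)%N) (nl : (n <= l)%N).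
Local Notation row := (fun k : Idx n => k.1.2).
Local Notation col := (fun k : Idx n => k.2).
Local Notation cfg := (cfg R (Idx n)).
Variable mu : probability cfg R.
Hypothesis mu_box : forall A : Idx n -> set R, (forall k, measurable (A k)) ->
  mu (box A) = (\prod_k normal_prob 0 1 (A k))%E.
Local Notation lo := (coef c (n := n) (fun r => r <= m)%N).
Local Notation hi := (coef c (n := n) (fun r => m < r)%N).
Local Notation rho := (powR 2 (- (c / 2)) : R).
Local Notation c0 := ((2^-1) ^+ n : R).
Local Notation eps := (rate rho m l).

Let w_gt0 : 0 < complex.Im w.
Proof. by rewrite wE divr_gt0 ?exprn_gt0. Qed.

Let rho_gt0 : 0 < rho. Proof. exact: powR_gt0. Qed.

Let rho_lt1 : rho < 1.
Proof.
have c2 : 0 < c / 2 by rewrite divr_gt0.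
have := @gt0_ltr_powR R _ c2 1 2; rewrite !nnegrE powR1 => h.
by rewrite powRN invf_lt1 ?powR_gt0// h// ltr1n.
Qed.

Let eps_gt0 : 0 < eps. Proof. exact: rate_gt0. Qed.

(** The level of a Gaussian is either at most [m] or above it. *)
Let disjoint_coef k : lo k * hi k = 0.
Proof.
rewrite /coef; case: (k.1.2 <= k.2)%N; rewrite ?mul0r//=.
by case: leqP; rewrite ?mul0r ?mulr0.
Qed.

Let diag (b : Bn n) : Idx n := (ord0, b, b).

(** Level 0 lies in the fixed part for every [m], so this coefficient is constant along the
    interpolation and the averaged resolvent bounds are uniform in [u]. *)
Let diag_coef u b : [/\ row (diag b) = b, col (diag b) = b &
  (fun k => lo k + u * hi k) (diag b) = Num.sqrt 2].
Proof.
split => //; rewrite /coef/= leqnn/= mulr0 addr0 /scale mulr0 oppr0 mul0r powRr0.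
by rewrite mul1r /phi_sd eqxx expr0 mulr1.
Qed.

Let drift_bound u : 0 <= u <= 1 ->
  c0 * \sum_k (hi k ^+ 2 * \int[mu]_x drift row col w lo hi c0 eps u k x) <=
  \sum_(r < n.+1 | (m < r)%N) 2 * (rho ^+ 2 / 4) ^+ r *
     (pi * (4 * c0 / (eps * (y0 / 2 ^+ l) ^+ 3) + 12 / (y0 / 2 ^+ l) ^+ 2 +
        4 / (y0 / 2 ^+ l) * ((2 ^ r)%:R * (y0^-1 + l%:R * pi)))).
Proof.
move=> _; set H := gmx row col (fun k => lo k + u * hi k).
have c00 : 0 <= c0 by rewrite exprn_ge0.
pose I i j := \int[mu]_x pair_drift w c0 eps (H x) i j.
have I0 i j : 0 <= I i j by apply: Rintegral_ge0 => x _; exact: pair_drift_ge0.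
have q0 : 0 <= rho ^+ 2 / 4 by rewrite divr_ge0 ?sqr_ge0.
apply: (@le_trans _ _ (c0 * \sum_(r < n.+1 | (m < r)%N) 2 * (rho ^+ 2 / 4) ^+ r *
   \sum_i \sum_(j | same_block r i j) I i j)).
  rewrite ler_wpM2l//.
  apply: (@le_trans _ _ (\sum_(k : Idx n) (if (m < k.1.1)%N && same_block k.1.1 k.1.2 k.2
      then 2 * (rho ^+ 2 / 4) ^+ k.1.1 else 0) * I k.1.2 k.2)).
    by apply: ler_sum => k _; rewrite ler_wpM2r ?I0// (sqr_coef_le c (fun r => m < r)%N).
  apply/ler_of_eq; rewrite sum_Idx/= [RHS]big_mkcond.
  apply: eq_bigr => r _; case: (m < r)%N => /=; last first.
    by rewrite big1// => i _; rewrite big1// => j _; rewrite mul0r.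
  rewrite mulr_sumr; apply: eq_bigr => i _; rewrite mulr_sumr [RHS]big_mkcond.
  by apply: eq_bigr => j _; case: ifP; rewrite ?mul0r.
rewrite mulr_sumr; apply: ler_sum => r _.
rewrite mulrCA ler_wpM2l ?mulr_ge0 ?exprn_ge0//.
have := @sum_expected_pair_drift_le _ _ _ row col _ w_gt0 _ mu_box _ _ (diag_coef u) _ _
  c00 eps_gt0 _ (@same_block_sym _ r) _ _ _ y0_gt0 wE (@card_same_block _ r).
rewrite -/(H _) => h; rewrite (le_trans (ler_wpM2l c00 h))//.
(* The normalization of the trace cancels the number [2 ^ n] of rows in the drift bound. *)
have cE : c0 * (2 ^ n)%:R = 1 by rewrite natrX -exprMn mulVf ?pnatr_eq0// expr1n.
by rewrite wE -[(2 ^ n)%:R * pi * _]mulrA [leLHS]mulrA cE mul1r.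
Qed.

Lemma expected_gap_le :
  (\int[mu]_x `|nuP (gmx row col (coef c (fun r => r <= n)%N) x) w - nuP (gmx row col lo x) w|%:E
   <= (rate_const rho y0 * eps)%:E)%E.
Proof.
have c00 : 0 <= c0 by rewrite exprn_ge0.
apply: le_trans (_ : (eps + _)%:E <= _)%E; last first.
  by rewrite lee_fin; exact: (rate_le rho_gt0 rho_lt1 y0_gt0 mn nl).
have := interpolation_le w_gt0 mu_box disjoint_coef c00 eps_gt0 drift_bound.
apply: le_trans; rewrite le_eqVlt; apply/orP; left; apply/eqP.
apply: eq_integral => x _; congr (`|_|%:E).
rewrite !(nuPE w_gt0); try exact: gmx_tr.
rewrite /trace_gap -mulrBr; congr (_ * (_ - _)); congr (T0 w (gmx _ _ _ x)).
  apply/funext => k; have kn : (k.1.1 <= n)%N by rewrite -ltnS.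
  rewrite mul1r /coef kn; case: (_ <= _)%N => //=; last by rewrite addr0.
  by case: leqP; rewrite ?addr0 ?add0r.
by apply/funext => k; rewrite mul0r addr0.
Qed.

End Gap.

(** * Transfer to an arbitrary Gaussian family and conclusion *)

Lemma measurable_nuP_gmx (R : realType) n (K : finType) (p q : K -> 'I_(2 ^ n)) (w : R[i]) a :
  0 < complex.Im w ->
  measurable_fun [set: cfg R K] (fun x => nuP (gmx p q a x) w).
Proof.
move=> w0; rewrite (_ : (fun _ => _) = fun x => (2^-1) ^+ n * T0 w (gmx p q a x)).
  by apply: measurable_funM => //; exact: measurable_T0.
by apply/funext => x; rewrite (nuPE w0)//; exact: gmx_tr.
Qed.

(** The estimates know the law only through box probabilities, so they apply to the distribution of
    the configuration under [P], whose box probabilities come from independence and normality of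
    [g]. *)
Lemma expectation_gaussian_field d (T : measurableType d) (R : realType) (P : probability T R)
    n (g : Idx n -> T -> R) (f : cfg R (Idx n) -> R) (b : \bar R) :
  iid_std_normal P g -> measurable_fun setT f -> (forall x, 0 <= f x) ->
  (forall mu : probability (cfg R (Idx n)) R,
    (forall A : Idx n -> set R, (forall k, measurable (A k)) ->
      mu (box A) = (\prod_k normal_prob 0 1 (A k))%E) -> (\int[mu]_x (f x)%:E <= b)%E) ->
  ('E_P[fun t => f (fun k => g k t)] <= b)%E.
Proof.
move=> [mg [gN gP]] mf f0 fb.
have mG : (fun t k => g k t : R) \in @mfun _ _ T (cfg R (Idx n)).
  by rewrite inE/=; apply: measurable_to_cfg => k; exact: mg.
have := fb (distribution P (mfun_Sub mG)).
rewrite ge0_integral_distribution//; last exact/measurable_EFinP.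
rewrite expectation.unlock; apply => A mA.
rewrite (eq_bigr (fun k => P (g k @^-1` A k))); last by move=> k _; rewrite gN.
exact: (gP A mA).
Qed.

Theorem theorem5p2 (R : realType) (c E : R) (z : R[i]) :
  0 < c -> 0 < complex.Im z ->
  exists (Cz delta : R), 0 < delta /\
  forall (m n l : nat), (m <= n)%N -> (n <= l)%N ->
  forall (d : measure_display) (T : measurableType d) (P : probability T R)
         (g : Idx n -> T -> R),
    iid_std_normal P g ->
    let zl : R[i] := (E%:C + ((2 ^-1) ^+ l)%:C * z)%C in
    ('E_P[fun t => `| nuP (Hnm c n n g t) zl - nuP (Hnm c n m g t) zl |%R]
       <= (Cz * powR 2 (3 * (l%:R - (1 + delta) * m%:R)))%:E)%E.
Proof.
move=> c0 z0; pose y0 := complex.Im z; pose rho : R := powR 2 (- (c / 2)).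
exists (rate_const rho y0), (c / 6); split; first by rewrite divr_gt0.
move=> m n l mn nl d T P g gN; cbv zeta; set zl : R[i] := (_ + _)%C.
have zlE : complex.Im zl = y0 / 2 ^+ l.
  by rewrite /zl Imc_add Imc_mul/= mul0r addr0 add0r exprVn mulrC.
have w0 : 0 < complex.Im zl by rewrite zlE divr_gt0 ?exprn_gt0.
have -> : powR 2 (3 * (l%:R - (1 + c / 6) * m%:R)) = rate rho m l :> R.
  have ml := leq_trans mn nl.
  rewrite /rate /rho -!powR_mulrn ?powR_ge0 ?exprn_ge0// -!powRrM -powRD ?pnatr_eq0 ?implybT//.
  by congr powR; rewrite natrB//; field.
pose f (x : cfg R (Idx n)) : R := `|nuP (gmx (fun k : Idx n => k.1.2) (fun k => k.2)
     (coef c (fun r => r <= n)%N) x) zl -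
   nuP (gmx (fun k : Idx n => k.1.2) (fun k => k.2) (coef c (fun r => r <= m)%N) x) zl|.
rewrite (_ : (fun t => _) = fun t => f (fun k => g k t)); last first.
  by apply/funext => t; rewrite /f -!Hnm_gmx.
apply: (expectation_gaussian_field gN) => [||mu mu_box].
- by apply: measurableT_comp => //; apply: measurable_funB; exact: measurable_nuP_gmx.
- by move=> x; exact: normr_ge0.
exact: (expected_gap_le c0 z0 zlE mn nl mu_box).
Qed.
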